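(* Let $\{X(t)\}_{t\ge 0}$ be the stochastic replicator process with payoff matrix $A\in\mathbb{R}^{n\times n}$, noise parameters $\sigma_1,\dots,\sigma_n$ and initial value $\mathbf{x}_0\in\operatorname{int}\Delta$, and let $\tilde A=(a_{ij}-\tfrac12\sigma_i^2)_{i,j}$. If there does not exist $\mathbf{p}\in\Delta$ such that $\{\tilde A\mathbf{p}\}_1=\cdots=\{\tilde A\mathbf{p}\}_n$, then $\{X(t)\}$ is transient.
   Context: Setting. $n\ge2$; $A=(a_{ij})\in\mathbb{R}^{n\times n}$ is an arbitrary payoff matrix; $\sigma_1,\dots,\sigma_n>0$; $W=(W_1,\dots,W_n)^T$ is a standard $n$-dimensional Brownian motion (independent components). $\Delta=\{\mathbf{y}\in[0,1]^n:y_1+\cdots+y_n=1\}$, $\operatorname{int}\Delta=\{\mathbf{y}\in\Delta: y_i>0\ \forall i\}$ and $\operatorname{bd}\Delta=\Delta\setminus\operatorname{int}\Delta$. The stochastic replicator process $\{X(t)\}$ is a strong solution of the Itô equation $$dX(t)=\mathbf{b}(X(t))\,dt+C(X(t))\,dW(t),\qquad X(0)=\mathbf{x}_0\in\operatorname{int}\Delta,$$ with $\mathbf{b}(\mathbf{x})=[\operatorname{diag}(x_1,\dots,x_n)-\mathbf{x}\mathbf{x}^T][A-\operatorname{diag}(\sigma_1^2,\dots,\sigma_n^2)]\mathbf{x}$ and $C(\mathbf{x})=[\operatorname{diag}(x_1,\dots,x_n)-\mathbf{x}\mathbf{x}^T]\operatorname{diag}(\sigma_1,\dots,\sigma_n)$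 for $\mathbf{x}\in\Delta$. Equivalently, $X_i=Z_i/(Z_1+\cdots+Z_n)$ where $dZ_i(t)=Z_i(t)[\{AX(t)\}_i\,dt+\sigma_i\,dW_i(t)]$, $Z_i(0)>0$. Almost surely $X(t)\in\operatorname{int}\Delta$ for all $t\ge0$. $\{\mathbf{v}\}_i$ denotes the $i$th component of $\mathbf{v}$. $\{X(t)\}$ is transient if $P_{\mathbf{x}_0}\{X(t)\to\operatorname{bd}\Delta\}=1$, i.e. almost surely the distance of $X(t)$ to $\operatorname{bd}\Delta$ tends to $0$ as $t\to\infty$. *)

(* Defs.v *)
From HB Require Import structures.
From mathcomp Require Import all_boot all_order all_algebra.
From mathcomp Require Import all_classical all_reals all_analysis.
Import Order.TTheory GRing.Theory Num.Theory.
Import numFieldNormedType.Exports.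

Set Implicit Arguments.
Unset Strict Implicit.
Unset Printing Implicit Defensive.

Local Open Scope classical_set_scope.
Local Open Scope ring_scope.

(* Processes are functions of all t : R, but only their values at t >= 0 are
   ever constrained or used.  A family of sub-sigma-algebras indexed by time is
   an R -> set (set T); its members are sigma-algebras by construction (<<s _ >>)
   in the two instances used below. *)

Definition measurable_wrt (R : realType) (T : Type) (G : set (set T))
    (Y : T -> R) : Prop :=
  forall B : set R, measurable B -> G (Y @^-1` B).

Definition adapted (R : realType) (T : Type) (F : R -> set (set T))
    (Y : R -> T -> R) : Prop :=
  forall t, 0 <= t -> measurable_wrt (F t) (Y t).

Definition continuous_paths (R : realType) (T : Type) (Y : R -> T -> R) : Prop :=
  forall w, {within `[0, +oo[%classic, continuous (fun t => Y t w)}.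

Definition component (R : realType) (T : Type) (n : nat)
    (Y : R -> T -> 'cV[R]_n) (i : 'I_n) : R -> T -> R :=
  fun t w => Y t w i 0.

Definition past_events (R : realType) (T : Type) (n : nat)
    (W : R -> T -> 'cV[R]_n) (t : R) : set (set T) :=
  [set E | exists r i B, [/\ 0 <= r <= t, measurable B
                           & E = component W i r @^-1` B]].

Definition natural_filtration (R : realType) (T : Type) (n : nat)
    (W : R -> T -> 'cV[R]_n) (t : R) : set (set T) :=
  <<s past_events W t >>.

Definition augmented_filtration (R : realType) (d : measure_display)
    (T : measurableType d) (P : probability T R) (n : nat)
    (W : R -> T -> 'cV[R]_n) (t : R) : set (set T) :=
  <<s past_events W t `|` [set N | measurable N /\ P N = 0%E] >>.

(* The product formula says at once that W(t) - W(s) is independent of the past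
   up to time s, that its components are independent, and that each of them has
   law N(0, t - s); the second argument of normal_prob is the standard
   deviation. *)
Record standard_brownian_motion (R : realType) (d : measure_display)
    (T : measurableType d) (P : probability T R) (n : nat)
    (W : R -> T -> 'cV[R]_n) : Prop := {
  bm_measurable : forall i t, 0 <= t -> measurable_fun setT (component W i t);
  bm_continuous : forall i, continuous_paths (component W i);
  bm_start : {ae P, forall w, W 0 w = 0};
  bm_increments : forall (s t : R), 0 <= s -> s < t ->
    forall E, natural_filtration W s E ->
    forall B : 'I_n -> set R, (forall i, measurable (B i)) ->
    P (E `&` [set w | forall i, B i ((W t w - W s w) i 0)]) =
    (P E * \prod_(i < n) normal_prob 0 (Num.sqrt (t - s)) (B i))%E
}.

(* The simple process  sum_(k < m) xi_k 1_(]tau_k, tau_(k+1)]). *)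
Record simple_process (R : realType) (T : Type) (F : R -> set (set T)) := {
  sp_size : nat;
  sp_time : nat -> R;
  sp_coef : nat -> T -> R;
  sp_time_ge0 : forall k, 0 <= sp_time k;
  sp_time_mono : forall k, sp_time k <= sp_time k.+1;
  sp_coef_bounded : forall k, exists M : R, forall w, `|sp_coef k w| <= M;
  sp_coef_measurable : forall k, measurable_wrt (F (sp_time k)) (sp_coef k)
}.

Definition sp_value (R : realType) (T : Type) (F : R -> set (set T))
    (Phi : simple_process F) (s : R) (w : T) : R :=
  \sum_(k < sp_size Phi)
    sp_coef Phi k w * (sp_time Phi k < s <= sp_time Phi k.+1)%R%:R.

Definition sp_integral (R : realType) (T : Type) (F : R -> set (set T))
    (Phi : simple_process F) (B : R -> T -> R) (t : R) (w : T) : R :=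
  \sum_(k < sp_size Phi)
    sp_coef Phi k w * (B (Num.min (sp_time Phi k.+1) t) w
                       - B (Num.min (sp_time Phi k) t) w).

Definition cvg_in_probability (R : realType) (d : measure_display)
    (T : measurableType d) (P : probability T R)
    (Y : nat -> T -> R) (Z : T -> R) : Prop :=
  forall e : R, 0 < e ->
    (fun m => P [set w | e <= `|Y m w - Z w|]) @ \oo --> 0%E.

(* J is (a version of) the Ito integral of H dB over [0, t], for an adapted
   integrand H with almost surely square-integrable paths: the limit in
   probability of the integrals of simple adapted processes that approximate H
   in L^2([0, t]), in probability. *)
Definition is_ito_integral (R : realType) (d : measure_display)
    (T : measurableType d) (P : probability T R) (F : R -> set (set T))
    (B H : R -> T -> R) (t : R) (J : T -> R) : Prop :=
  measurable_fun setT J /\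
  exists Phi : nat -> simple_process F,
    (forall e : R, 0 < e ->
       (fun m => P [set w |
          (e%:E <= \int[lebesgue_measure]_(s in `[0%R, t])
                     ((sp_value (Phi m) s w - H s w) ^+ 2)%:E)%E]) @ \oo
         --> 0%E) /\
    cvg_in_probability P (fun m => sp_integral (Phi m) B t) J.

(* X is a strong solution of  dX = b(X) dt + C(X) dW,  X(0) = x0,  with respect
   to the given Brownian motion W. *)
Record strong_solution (R : realType) (d : measure_display)
    (T : measurableType d) (P : probability T R) (n : nat)
    (W : R -> T -> 'cV[R]_n) (b : 'cV[R]_n -> 'cV[R]_n)
    (C : 'cV[R]_n -> 'M[R]_n) (x0 : 'cV[R]_n) (X : R -> T -> 'cV[R]_n)
    : Prop := {
  sol_adapted : forall i, adapted (augmented_filtration P W) (component X i);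
  sol_continuous : forall i, continuous_paths (component X i);
  sol_start : {ae P, forall w, X 0 w = x0};
  sol_equation : forall t, 0 <= t -> forall i : 'I_n,
    exists J : 'I_n -> T -> R,
      (forall j, is_ito_integral P (augmented_filtration P W)
                   (component W j) (fun s w => C (X s w) i j) t (J j)) /\
      {ae P, forall w,
         X t w i 0 = x0 i 0
                     + (\int[lebesgue_measure]_(s in `[0, t]) (b (X s w) i 0))
                     + \sum_j J j w}
}.

Definition simplex (R : realType) (n : nat) : set 'cV[R]_n :=
  [set y | (forall i, 0 <= y i 0 <= 1) /\ \sum_i y i 0 = 1].

Definition simplex_int (R : realType) (n : nat) : set 'cV[R]_n :=
  [set y | @simplex R n y /\ forall i, 0 < y i 0].

Definition simplex_bd (R : realType) (n : nat) : set 'cV[R]_n :=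
  @simplex R n `\` @simplex_int R n.

Arguments simplex {R n}.
Arguments simplex_int {R n}.
Arguments simplex_bd {R n}.

Definition replicator_drift (R : realType) (n : nat) (A : 'M[R]_n)
    (sigma : 'I_n -> R) (x : 'cV[R]_n) : 'cV[R]_n :=
  (diag_mx x^T - x *m x^T)
    *m (A - diag_mx (\row_i (sigma i ^+ 2))) *m x.

Definition replicator_diffusion (R : realType) (n : nat)
    (sigma : 'I_n -> R) (x : 'cV[R]_n) : 'M[R]_n :=
  (diag_mx x^T - x *m x^T) *m diag_mx (\row_i sigma i).

Definition stochastic_replicator (R : realType) (d : measure_display)
    (T : measurableType d) (P : probability T R) (n : nat)
    (W : R -> T -> 'cV[R]_n) (A : 'M[R]_n) (sigma : 'I_n -> R)
    (x0 : 'cV[R]_n) (X : R -> T -> 'cV[R]_n) : Prop :=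
  {ae P, forall w, forall t, 0 <= t -> simplex (X t w)} /\
  strong_solution P W (replicator_drift A sigma) (replicator_diffusion sigma)
    x0 X.

(* The library's norm on matrices is the max norm. *)
Definition euclidean_dist (R : realType) (n : nat) (x y : 'cV[R]_n) : R :=
  Num.sqrt (\sum_i (x i 0 - y i 0) ^+ 2).

Definition dist_to (R : realType) (n : nat) (S : set 'cV[R]_n)
    (x : 'cV[R]_n) : R :=
  inf [set euclidean_dist x y | y in S].

Definition transient (R : realType) (d : measure_display)
    (T : measurableType d) (P : probability T R) (n : nat)
    (X : R -> T -> 'cV[R]_n) : Prop :=
  {ae P, forall w, dist_to simplex_bd (X t w) @[t --> +oo] --> 0}.

Definition modified_payoff (R : realType) (n : nat) (A : 'M[R]_n)
    (sigma : 'I_n -> R) : 'M[R]_n :=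
  \matrix_(i, j) (A i j - sigma i ^+ 2 / 2).

(* Main.v *)
(* If no mixed strategy p equalises the components of A~ p, the point of the
   convex compact set { centred A~ p : p in the simplex } closest to the origin
   yields q with sum q_i = 0 and q . A~ p >= delta > 0 for all p.  For theta a
   small multiple of q the function v(x) = exp(- sum theta_i ln x_i) satisfies
   L v <= - c v, L being the generator, so exp(c t) v(X(t)) is a nonnegative
   supermartingale.  The maximal inequality bounds it almost surely, and since
   v(x) >= prod x_i, the product prod X_i(t) decays exponentially, which forces
   X(t) to the boundary.

   Ito's formula is replaced by a one-step estimate: a Taylor expansion of v over
   a time step of length eta^2 has error O(eta^3) in mean, because the stochastic
   integrals have the right first two moments given the past; a discrete Gronwall
   argument then sums the steps.  As v is singular on the boundary this is done
   with ln (x_i + eps).  The same estimate for 1 / (x_k + eps) bounds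
   E(1 / X_k(t)), and this domination lets eps tend to 0. *)

Require Import Defs.
From HB Require Import structures.
From mathcomp Require Import all_boot all_order all_algebra.
From mathcomp Require Import all_classical all_reals all_analysis.
From mathcomp Require Import measurable_realfun ring lra.
Import Order.TTheory GRing.Theory Num.Theory.
Import numFieldNormedType.Exports.

Set Implicit Arguments.
Unset Strict Implicit.
Unset Printing Implicit Defensive.

Local Open Scope classical_set_scope.
Local Open Scope ring_scope.

(** * Expectation *)

(** The Ito integral is given only as a limit in probability at one fixed time, and the
    approximating sequences at two different times need not be related; neither an isometry nor a
    martingale property is built in. What has to be recovered is what the one-step estimate
    consumes: an increment of the integral, minus its part with frozen coefficient, has a small
    second moment and is orthogonal to bounded variables of the past. Both follow by truncating step
    integrals by their energy.

    The condition sum q_i = 0 removes the averages in the replicator drift and, together with the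
    second-order terms, turns A - diag(sigma_i^2) into A~. The gain is linear in theta and the
    variance quadratic, so a small multiple of q wins.

    Smallness serves a second time: if sum |theta_i| <= 1/2, the regularised v is at most the square
    root of 2 sum 1/(x_i + eps). The generator error eps/(x_i + eps) is not uniformly small near the
    boundary, but v times it is at most sqrt(2 eps) sum 1/(x_i + eps), whose mean is bounded
    uniformly in eps. *)

Section Expectation.
Context (R : realType) (d : measure_display) (T : measurableType d)
  (P : probability T R).
Implicit Types (f g : T -> R) (c M : R).

Definition L1 f := P.-integrable setT (EFin \o f).

Definition Ex f := \int[P]_w f w.

Lemma L1_measurable f : L1 f -> measurable_fun setT f.
Proof. by move=> /integrableP[mf _]; apply/measurable_EFinP. Qed.

Lemma L1_cst c : L1 (fun=> c).
Proof. exact: finite_measure_integrable_cst. Qed.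

Lemma L1D f g : L1 f -> L1 g -> L1 (fun w => f w + g w).
Proof. by move=> f1 g1; exact: (integrableD measurableT f1 g1). Qed.

Lemma L1B f g : L1 f -> L1 g -> L1 (fun w => f w - g w).
Proof. by move=> f1 g1; exact: (integrableB measurableT f1 g1). Qed.

Lemma L1Z c f : L1 f -> L1 (fun w => c * f w).
Proof. by move=> f1; exact: (integrableZl measurableT c f1). Qed.

Lemma L1N f : L1 f -> L1 (fun w => - f w).
Proof. by move=> f1; exact: (integrableN f1). Qed.

Lemma L1_sum (I : Type) (s : seq I) (Q : pred I) (f : I -> T -> R) :
  (forall i, L1 (f i)) -> L1 (fun w => \sum_(i <- s | Q i) f i w).
Proof.
move=> f1; elim: s => [|i s IH].
  by under [X in L1 X]eq_fun do rewrite big_nil; exact: L1_cst.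
under [X in L1 X]eq_fun do rewrite big_cons.
by case: (Q i) => //; exact: L1D.
Qed.

Lemma L1_le f g : measurable_fun setT f -> (forall w, `|f w| <= g w) ->
  L1 g -> L1 f.
Proof.
move=> mf fg g1; apply: le_integrable g1 => //; first exact/measurable_EFinP.
by move=> w _; rewrite lee_fin (le_trans (fg w))// ler_norm.
Qed.

Lemma L1_bounded f M : measurable_fun setT f -> (forall w, `|f w| <= M) -> L1 f.
Proof. by move=> mf fM; apply: (L1_le mf fM); exact: L1_cst. Qed.

Lemma L1_norm f : L1 f -> L1 (fun w => `|f w|).
Proof. exact: integrable_norm. Qed.

Lemma L1_boundedM f g M : measurable_fun setT f -> (forall w, `|f w| <= M) ->
  L1 g -> L1 (fun w => f w * g w).
Proof.
move=> mf fM g1; apply: (L1_le (g := fun w => M * `|g w|)).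
- by apply: measurable_funM => //; exact: L1_measurable.
- by move=> w; rewrite normrM ler_wpM2r.
- by apply: L1Z; exact: L1_norm.
Qed.

Lemma L1_sqr f : measurable_fun setT f -> L1 (fun w => f w ^+ 2) -> L1 f.
Proof.
move=> mf f2; apply: (L1_le (g := fun w => 1 + f w ^+ 2)) => //; last first.
  by apply: L1D => //; exact: L1_cst.
move=> w; rewrite -(real_normK (num_real (f w))).
by have := sqr_ge0 (`|f w| - 1); have := normr_ge0 (f w); nra.
Qed.

Lemma L1_indic A : measurable A -> L1 \1_A.
Proof. exact: integrable_indic. Qed.

Lemma ExE f : L1 f -> (Ex f)%:E = (\int[P]_w (f w)%:E)%E.
Proof.
by move=> f1; rewrite /Ex /Rintegral fineK//; exact: integrable_fin_num.
Qed.

Lemma Ex_cst c : Ex (fun=> c) = c.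
Proof.
by rewrite /Ex Rintegral_cst// [X in fine X](@probability_setT _ _ _ P) mulr1.
Qed.

Lemma Ex_indic A : measurable A -> (Ex \1_A)%:E = P A.
Proof.
move=> mA; rewrite ExE; last exact: L1_indic.
by rewrite integral_indic// setIT.
Qed.

Lemma ExD f g : L1 f -> L1 g -> Ex (fun w => f w + g w) = Ex f + Ex g.
Proof. exact: RintegralD. Qed.

Lemma ExB f g : L1 f -> L1 g -> Ex (fun w => f w - g w) = Ex f - Ex g.
Proof. exact: RintegralB. Qed.

Lemma ExZ c f : L1 f -> Ex (fun w => c * f w) = c * Ex f.
Proof. exact: RintegralZl. Qed.

Lemma ExN f : L1 f -> Ex (fun w => - f w) = - Ex f.
Proof.
move=> f1; rewrite -mulN1r -ExZ//; congr Ex.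
by apply/funext => w; rewrite mulN1r.
Qed.

Lemma Ex_sum (I : Type) (s : seq I) (Q : pred I) (f : I -> T -> R) :
  (forall i, L1 (f i)) ->
  Ex (fun w => \sum_(i <- s | Q i) f i w) = \sum_(i <- s | Q i) Ex (f i).
Proof.
move=> f1; elim: s => [|i s IH].
  rewrite big_nil -[RHS](Ex_cst 0); congr Ex; apply/funext => w.
  by rewrite big_nil.
rewrite big_cons -IH; case: ifPn => Qi.
  rewrite -ExD//; last exact: L1_sum.
  by congr Ex; apply/funext => w; rewrite big_cons Qi.
by congr Ex; apply/funext => w; rewrite big_cons (negbTE Qi).
Qed.

Lemma Ex_le f g : L1 f -> L1 g -> (forall w, f w <= g w) -> Ex f <= Ex g.
Proof. by move=> f1 g1 fg; exact: le_Rintegral. Qed.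

Lemma Ex_ge0 f : (forall w, 0 <= f w) -> 0 <= Ex f.
Proof. by move=> f0; exact: Rintegral_ge0. Qed.

Lemma Ex_norm f : L1 f -> `|Ex f| <= Ex (fun w => `|f w|).
Proof. exact: le_normr_Rintegral. Qed.

Lemma Ex_norm_le f g : L1 f -> L1 g -> (forall w, `|f w| <= g w) ->
  `|Ex f| <= Ex g.
Proof.
move=> f1 g1 fg; apply: le_trans (Ex_norm f1) _.
by apply: Ex_le => //; exact: L1_norm.
Qed.

Lemma Ex_ae_eq f g : measurable_fun setT f -> measurable_fun setT g ->
  {ae P, forall w, f w = g w} -> Ex f = Ex g.
Proof.
move=> mf mg fg; congr fine; apply: ae_eq_integral => //.
- exact/measurable_EFinP.
- exact/measurable_EFinP.
- by apply: filterS fg => w /= -> _.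
Qed.

Lemma L1_ae_eq f g : measurable_fun setT g -> L1 f ->
  {ae P, forall w, f w = g w} -> L1 g.
Proof.
move=> mg f1 fg; have mf := L1_measurable f1.
have : P.-integrable setT (EFin \o f) by [].
move=> /integrableP[_ foo]; apply/integrableP; split.
  exact/measurable_EFinP.
suff <- : (\int[P]_w `|(f w)%:E| = \int[P]_w `|(g w)%:E|)%E by [].
apply: ae_eq_integral => //.
- by apply: measurableT_comp => //; exact/measurable_EFinP.
- by apply: measurableT_comp => //; exact/measurable_EFinP.
- by apply: filterS fg => w /= -> _.
Qed.

(** Monotonicity is first available for inequalities that hold everywhere; replacing [f] by its
    minimum with [g] changes it only on a null event. *)
Lemma Ex_ae_le f g : L1 f -> L1 g -> {ae P, forall w, f w <= g w} ->
  Ex f <= Ex g.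
Proof.
move=> f1 g1 fg; have [mf mg] := (L1_measurable f1, L1_measurable g1).
have mm : measurable_fun setT (fun w => Num.min (f w) (g w)).
  exact: measurable_minr.
have e : {ae P, forall w, f w = Num.min (f w) (g w)}.
  by apply: filterS fg => w /= fg; rewrite min_l.
rewrite (Ex_ae_eq mf mm e); apply: Ex_le => //; first exact: L1_ae_eq e.
by move=> w; rewrite ge_min lexx orbT.
Qed.

Lemma Ex_markov f c A : L1 f -> (forall w, 0 <= f w) -> measurable A ->
  (forall w, A w -> c <= f w) -> c * fine (P A) <= Ex f.
Proof.
move=> f1 f0 mA cf; rewrite -(Ex_indic mA) -ExZ; last exact: L1_indic.
apply: Ex_le => //; first by apply: L1Z; exact: L1_indic.
move=> w; rewrite indicE; case: (boolP (w \in A)) => wA /=.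
  by rewrite mulr1; apply: cf; exact/set_mem.
by rewrite mulr0.
Qed.

End Expectation.

(** * Exponential remainder and integration against a density *)

(** The coefficients satisfy 1/(i+3)! <= 1/i!, so the tail of the series is at most |y|^3 times the
    series of exp |y|. No smallness of [y] is assumed, because the estimate is integrated against
    Gaussian laws. *)
Lemma exp_taylor2 (R : realType) (y : R) :
  `|expR y - 1 - y - y ^+ 2 / 2| <= `|y| ^+ 3 * expR `|y|.
Proof.
pose u n := `|series (exp_coeff y) n.+3 - 1 - y - y ^+ 2 / 2|.
have cu : u @ \oo --> `|expR y - 1 - y - y ^+ 2 / 2|.
  apply: cvg_norm; apply: cvgB; last exact: cvg_cst.
  apply: cvgB; last exact: cvg_cst.
  apply: cvgB; last exact: cvg_cst.
  rewrite (_ : (fun _ => _) = (fun n => series (exp_coeff y) (n + 3)%N)); last first.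
    by apply/funext => n; rewrite addn3.
  rewrite (cvg_shiftn 3 (series (exp_coeff y))).
  exact: is_cvg_series_exp_coeff.
rewrite -(cvg_lim (@Rhausdorff R) cu); apply: limr_le.
  by apply/cvg_ex; eexists; exact: cu.
apply: nearW => n; rewrite /u.
have -> : series (exp_coeff y) n.+3 - 1 - y - y ^+ 2 / 2 =
    \sum_(0 <= i < n) y ^+ i.+3 / (i.+3)`!%:R.
  rewrite /series/= /exp_coeff/= big_nat_recl// big_nat_recl// big_nat_recl//=.
  rewrite fact0 expr0 expr1 !divr1 (_ : 2`! = 2)%N//.
  by move: (\sum_(0 <= i < n) _) => S; ring.
apply: le_trans (ler_norm_sum _ _ _) _.
apply: (@le_trans _ _ (`|y| ^+ 3 * series (exp_coeff `|y|) n)).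
  rewrite /series/= mulr_sumr ler_sum// => i _.
  rewrite /exp_coeff/= normrM normrX [`|_ %:R^-1|]ger0_norm//.
  rewrite -(addn3 i) addnC exprD -mulrA ler_wpM2l ?exprn_ge0//.
  rewrite ler_wpM2l ?exprn_ge0// lef_pV2 ?posrE ?ltr0n ?fact_gt0//.
  by rewrite ler_nat leq_fact// leq_addl.
rewrite ler_wpM2l ?exprn_ge0//.
apply: nondecreasing_cvgn_le; last exact: is_cvg_series_exp_coeff.
apply/nondecreasing_seqP => k; rewrite /series/= big_nat_recr//= lerDl.
exact: exp_coeff_ge0.
Qed.

Lemma expR_norm_le (R : realType) (y : R) : expR `|y| <= expR y + expR (- y).
Proof.
by case: (ger0P y) => _; rewrite ?lerDl ?lerDr expR_ge0.
Qed.

Import HBNNSimple.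

(** Linearity extends the formula from indicators to simple functions, and monotone convergence to
    nonnegative measurable functions. It is what turns integrals against [normal_prob] into Lebesgue
    integrals. *)
Lemma ge0_integral_density (d : measure_display) (T : measurableType d)
    (R : realType) (mu nu : {measure set T -> \bar R}) (g : T -> R) :
    measurable_fun setT g -> (forall x, 0 <= g x) ->
    (forall A, measurable A -> nu A = (\int[mu]_(x in A) (g x)%:E)%E) ->
  forall f : T -> \bar R, measurable_fun setT f -> (forall x, 0 <= f x)%E ->
  (\int[nu]_x f x = \int[mu]_x (f x * (g x)%:E))%E.
Proof.
move=> mg g0 nuE f mf f0.
have mgE : measurable_fun setT (EFin \o g) by exact/measurable_EFinP.
have indicE' A : measurable A ->
    (\int[nu]_x (\1_A x)%:E = \int[mu]_x ((\1_A x)%:E * (g x)%:E))%E.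
  move=> mA; rewrite integral_indic// setIT nuE// integral_mkcond.
  apply: eq_integral => x _; rewrite patchE indicE.
  by case: ifPn => xA; rewrite ?mul1e ?mul0e.
pose f_ := nnsfun_approx measurableT mf.
have f_E n : (\int[nu]_x (f_ n x)%:E = \int[mu]_x ((f_ n x)%:E * (g x)%:E))%E.
  under [LHS]eq_integral do rewrite fimfunE -fsumEFin//.
  rewrite [LHS]ge0_integral_fsum//; last 2 first.
    - by move=> r; exact/measurable_EFinP/measurableT_comp.
    - by move=> k x _; rewrite EFinM nnfun_muleindic_ge0.
  under [RHS]eq_integral.
    move=> x xD; rewrite fimfunE -fsumEFin// ge0_mule_fsuml; last first.
      by move=> r; rewrite EFinM nnfun_muleindic_ge0.
    over.
  rewrite [RHS]ge0_integral_fsum//; last 2 first.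
    - move=> r; apply: emeasurable_funM => //.
      by apply/measurable_EFinP; apply/measurableT_comp.
    - by move=> k x _; rewrite EFinM mule_ge0// ?nnfun_muleindic_ge0// lee_fin.
  apply: eq_fsbigr => r rf.
  have r0 : 0 <= r.
    by move: rf; rewrite inE => -[x _ <-].
  under [LHS]eq_integral do rewrite EFinM.
  rewrite ge0_integralZl//; last exact/measurable_EFinP/measurable_indic.
  rewrite indicE'// -ge0_integralZl//.
  - by apply: eq_integral => x _; rewrite EFinM muleA.
  - by apply: emeasurable_funM => //; exact/measurable_EFinP.
  - by move=> x _; rewrite mule_ge0// lee_fin.
transitivity (limn (fun n => \int[nu]_x (f_ n x)%:E))%E.
  rewrite -monotone_convergence//=.
  - apply: eq_integral => x _; apply/esym/cvg_lim => //=.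
    exact: cvg_nnsfun_approx.
  - by move=> n; exact/measurable_EFinP/measurable_funTS.
  - by move=> n x _; rewrite lee_fin.
  - by move=> x _ m n mn; rewrite lee_fin; exact/lefP/nd_nnsfun_approx.
transitivity (limn (fun n => \int[mu]_x ((f_ n x)%:E * (g x)%:E)))%E.
  by apply: congr_lim; apply/funext => n; exact: f_E.
rewrite -monotone_convergence//=.
- apply: eq_integral => x _; apply/cvg_lim => //=.
  apply: cvgeZr => //; exact: cvg_nnsfun_approx.
- by move=> n; apply: emeasurable_funM => //; exact/measurable_EFinP/measurable_funTS.
- by move=> n x _; rewrite mule_ge0// lee_fin.
- move=> x _ m n mn; apply: lee_wpmul2r; rewrite lee_fin//.
  exact/lefP/nd_nnsfun_approx.
Qed.

(** * Gaussian moments *)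

Section GaussianMoments.
Variables (R : realType) (s : R).
Hypothesis s_gt0 : 0 < s.
Let N : probability (measurableTypeR R) R := normal_prob 0 s.

(** Completing the square: exp(c y) times the density of N(0, s^2) is exp(c^2 s^2 / 2) times the
    density of N(c s^2, s^2). *)
Lemma normal_mgf c : L1 N (fun y => expR (c * y)) /\
  Ex N (fun y => expR (c * y)) = expR (c ^+ 2 * s ^+ 2 / 2).
Proof.
have s0 : s != 0 by rewrite gt_eqF.
have mE : measurable_fun setT (fun y : R => expR (c * y)).
  by apply: measurableT_comp => //; exact: measurable_funM.
have iE : (\int[N]_y (expR (c * y))%:E = (expR (c ^+ 2 * s ^+ 2 / 2))%:E)%E.
  rewrite (@ge0_integral_density _ _ R lebesgue_measure N (normal_pdf 0 s))//.
  - transitivity (\int[lebesgue_measure]_y ((expR (c ^+ 2 * s ^+ 2 / 2))%:E *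
      (normal_pdf (c * s ^+ 2) s y)%:E))%E.
      apply: eq_integral => y _; rewrite -!EFinM; congr EFin.
      rewrite !normal_pdfE// mulrCA [RHS]mulrCA; congr (_ * _).
      rewrite /normal_fun -!expRD; congr expR; field.
      by rewrite s0.
    rewrite integralZl//=; last exact: integrable_normal_pdf.
    by rewrite integral_normal_pdf mule1.
  - exact: measurable_normal_pdf.
  - exact: normal_pdf_ge0.
  - exact/measurable_EFinP.
split.
  apply/integrableP; split; first exact/measurable_EFinP.
  under eq_integral do rewrite /= ger0_norm ?expR_ge0//.
  by rewrite iE ltry.
by rewrite /Ex /Rintegral iE.
Qed.

Lemma normal_exp_norm c : L1 N (fun y => expR (c * y) + expR (- (c * y))) /\
  Ex N (fun y => expR (c * y) + expR (- (c * y))) =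
    2 * expR (c ^+ 2 * s ^+ 2 / 2).
Proof.
have [i1 e1] := normal_mgf c; have [i2 e2] := normal_mgf (- c).
have e : (fun y : R => expR (- (c * y))) = (fun y => expR (- c * y)).
  by apply/funext => y; rewrite mulNr.
rewrite -e in i2 e2; split; first exact: L1D.
by rewrite ExD// e1 e2 sqrrN; ring.
Qed.

(** The series of the exponential gives (|y|/s)^4 <= 4! exp(|y|/s). The scale 1/s makes the exponent
    of the moment generating function equal to 1/2, and 48 is 2 * 4!. *)
Lemma normal_moment4 : L1 N (fun y => y ^+ 4) /\
  Ex N (fun y => y ^+ 4) <= 48 * expR (1 / 2) * s ^+ 4.
Proof.
have s0 : s != 0 by rewrite gt_eqF.
have [i e] := normal_exp_norm s^-1.
have le4 (y : R) : `|y ^+ 4| <=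
    24 * s ^+ 4 * (expR (s^-1 * y) + expR (- (s^-1 * y))).
  have := @expR_ge1Dxn R `|s^-1 * y| 3 (normr_ge0 _).
  have := expR_norm_le (s^-1 * y).
  have -> : 4`!%:R = 24%:R :> R by [].
  rewrite normrM normfV (gtr0_norm s_gt0) exprMn exprVn.
  have -> : `|y ^+ 4| = `|y| ^+ 4 by rewrite normrX.
  move: (expR _ + _) (expR _) => a b ba h.
  have : `|y| ^+ 4 / s ^+ 4 <= 24 * a.
    by move: h; set z := _ ^- 4 * _; rewrite [z]mulrC -/z; lra.
  rewrite ler_pdivrMr ?exprn_gt0// => h'.
  by apply: le_trans h' _; rewrite mulrAC.
have m4 : measurable_fun setT (fun y : R => y ^+ 4) by [].
have i' := L1Z (24 * s ^+ 4) i.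
have j := L1_le (P := N) m4 le4 i'.
split => //.
have : Ex N (fun y => y ^+ 4) <= Ex N (fun y =>
    24 * s ^+ 4 * (expR (s^-1 * y) + expR (- (s^-1 * y)))).
  by apply: Ex_le => // y; apply: le_trans (le4 y); exact: ler_norm.
move/le_trans; apply.
rewrite ExZ// e exprVn mulVf ?expf_neq0//.
rewrite le_eqVlt; apply/orP; left; apply/eqP; ring.
Qed.

Lemma normal_moment2_integrable : L1 N (fun y => y ^+ 2).
Proof.
have [i4 _] := normal_moment4.
apply: (L1_le (P := N) (g := fun y => 1 + y ^+ 4)) => //.
  move=> y; rewrite ger0_norm ?sqr_ge0//.
  by have := sqr_ge0 (y ^+ 2 - 1); rewrite (_ : y ^+ 4 = y ^+ 2 * y ^+ 2); nra.
by apply: L1D => //; exact: L1_cst.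
Qed.

Lemma normal_moment1_integrable : L1 N (fun y => y).
Proof. by apply: (L1_sqr (P := N)) => //; exact: normal_moment2_integrable. Qed.

(* Both sides of E exp(c Y) = exp(c^2 s^2 / 2) agree to second order in c. *)
Let expansion : exists2 K, 0 <= K & forall c, 0 <= c -> c <= 1 ->
  `|c * Ex N (fun y => y) + c ^+ 2 / 2 * (Ex N (fun y => y ^+ 2) - s ^+ 2)| <=
    K * c ^+ 3 /\
  `|- c * Ex N (fun y => y) + c ^+ 2 / 2 * (Ex N (fun y => y ^+ 2) - s ^+ 2)| <=
    K * c ^+ 3.
Proof.
have [i e] := normal_exp_norm 2.
(* For |c| <= 1 the Taylor remainder of exp(c y) is at most |c|^3 |y|^3 exp |y|, and |y|^3 <= 3! exp
   |y|; this explains the 6 and the exponent 2. In [K] the term [Ex N G] bounds that remainder, and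
   the other terms bound the one of exp(c^2 s^2 / 2). *)
pose G y : R := 6 * (expR (2 * y) + expR (- (2 * y))).
have iG : L1 N G by exact: L1Z.
pose K := Ex N G + (s ^+ 4 + s ^+ 6 * expR (s ^+ 2)).
exists K.
  apply: addr_ge0.
    by apply: Ex_ge0 => y; rewrite mulr_ge0// addr_ge0// expR_ge0.
  have s0 := ltW s_gt0.
  by apply: addr_ge0; [|apply: mulr_ge0]; rewrite ?exprn_ge0 ?expR_ge0.
suff main c : `|c| <= 1 ->
  `|c * Ex N (fun y => y) + c ^+ 2 / 2 * (Ex N (fun y => y ^+ 2) - s ^+ 2)| <=
    K * `|c| ^+ 3.
  move=> c c0 c1; split.
    by rewrite -[X in _ <= _ * X ^+ _](ger0_norm c0); apply: main; rewrite ger0_norm.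
  by have := main (- c); rewrite normrN sqrrN (ger0_norm c0); apply.
move=> c1.
have c0 := normr_ge0 c.
have [ic ec] := normal_mgf c.
pose D (y : R) := expR (c * y) - 1 - c * y - (c * y) ^+ 2 / 2.
have mc : measurable_fun [set: measurableTypeR R] (fun y : R => c * y).
  exact: measurable_funM.
have mD : measurable_fun [set: measurableTypeR R] D.
  apply: measurable_funB; last first.
    by apply: measurable_funM => //; exact: measurable_funX.
  apply: measurable_funB => //.
  by apply: measurable_funB => //; exact: L1_measurable ic.
have DG y : `|D y| <= `|c| ^+ 3 * G y.
  apply: le_trans (exp_taylor2 _) _.
  rewrite normrM exprMn -[leLHS]mulrA ler_wpM2l ?exprn_ge0//.
  have cy : `|c| * `|y| <= `|y| by rewrite ler_piMl.
  have y3 : `|y| ^+ 3 <= 6 * expR `|y|.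
    by have := @expR_ge1Dxn R `|y| 2 (normr_ge0 _); rewrite (_ : 3`! = 6)%N//; lra.
  apply: (@le_trans _ _ (6 * expR `|y| * expR `|y|)).
    by apply: ler_pM; rewrite ?exprn_ge0 ?expR_ge0 ?ler_expR//.
  rewrite /G -mulrA -expRD ler_wpM2l//.
  apply: le_trans (expR_norm_le _).
  by rewrite ler_expR normrM ger0_norm//; lra.
have iD : L1 N D by apply: L1_le mD DG _; exact: L1Z.
have [i1 i2] := (normal_moment1_integrable, normal_moment2_integrable).
have ED : Ex N D = expR (c ^+ 2 * s ^+ 2 / 2) - 1 - c * Ex N (fun y => y) -
    c ^+ 2 / 2 * Ex N (fun y => y ^+ 2).
  have i0 : L1 N (fun y => expR (c * y) - 1) by apply: L1B => //; exact: L1_cst.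
  have j0 : L1 N (fun y => expR (c * y) - 1 - c * y) by apply: L1B => //; exact: L1Z.
  rewrite -ec -(ExZ c i1) -(ExZ (c ^+ 2 / 2) i2).
  rewrite -[X in _ - X - _ - _](Ex_cst N) -!ExB//.
  - by congr Ex; apply/funext => w; rewrite /D exprMn mulrAC.
  - exact: L1Z.
  - exact: L1Z.
  - exact: L1_cst.
have EDle : `|Ex N D| <= `|c| ^+ 3 * Ex N G.
  by rewrite -ExZ//; apply: Ex_norm_le => //; exact: L1Z.
pose u := c ^+ 2 * s ^+ 2 / 2.
have u0 : 0 <= u by rewrite divr_ge0// mulr_ge0// sqr_ge0.
have ule : u <= s ^+ 2.
  have c2 : c ^+ 2 <= 1 by rewrite -(real_normK (num_real c)) expr_le1.
  by rewrite /u; have := sqr_ge0 s; nra.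
have := exp_taylor2 u; rewrite (ger0_norm u0) => tu.
have eu : expR u <= expR (s ^+ 2) by rewrite ler_expR.
have c4 : c ^+ 4 <= `|c| ^+ 3.
  rewrite [leLHS](_ : c ^+ 4 = `|c| ^+ 4); last by rewrite -normrX ger0_norm// exprn_even_ge0.
  by rewrite exprS ler_piMl// exprn_ge0.
have c6 : c ^+ 6 <= `|c| ^+ 3.
  rewrite [leLHS](_ : c ^+ 6 = `|c| ^+ 6); last by rewrite -normrX ger0_norm// exprn_even_ge0.
  by rewrite (_ : 6 = 3 + 3)%N// exprD ler_piMl ?exprn_ge0// expr_le1.
have us : `|expR u - 1 - u| <= `|c| ^+ 3 * (s ^+ 4 + s ^+ 6 * expR (s ^+ 2)).
  have -> : expR u - 1 - u = (expR u - 1 - u - u ^+ 2 / 2) + u ^+ 2 / 2 by ring.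
  apply: le_trans (ler_normD _ _) _.
  rewrite [X in _ + X]ger0_norm; last by rewrite divr_ge0// sqr_ge0.
  have h1 : u ^+ 2 / 2 <= `|c| ^+ 3 * s ^+ 4.
    have -> : u ^+ 2 / 2 = c ^+ 4 * s ^+ 4 / 8 by rewrite /u; field.
    have s4 : 0 <= s ^+ 4 by rewrite exprn_ge0// ltW.
    have h : c ^+ 4 * s ^+ 4 <= `|c| ^+ 3 * s ^+ 4 by rewrite ler_wpM2r.
    have : 0 <= c ^+ 4 * s ^+ 4 by rewrite mulr_ge0// exprn_even_ge0.
    by lra.
  have h2 : u ^+ 3 * expR u <= `|c| ^+ 3 * (s ^+ 6 * expR (s ^+ 2)).
    rewrite mulrA; apply: ler_pM => //; rewrite ?exprn_ge0 ?expR_ge0//.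
    have -> : u ^+ 3 = c ^+ 6 * s ^+ 6 / 8 by rewrite /u; field.
    have s6 : 0 <= s ^+ 6 by rewrite exprn_ge0// ltW.
    have h : c ^+ 6 * s ^+ 6 <= `|c| ^+ 3 * s ^+ 6 by rewrite ler_wpM2r.
    have : 0 <= c ^+ 6 * s ^+ 6 by rewrite mulr_ge0// exprn_even_ge0.
    by lra.
  by rewrite mulrDr; move: tu h1 h2; lra.
have -> : c * Ex N (fun y => y) + c ^+ 2 / 2 * (Ex N (fun y => y ^+ 2) - s ^+ 2) =
    (expR u - 1 - u) - Ex N D by rewrite ED /u; ring.
apply: le_trans (ler_normB _ _) _.
by rewrite /K mulrDl mulrC [X in _ <= _ + X]mulrC addrC lerD.
Qed.

(** Subtracting the expansions at c and -c removes the second-order term and leaves |c m| <= K c^3;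
    divide by c and let it tend to 0. *)
Lemma normal_moment1 : Ex N (fun y => y) = 0.
Proof.
have [K K0 /= e] := expansion; apply/eqP; rewrite -normr_le0.
apply/ler_addgt0Pl => r r0; rewrite addr0.
pose c := Num.min 1 (r / (K + 1)).
have K1 : 0 < K + 1 by rewrite ltr_wpDl.
have c0 : 0 < c by rewrite lt_min ltr01 divr_gt0.
have c1 : c <= 1 by rewrite ge_min lexx.
have cr : c * (K + 1) <= r by rewrite -ler_pdivlMr// ge_min lexx orbT.
have [h1 h2] := e _ (ltW c0) c1.
move: h1 h2; set m := Ex N _; set q := _ - s ^+ 2 => h1 h2.
have h : `|c * m| <= K * c ^+ 3.
  have -> : c * m = ((c * m + c ^+ 2 / 2 * q) - (- c * m + c ^+ 2 / 2 * q)) / 2.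
    by field.
  rewrite normrM [X in _ * X]ger0_norm//.
  by have := ler_normB (c * m + c ^+ 2 / 2 * q) (- c * m + c ^+ 2 / 2 * q); lra.
move: h; rewrite normrM (gtr0_norm c0) (_ : K * c ^+ 3 = c * (K * c ^+ 2)); last by ring.
rewrite ler_pM2l// => /le_trans; apply.
apply: le_trans cr.
have : K * c ^+ 2 <= K * c.
  by rewrite ler_wpM2l// expr2 ler_piMl// ltW.
by lra.
Qed.

(** Once the mean is known to vanish, dividing the expansion by c^2 / 2 leaves an error 2 K c. *)
Lemma normal_moment2 : Ex N (fun y => y ^+ 2) = s ^+ 2.
Proof.
have [K K0 /= e] := expansion; apply/eqP; rewrite -subr_eq0 -normr_le0.
apply/ler_addgt0Pl => r r0; rewrite addr0.
pose c := Num.min 1 (r / (2 * K + 1)).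
have K1 : 0 < 2 * K + 1 by rewrite ltr_wpDl// mulr_ge0.
have c0 : 0 < c by rewrite lt_min ltr01 divr_gt0.
have c1 : c <= 1 by rewrite ge_min lexx.
have cr : c * (2 * K + 1) <= r by rewrite -ler_pdivlMr// ge_min lexx orbT.
have [] := e _ (ltW c0) c1; rewrite normal_moment1 !mulr0 !add0r => h _.
move: h; set q := _ - s ^+ 2.
rewrite normrM [X in X * _]ger0_norm ?divr_ge0 ?sqr_ge0//.
rewrite (_ : K * c ^+ 3 = c ^+ 2 / 2 * (2 * K * c)); last by field.
rewrite ler_pM2l ?divr_gt0 ?exprn_gt0// => /le_trans; apply.
by apply: le_trans cr; lra.
Qed.

End GaussianMoments.

(** * Independence and the augmented Brownian filtration *)

Section IndependentExpectation.
Context (R : realType) (d : measure_display) (T : measurableType d)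
  (P : probability T R) (N : probability (measurableTypeR R) R).
Variables (xi Y : T -> R).
Hypothesis mxi : measurable_fun setT (xi : T -> measurableTypeR R).
Hypothesis mY : measurable_fun setT (Y : T -> measurableTypeR R).
Hypothesis indep : forall A B : set (measurableTypeR R),
  measurable A -> measurable B ->
  P (xi @^-1` A `&` Y @^-1` B) = (P (xi @^-1` A) * N B)%E.

Let RR := (measurableTypeR R * measurableTypeR R)%type.
Let X : {mfun T >-> measurableTypeR R} :=
  HB.pack (xi : T -> measurableTypeR R) (isMeasurableFun.Build _ _ _ _ _ mxi).
Let m1 : probability (measurableTypeR R) R := distribution P X.
Let Z (w : T) : RR := (xi w, Y w).
Let mZ : measurable_fun setT Z.
Proof. exact: measurable_fun_pair. Qed.
Let ZZ : {mfun T >-> RR} := HB.pack Z (isMeasurableFun.Build _ _ _ _ _ mZ).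
Let m12 : probability RR R := distribution P ZZ.

Let m12E (A : set RR) : measurable A -> m12 A = (m1 \x N)%E A.
Proof.
by move=> mA; apply/esym; apply: product_measure_unique => // B C mB mC; exact: indep.
Qed.

Let ge0_joint (f : RR -> \bar R) : measurable_fun setT f ->
  (forall z, 0 <= f z)%E ->
  (\int[P]_w f (xi w, Y w) = \int[m1 \x N]_z f z)%E.
Proof.
move=> mf f0.
rewrite [RHS](eq_measure_integral m12).
  by rewrite ge0_integral_distribution.
by move=> A mA _; apply/esym; exact: m12E.
Qed.

(** The hypothesis on rectangles identifies the joint law of [xi] and [Y] with a product measure,
    and Fubini's theorem applies. No boundedness of [xi] is required, which matters when [xi] itself
    contains another Brownian increment. *)
Lemma indep_expectation (g : R -> R) : L1 P xi -> L1 N g ->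
  L1 P (fun w => xi w * g (Y w)) /\
  Ex P (fun w => xi w * g (Y w)) = Ex P xi * Ex N g.
Proof.
move=> i1 ig; have mg := L1_measurable ig.
pose f (z : RR) : \bar R := (z.1 * g z.2)%:E.
have mf : measurable_fun setT f.
  apply/measurable_EFinP; apply: measurable_funM => //.
  exact: (measurableT_comp mg).
have mfa : measurable_fun setT (abse \o f) by exact: measurableT_comp.
have iX : m1.-integrable setT (fun x => x%:E).
  apply/integrableP; split; first exact/measurable_EFinP.
  rewrite ge0_integral_distribution//; last by apply: measurableT_comp.
  by have /integrableP[_] : P.-integrable setT (EFin \o xi) by [].
have if12 : (m1 \x N)%E.-integrable setT f.
  apply/integrable12ltyP => //=.
  have -> : (\int[m1]_x \int[N]_y `|f (x, y)| =
      \int[m1]_x (`|x%:E| * \int[N]_y `|(g y)%:E|))%E.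
    apply: eq_integral => x _; rewrite -ge0_integralZl//.
    - by apply: eq_integral => y _; rewrite /f/= normrM EFinM.
    - by apply: measurableT_comp => //; exact/measurable_EFinP.
  have /integrableP[_ gfin] : N.-integrable setT (EFin \o g) by [].
  have /integrableP[_ xfin] := iX.
  rewrite ge0_integralZr//; last 2 first.
    - by apply: measurableT_comp => //; exact/measurable_EFinP.
    - by apply: integral_ge0.
  apply: lte_mul_pinfty => //; first exact: integral_ge0.
  by rewrite ge0_fin_numE//; exact: integral_ge0.
have iP : L1 P (fun w => xi w * g (Y w)).
  apply/integrableP; split.
    apply/measurable_EFinP; apply: measurable_funM => //.
    exact: (measurableT_comp mg).
  rewrite (ge0_joint mfa)//=.
  by case/integrableP : if12.
split => //.
apply: EFin_inj; rewrite EFinM !ExE//.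
have -> : (\int[P]_w (xi w * g (Y w))%:E = \int[m1 \x N]_z f z)%E.
  rewrite [LHS]integralE [RHS]integralE -ge0_joint//; last exact: measurable_funepos.
  rewrite -ge0_joint//; last exact: measurable_funeneg mf.
  by congr (_ - _)%E; apply: eq_integral => w _; rewrite ?funeposE ?funenegE.
rewrite -integral12_prod_meas1//.
have -> : (\int[m1]_x fubini_F N f x = \int[m1]_x (x%:E * \int[N]_y (g y)%:E))%E.
  apply: eq_integral => x _; rewrite /fubini_F -integralZl//.
have gf : (\int[N]_y (g y)%:E)%E \is a fin_num by exact: integrable_fin_num.
rewrite -(fineK gf) integralZr// integral_distribution//.
Qed.

End IndependentExpectation.

(* Dynkin's theorem, applied to the two finite measures
   [P (. `&` D)] and [p * P]. *)
Lemma indep_event_generated (R : realType) (d : measure_display)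
    (T : measurableType d) (P : probability T R) (C : set (set T))
    (D : set T) (p : \bar R) :
    C `<=` measurable -> setI_closed C -> C setT -> measurable D ->
    (0 <= p)%E ->
    (forall E, C E -> P (E `&` D) = P E * p)%E ->
  forall E, <<s C >> E -> P (E `&` D) = (P E * p)%E.
Proof.
move=> Cm CI CT mD p0 CE E.
(* The case E = setT shows that [p] is the probability of [D], hence finite. *)
have pfin : p \is a fin_num.
  have := CE _ CT; rewrite setTI [P setT]probability_setT mul1e => <-.
  exact: fin_num_measure.
have pE : ((fine p)%:E = p)%E by rewrite fineK.
have fp0 : 0 <= fine p by exact: fine_ge0.
pose m := mscale (NngNum fp0) P.
have mE A : m A = (P A * p)%E by rewrite -[in RHS]pE muleC.
move=> CE'; rewrite -mE.
apply: (@g_sigma_algebra_measure_unique _ R T C Cm (fun=> setT) (fun=> CT) _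
  (mrestr P mD) m CI) => //.
- by rewrite bigcup_const.
- by move=> A CA; apply: etrans (esym (mE A)); exact: CE.
- move=> n; suff : (P (setT `&` D) < +oo)%E by [].
  by rewrite -ge0_fin_numE//; rewrite setTI; exact: fin_num_measure.
Qed.

Section MeasurableWrt.
Context (R : realType) (T : pointedType) (C : set (set T)).
Implicit Types Y Z : T -> R.
Let F := <<s C >>.

(** Viewing the sub-sigma-algebra as a measurable type of its own makes the usual closure properties
    of measurable functions available for adapted variables. *)
Lemma measurable_wrtP Y :
  measurable_wrt F Y <-> measurable_fun [set: g_sigma_algebraType C] Y.
Proof.
split => [mY _ B mB|mY B mB]; first by rewrite setTI; exact: mY.
by rewrite -[X in F X]setTI; exact: mY.
Qed.

Lemma measurable_wrt_cst (c : R) : measurable_wrt F (fun=> c).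
Proof. by apply/measurable_wrtP; exact: measurable_cst. Qed.

Lemma measurable_wrtD Y Z : measurable_wrt F Y -> measurable_wrt F Z ->
  measurable_wrt F (fun w => Y w + Z w).
Proof.
by move=> /measurable_wrtP mY /measurable_wrtP mZ; apply/measurable_wrtP; exact: measurable_funD.
Qed.

Lemma measurable_wrtB Y Z : measurable_wrt F Y -> measurable_wrt F Z ->
  measurable_wrt F (fun w => Y w - Z w).
Proof.
by move=> /measurable_wrtP mY /measurable_wrtP mZ; apply/measurable_wrtP; exact: measurable_funB.
Qed.

Lemma measurable_wrtM Y Z : measurable_wrt F Y -> measurable_wrt F Z ->
  measurable_wrt F (fun w => Y w * Z w).
Proof.
by move=> /measurable_wrtP mY /measurable_wrtP mZ; apply/measurable_wrtP; exact: measurable_funM.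
Qed.

Lemma measurable_wrt_sum (I : Type) (s : seq I) (Q : pred I) (Y : I -> T -> R) :
  (forall i, measurable_wrt F (Y i)) ->
  measurable_wrt F (fun w => \sum_(i <- s | Q i) Y i w).
Proof.
move=> mY; apply/measurable_wrtP; elim: s => [|i s IH].
  by under eq_fun do rewrite big_nil; exact: measurable_cst.
under eq_fun do rewrite big_cons; case: (Q i) => //.
by apply: measurable_funD => //; exact/measurable_wrtP.
Qed.

Lemma measurable_wrt_comp (f : R -> R) Y : measurable_fun setT f ->
  measurable_wrt F Y -> measurable_wrt F (fun w => f (Y w)).
Proof.
by move=> mf /measurable_wrtP mY; apply/measurable_wrtP; exact: measurableT_comp.
Qed.

Lemma measurable_wrt_indic (E : set T) : F E -> measurable_wrt F (\1_E : T -> R).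
Proof.
move=> FE; apply/measurable_wrtP.
exact: (@measurable_indic _ (g_sigma_algebraType C)).
Qed.

Lemma measurable_wrtTI (E E' : set T) : F E -> F E' -> F (E `&` E').
Proof. exact: (@measurableI _ (g_sigma_algebraType C)). Qed.

Lemma measurable_wrt_setT : F setT.
Proof. exact: (@measurableT _ (g_sigma_algebraType C)). Qed.

Lemma measurable_wrt_le Y Z : measurable_wrt F Y -> measurable_wrt F Z ->
  F [set w | Y w <= Z w].
Proof.
move=> /measurable_wrtP mY /measurable_wrtP mZ.
rewrite -[X in F X]setTI.
exact: (@measurable_fun_le _ (g_sigma_algebraType C)).
Qed.

End MeasurableWrt.

Lemma measurable_wrt_sub (R : realType) (T : Type) (G H : set (set T))
    (Y : T -> R) : G `<=` H -> measurable_wrt G Y -> measurable_wrt H Y.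
Proof. by move=> GH mY B mB; exact/GH/mY. Qed.

Lemma generated_mem (T : Type) (C : set (set T)) (E : set T) : C E -> <<s C >> E.
Proof. by move=> CE; exact: sub_sigma_algebra CE. Qed.

Section AugmentedBrownianMotion.
Context (R : realType) (d : measure_display) (T : measurableType d)
  (P : probability T R) (n : nat) (W : R -> T -> 'cV[R]_n).
Hypothesis bm : standard_brownian_motion P W.

Let F := augmented_filtration P W.

Lemma past_events_measurable t : past_events W t `<=` measurable.
Proof.
move=> _ [r [i [B [/andP[r0 _] mB ->]]]].
by rewrite -[X in measurable X]setTI; exact: (bm_measurable bm).
Qed.

Lemma filtration_measurable t : F t `<=` measurable.
Proof.
apply: smallest_sub; first exact: sigma_algebra_measurable.
by move=> E [|[//]]; exact: past_events_measurable.
Qed.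

Lemma filtration_mono s t : s <= t -> F s `<=` F t.
Proof.
move=> st; apply: smallest_sub; first exact: smallest_sigma_algebra.
move=> E PE; refine (generated_mem _); case: PE; last by right.
move=> [r [i [B [/andP[r0 rs] mB ->]]]]; left.
by exists r, i, B; split => //; rewrite r0 (le_trans rs).
Qed.

Lemma filtration_null t N : measurable N -> P N = 0%E -> F t N.
Proof. by move=> mN PN; refine (generated_mem _); right. Qed.

Lemma filtration_bm r t i : 0 <= r -> r <= t ->
  measurable_wrt (F t) (component W i r).
Proof.
move=> r0 rt B mB; refine (generated_mem _); left.
by exists r, i, B; rewrite r0.
Qed.

Lemma measurable_wrt_fun t (Y : T -> R) : measurable_wrt (F t) Y ->
  measurable_fun setT Y.
Proof. by move=> mY _ B mB; rewrite setTI; exact: (filtration_measurable (mY _ mB)). Qed.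

(** The Brownian motion is independent of its natural past only by definition. Adjoining null events
    is harmless: the augmented sigma-algebra is generated by the sets A [&] M with A in the natural
    past and M of probability 0 or 1, and such an M either annihilates both sides or changes
    neither. *)
Lemma filtration_increments (s t : R) : 0 <= s -> s < t ->
  forall E, F s E ->
  forall B : 'I_n -> set R, (forall i, measurable (B i)) ->
  P (E `&` [set w | forall i, B i ((W t w - W s w) i 0)]) =
    (P E * \prod_(i < n) normal_prob 0 (Num.sqrt (t - s)) (B i))%E.
Proof.
move=> s0 st E FE B mB; set D := [set w | _].
have mD : measurable D.
  rewrite (_ : D = \bigcap_(i in [set: 'I_n])
      ((fun w => component W i t w - component W i s w) @^-1` (B i))).
    apply: fin_bigcap_measurable; first exact: finite_finset.
    move=> i _; rewrite -[X in measurable X]setTI.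
    apply: measurable_funB => //; apply: (bm_measurable bm) => //.
    exact: ltW (le_lt_trans s0 st).
  apply/seteqP; split => w /= h i; first by move=> _; have := h i; rewrite !mxE.
  by have := h i I; rewrite /component !mxE.
(* A generating pi-system of the augmented sigma-algebra. *)
pose C := [set E | exists A M, [/\ natural_filtration W s A, measurable M,
  P M = 0%E \/ P M = 1%E & E = A `&` M]].
have natm : natural_filtration W s `<=` measurable.
  apply: smallest_sub; first exact: sigma_algebra_measurable.
  exact: past_events_measurable.
have natI A B' : natural_filtration W s A -> natural_filtration W s B' ->
    natural_filtration W s (A `&` B') by exact: measurable_wrtTI.
have P1 (M A : set T) : measurable M -> measurable A -> P M = 1%E ->
    P (A `&` M) = P A.
  move=> mM mA PM.
  have PC : P (~` M) = 0%E by rewrite probability_setC// PM subee.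
  apply/eqP; rewrite eq_le; apply/andP; split.
    by apply: le_measure; rewrite ?inE//; exact: measurableI.
  rewrite -[X in (P X <= _)%E](setIT A) -(setUv M) setIUr.
  have mMC := measurableC mM.
  apply: le_trans (measureU2 P (measurableI _ _ mA mM) (measurableI _ _ mA mMC)) _.
  rewrite -[leRHS]adde0 leeD// -PC.
  by apply: le_measure; rewrite ?inE//; exact: measurableI.
have P0 (M A : set T) : measurable M -> measurable A -> P M = 0%E ->
    P (A `&` M) = 0%E.
  move=> mM mA PM; apply/eqP; rewrite eq_le measure_ge0 andbT -PM.
  by apply: le_measure; rewrite ?inE//; exact: measurableI.
apply: (@indep_event_generated _ _ T P C D) => //.
- by move=> _ [A [M [nA mM _ ->]]]; apply: measurableI => //; exact: natm.
- move=> _ _ [A [M [nA mM PM ->]]] [A' [M' [nA' mM' PM' ->]]].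
  exists (A `&` A'), (M `&` M'); split => //.
  + exact: natI.
  + exact: measurableI.
  + case: PM => PM; first by left; rewrite setIC P0.
    by case: PM' => PM'; [left; rewrite P0|right; rewrite P1].
  + by rewrite setIACA.
- exists setT, setT; split => //; first exact: measurable_wrt_setT.
    by right; rewrite probability_setT.
  by rewrite setTI.
- by apply: prode_ge0 => i _; exact: measure_ge0.
- move=> _ [A [M [nA mM PM ->]]].
  have mA := natm _ nA; have mAD := measurableI _ _ mA mD.
  rewrite -setIA [M `&` D]setIC setIA; case: PM => PM.
    by rewrite !P0 ?mul0e.
  rewrite (P1 M (A `&` D))// (P1 M A)//; exact: (bm_increments bm s0 st nA mB).
- move: E FE; apply: smallest_sub; first exact: smallest_sigma_algebra.
  move=> A PA; refine (generated_mem _); case: PA => [nA|[mA PA]].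
    exists A, setT; split => //; last by rewrite setIT.
      exact: (generated_mem _).
    by right; rewrite probability_setT.
  exists setT, A; split => //; first exact: measurable_wrt_setT.
    by left.
  by rewrite setTI.
Qed.

End AugmentedBrownianMotion.

Section IncrementMoments.
Context (R : realType) (d : measure_display) (T : measurableType d)
  (P : probability T R) (n : nat) (W : R -> T -> 'cV[R]_n).
Hypothesis bm : standard_brownian_motion P W.

Let F := augmented_filtration P W.

Definition increment (j : 'I_n) (s t : R) (w : T) : R :=
  component W j t w - component W j s w.

Lemma increment_measurable j s t : 0 <= s -> s <= t ->
  measurable_fun setT (increment j s t).
Proof.
move=> s0 st; apply: measurable_funB => //; apply: (bm_measurable bm) => //.
exact: le_trans st.
Qed.

Lemma increment_indep j (s t : R) (B : set R) (E : set T) : 0 <= s -> s < t ->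
  measurable B -> F s E ->
  P (E `&` increment j s t @^-1` B) =
    (P E * normal_prob 0 (Num.sqrt (t - s)) B)%E.
Proof.
move=> s0 st mB FE.
have := filtration_increments bm s0 st FE
  (B := fun i => if i == j then B else setT).
move=> /(_ _)/[dup] h; rewrite (bigD1 j)//= eqxx big1 ?mule1; last first.
  move=> i /negbTE ->; exact: (@probability_setT _ _ _ (normal_prob 0 (Num.sqrt (t - s)))).
move=> <-; last by move=> i; case: ifP.
congr (P (_ `&` _)); apply/seteqP; split => w /=.
  by move=> h' i; case: eqP => // ->; move: h'; rewrite /increment /component !mxE.
by move=> /(_ j); rewrite eqxx /increment /component !mxE.
Qed.

Lemma increment_expectation j s t (zeta : T -> R) (g : R -> R) :
    0 <= s -> s < t -> measurable_wrt (F s) zeta -> L1 P zeta ->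
    L1 (normal_prob 0 (Num.sqrt (t - s))) g ->
  L1 P (fun w => zeta w * g (increment j s t w)) /\
  Ex P (fun w => zeta w * g (increment j s t w)) =
    Ex P zeta * Ex (normal_prob 0 (Num.sqrt (t - s))) g.
Proof.
move=> s0 st mz iz ig.
apply: indep_expectation => //.
- exact: L1_measurable iz.
- exact: increment_measurable (ltW st).
- by move=> A B mA mB; apply: increment_indep => //; exact: mz.
Qed.

Lemma increment_moment1 j s t (zeta : T -> R) :
    0 <= s -> s <= t -> measurable_wrt (F s) zeta -> L1 P zeta ->
  L1 P (fun w => zeta w * increment j s t w) /\
  Ex P (fun w => zeta w * increment j s t w) = 0.
Proof.
move=> s0; rewrite le_eqVlt => /predU1P[<-|st] mz iz.
  rewrite (_ : (fun _ => _) = (fun=> 0)).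
    by split; [exact: L1_cst|exact: Ex_cst].
  by apply/funext => w; rewrite /increment subrr mulr0.
have sq0 : 0 < Num.sqrt (t - s) by rewrite sqrtr_gt0 subr_gt0.
have [i e] := @increment_expectation j s t zeta _ s0 st mz iz
  (normal_moment1_integrable sq0).
by split => //; rewrite e (normal_moment1 sq0) mulr0.
Qed.

Lemma increment_moment2 j s t (zeta : T -> R) :
    0 <= s -> s <= t -> measurable_wrt (F s) zeta -> L1 P zeta ->
  L1 P (fun w => zeta w * increment j s t w ^+ 2) /\
  Ex P (fun w => zeta w * increment j s t w ^+ 2) = (t - s) * Ex P zeta.
Proof.
move=> s0; rewrite le_eqVlt => /predU1P[<-|st] mz iz.
  rewrite (_ : (fun _ => _) = (fun=> 0)).
    by split; [exact: L1_cst|rewrite Ex_cst subrr mul0r].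
  by apply/funext => w; rewrite /increment subrr expr0n mulr0.
have sq0 : 0 < Num.sqrt (t - s) by rewrite sqrtr_gt0 subr_gt0.
have [i e] := @increment_expectation j s t zeta _ s0 st mz iz
  (normal_moment2_integrable sq0).
split => //; rewrite e (normal_moment2 sq0) sqr_sqrtr ?subr_ge0 ?(ltW st)//.
by rewrite mulrC.
Qed.

Lemma increment_moment4 j s t : 0 <= s -> s <= t ->
  L1 P (fun w => increment j s t w ^+ 4) /\
  Ex P (fun w => increment j s t w ^+ 4) <= 48 * expR (1 / 2) * (t - s) ^+ 2.
Proof.
move=> s0; rewrite le_eqVlt => /predU1P[<-|st].
  rewrite (_ : (fun _ => _) = (fun=> 0)).
    by split; [exact: L1_cst|rewrite Ex_cst subrr expr0n mulr0].
  by apply/funext => w; rewrite /increment subrr expr0n.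
have sq0 : 0 < Num.sqrt (t - s) by rewrite sqrtr_gt0 subr_gt0.
have [i4 e4] := normal_moment4 sq0.
have [i e] := @increment_expectation j s t (fun=> 1) _ s0 st
  (@measurable_wrt_cst _ _ _ _) (L1_cst P 1) i4.
have E : (fun w => 1 * increment j s t w ^+ 4) = (fun w => increment j s t w ^+ 4).
  by apply/funext => w; rewrite mul1r.
rewrite E Ex_cst mul1r in i e; split => //; rewrite e; apply: le_trans e4 _.
by rewrite (_ : 4 = 2 * 2)%N// exprM sqr_sqrtr// subr_ge0 ltW.
Qed.

(** The k-th increment must be independent not of the past alone but of the past together with the
    j-th increment. The sets of [C] form a pi-system generating that larger sigma-algebra, on which
    the joint product formula gives independence; then the mean factors through the vanishing mean
    of the k-th increment. *)
Lemma increment_cross j k s t (zeta : T -> R) : j != k ->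
    0 <= s -> s <= t -> measurable_wrt (F s) zeta -> L1 P zeta ->
  L1 P (fun w => zeta w * increment j s t w * increment k s t w) /\
  Ex P (fun w => zeta w * increment j s t w * increment k s t w) = 0.
Proof.
move=> jk s0; rewrite le_eqVlt => /predU1P[<-|st] mz iz.
  rewrite (_ : (fun _ => _) = (fun=> 0)).
    by split; [exact: L1_cst|exact: Ex_cst].
  by apply/funext => w; rewrite /increment [X in _ * X = _]subrr mulr0.
have sq0 : 0 < Num.sqrt (t - s) by rewrite sqrtr_gt0 subr_gt0.
set N : probability (measurableTypeR R) R := normal_prob 0 (Num.sqrt (t - s)).
have mI := increment_measurable _ s0 (ltW st).
pose C := [set E | exists A B, [/\ F s A, measurable B &
  E = A `&` increment j s t @^-1` B]].
have mpre i (B : set R) : measurable B -> measurable (increment i s t @^-1` B).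
  by move=> mB; rewrite -[X in measurable X]setTI; exact: mI.
have FC A : F s A -> <<s C>> A.
  move=> FA; refine (generated_mem _); exists A, setT; split => //.
  by rewrite preimage_setT setIT.
have CI B : measurable B -> <<s C>> (increment j s t @^-1` B).
  move=> mB; refine (generated_mem _); exists setT, B; split => //.
    exact: measurable_wrt_setT.
  by rewrite setTI.
have indepC (B' : set R) (E : set T) : measurable B' -> <<s C>> E ->
    P (E `&` increment k s t @^-1` B') = (P E * N B')%E.
  move=> mB' CE; apply: (@indep_event_generated _ _ T P C) CE => //.
  - move=> _ [A [B [FA mB ->]]]; apply: measurableI; last exact: mpre.
    exact: (filtration_measurable bm FA).
  - move=> _ _ [A [B [FA mB ->]]] [A' [B'' [FA' mB'' ->]]].
    exists (A `&` A'), (B `&` B''); split => //.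
    + exact: measurable_wrtTI.
    + exact: measurableI.
    + by rewrite preimage_setI setIACA.
  - exists setT, setT; split => //; first exact: measurable_wrt_setT.
    by rewrite preimage_setT setIT.
  - exact: mpre.
  - move=> _ [A [B [FA mB ->]]]; rewrite (increment_indep j s0 st mB FA).
    rewrite -setIA.
    have := filtration_increments bm s0 st FA
      (B := fun i => if i == j then B else if i == k then B' else setT).
    rewrite (bigD1 j)//= eqxx (bigD1 k)//=; last by rewrite eq_sym.
    rewrite [X in if X then _ else _]eq_sym (negbTE jk) eqxx big1 ?mule1.
      rewrite /N -muleA => <-; last by move=> i; do 2 case: ifP => //.
      congr (P (_ `&` _)); apply/seteqP; split => w /=.
        move=> [h1 h2] i; case: eqP => [->|_].
          by move: h1; rewrite /increment /component !mxE.
        by case: eqP => // ->; move: h2; rewrite /increment /component !mxE.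
      move=> h; split; [have := h j|have := h k]; rewrite ?eqxx.
        by rewrite /increment /component !mxE.
      by rewrite eq_sym (negbTE jk) /increment /component !mxE.
    move=> i /andP[/negbTE -> /negbTE ->].
    exact: (@probability_setT _ _ _ N).
have mzC : measurable_wrt <<s C>> zeta by move=> B mB; exact: (FC _ (mz _ mB)).
have mprod : measurable_wrt <<s C>> (fun w => zeta w * increment j s t w).
  exact: measurable_wrtM.
have [i1 e1] := increment_moment1 j s0 (ltW st) mz iz.
have [i e] := @indep_expectation _ _ T P N _ (increment k s t)
  (L1_measurable i1) (mI k) (fun A B mA mB => indepC B _ mB (mprod A mA)) _
  i1 (normal_moment1_integrable sq0).
by split => //; rewrite e e1 mul0r.
Qed.

End IncrementMoments.

(** * Joint measurability and the energy of integrands *)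

Section JointMeasurability.
Context (R : realType) (d : measure_display) (T : measurableType d).
Implicit Types Y : R -> T -> R.

Definition jointly_measurable Y :=
  measurable_fun [set: measurableTypeR R * T] (fun z => Y z.1 z.2).

Lemma within_nneg_cvg (f : R -> R) (u : nat -> R) (r : R) :
  {within `[0, +oo[%classic, continuous f} -> 0 <= r ->
  (forall k, 0 <= u k) -> u @ \oo --> r -> (f \o u) @ \oo --> f r.
Proof.
move=> /subspace_continuousP cf r0 u0 ur.
have A0 : (`[0, +oo[%classic : set R) r by rewrite /= in_itv/= r0.
have /cvgrPdist_lt cfr := cf _ A0.
apply/cvgrPdist_lt => e e0.
have := cfr e e0; rewrite near_withinE => /nbhs_ballP[del /= del0 fdel].
have /cvgrPdist_lt/(_ _ del0) := ur.
apply: filterS => k uk /=; apply: (fdel (u k)) => //.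
by rewrite in_itv/= u0.
Qed.

(** Freezing a path at its initial value for negative times turns continuity within the half-line
    into continuity on the whole line. *)
Lemma continuous_paths_max0 Y w : continuous_paths Y ->
  continuous (fun r : R => Y (Num.max 0 r) w).
Proof.
move=> cY r; have /subspace_continuousP cf := cY w.
have A0 x : (`[0, +oo[%classic : set R) (Num.max 0 x).
  by rewrite /= in_itv/= le_max lexx.
have /cvgrPdist_lt cfr := cf _ (A0 r).
apply/cvgrPdist_lt => e e0.
have := cfr e e0; rewrite near_withinE => /nbhs_ballP[del /= del0 fdel].
near=> x; apply: (fdel (Num.max 0 x) _ (A0 x)).
rewrite /ball/=; apply: (@le_lt_trans _ _ `|r - x|).
  case: (leP 0 r) => r0; case: (leP 0 x) => x0; rewrite ?subrr ?normr0//.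
  - by rewrite subr0 ger0_norm// ler_normr; apply/orP; left; lra.
  - by rewrite sub0r normrN (ger0_norm x0) ler_normr; apply/orP; right; lra.
by near: x; exact: (nbhsx_ballx r del del0).
Unshelve. all: by end_near. Qed.

(** At mesh 1/(m+1), the process read at the grid point to the left of the time has preimages that
    are countable unions of measurable rectangles; path continuity makes these approximations
    converge pointwise. *)
Lemma jointly_measurable_continuous Y : continuous_paths Y ->
  (forall r, 0 <= r -> measurable_fun setT (Y r)) ->
  jointly_measurable (fun r w => Y (Num.max 0 r) w).
Proof.
move=> cY mY.
pose t m (r : R) : nat := Num.truncn (m.+1%:R * Num.max 0 r).
have t0 m (r : R) : 0 <= m.+1%:R * Num.max 0 r.
  by rewrite mulr_ge0// le_max lexx.
apply: (measurable_fun_cvg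
  (h := fun m z => Y ((t m z.1)%:R / m.+1%:R) z.2)) => /=.
- move=> m _ B mB; rewrite setTI.
  rewrite (_ : _ @^-1` _ = \bigcup_k
    ([set r : measurableTypeR R | k%:R <= m.+1%:R * Num.max 0 r < k.+1%:R] `*`
     (Y (k%:R / m.+1%:R) @^-1` B))).
    apply: bigcupT_measurable => k; apply: measurableX.
      rewrite (_ : [set r : measurableTypeR R | _] =
        (fun r : R => m.+1%:R * Num.max 0 r) @^-1` `[k%:R, k.+1%:R[%classic).
        rewrite -[X in measurable X]setTI.
        suff : measurable_fun [set: R] (fun r : R => m.+1%:R * Num.max 0 r).
          by apply => //; exact: measurable_itv.
        by apply: measurable_funM => //; exact: measurable_maxr.
      by apply/seteqP; split => r /=; rewrite in_itv.
    rewrite -[X in measurable X]setTI; apply: mY => //.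
  apply/seteqP; split => [[r w] /= h|[r w] [k _ [/= h]]].
    by exists (t m r) => //; split => //=; exact: truncn_itv.
  by rewrite /t (truncn_def h).
- move=> [r w] _ /=.
  apply: (@within_nneg_cvg (fun s => Y s w)) => //.
    by rewrite le_max lexx.
  set r0 := Num.max 0 r.
  apply/cvgrPdist_lt => e e0; near=> k.
  have /andP[h1 h2] := truncn_itv (t0 k r); rewrite -/(t k r) -/r0 in h1 h2.
  have h3 : (t k r)%:R / k.+1%:R <= r0 by rewrite ler_pdivrMr// mulrC.
  have h4 : r0 < (t k r)%:R / k.+1%:R + k.+1%:R^-1.
    by rewrite -[X in _ + X]mul1r -mulrDl ltr_pdivlMr// mulrC natr1.
  rewrite ger0_norm ?subr_ge0//.
  apply: (@lt_trans _ _ k.+1%:R^-1); first by rewrite ltrBlDl.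
  near: k; exact: near_infty_natSinv_lt (PosNum e0).
Unshelve. all: by end_near. Qed.

End JointMeasurability.

Section Energy.
Context (R : realType) (d : measure_display) (T : measurableType d)
  (P : probability T R).
Implicit Types (Y Z : R -> T -> R) (f g : R -> R) (s t K : R).
Let leb := @lebesgue_measure R.

Lemma jointly_measurableB Y Z : jointly_measurable Y -> jointly_measurable Z ->
  jointly_measurable (fun r w => Y r w - Z r w).
Proof. by move=> mY mZ; exact: measurable_funB. Qed.

Lemma jointly_measurableM Y Z : jointly_measurable Y -> jointly_measurable Z ->
  jointly_measurable (fun r w => Y r w * Z r w).
Proof. by move=> mY mZ; exact: measurable_funM. Qed.

Lemma jointly_measurable_event (f : T -> R) : measurable_fun setT f ->
  jointly_measurable (fun _ w => f w).
Proof.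
by move=> mf; apply: (measurableT_comp mf); exact: measurable_snd.
Qed.

Lemma jointly_measurable_time f : measurable_fun [set: measurableTypeR R] f ->
  jointly_measurable (fun r (_ : T) => f r).
Proof.
by move=> mf; apply: (measurableT_comp mf); exact: measurable_fst.
Qed.

Lemma jointly_measurable_sum (I : Type) (e : seq I) (Q : pred I)
    (Y : I -> R -> T -> R) : (forall i, jointly_measurable (Y i)) ->
  jointly_measurable (fun r w => \sum_(i <- e | Q i) Y i r w).
Proof.
move=> mY; rewrite /jointly_measurable; elim: e => [|i e IH].
  by under eq_fun do rewrite big_nil; exact: measurable_cst.
under eq_fun do rewrite big_cons; case: (Q i) => //.
by apply: measurable_funD => //; exact: mY.
Qed.

Lemma jointly_measurable_path Y w : jointly_measurable Y ->
  measurable_fun [set: measurableTypeR R] (fun r => Y r w).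
Proof.
move=> mY; apply: (measurableT_comp mY (g := fun r : measurableTypeR R => (r, w))).
exact: measurable_fun_pair.
Qed.

Lemma jointly_measurable_section Y r : jointly_measurable Y ->
  measurable_fun setT (Y r).
Proof.
move=> mY; apply: (measurableT_comp mY (g := fun w : T => (r : measurableTypeR R, w))).
exact: measurable_fun_pair.
Qed.

Lemma measurable_time_itv a b :
  measurable_fun [set: measurableTypeR R] (fun r : R => ((a < r <= b)%R%:R : R)).
Proof.
rewrite (_ : (fun _ => _) = \1_(`]a, b]%classic : set (measurableTypeR R))).
  exact: measurable_indic.
apply/funext => r; rewrite indicE; congr ((nat_of_bool _)%:R).
by apply/idP/idP => [h|]; [rewrite inE/= in_itv/=|rewrite inE/= in_itv/=].
Qed.

Lemma integral_itv_cst c s t : s <= t ->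
  (\int[leb]_(r in `[s, t]) c%:E = (c * (t - s))%:E)%E.
Proof.
move=> st; rewrite integral_cst// EFinM; congr (_ * _)%E.
suff : leb `[s, t]%classic = (t - s)%:E.
  by apply.
rewrite /leb lebesgue_measure_itv/= lte_fin.
by case: ltgtP st => // -> _; rewrite subrr.
Qed.

Definition energy s t f : \bar R :=
  (\int[leb]_(r in `[s, t]) ((f r) ^+ 2)%:E)%E.

Lemma energy_ge0 s t f : (0 <= energy s t f)%E.
Proof. by apply: integral_ge0 => r _; rewrite lee_fin sqr_ge0. Qed.

Let ind s t (r : measurableTypeR R) : R := \1_(`[s, t]%classic) r.

Let energyE s t Y w : energy s t (Y^~ w) =
  (\int[leb]_r ((Y r w) ^+ 2 * ind s t r)%:E)%E.
Proof.
rewrite /energy integral_mkcond; apply: eq_integral => r _.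
by rewrite patchE /ind indicE; case: ifPn => h; rewrite ?mulr1 ?mulr0.
Qed.

Let mind s t Y : jointly_measurable Y ->
  measurable_fun [set: measurableTypeR R * T]
    (fun z => ((Y z.1 z.2) ^+ 2 * ind s t z.1)%:E).
Proof.
move=> mY; apply/measurable_EFinP; apply: measurable_funM.
  exact: measurable_funX.
apply: (jointly_measurable_time (f := ind s t)).
exact: measurable_indic.
Qed.

Lemma energy_measurable s t Y : jointly_measurable Y ->
  measurable_fun setT (fun w => energy s t (Y^~ w)).
Proof.
move=> mY; under eq_fun do rewrite energyE.
apply: (measurable_fun_fubini_tonelli_G (m1 := leb)
  (fun z => ((Y z.1 z.2) ^+ 2 * ind s t z.1)%:E)).
  exact: mind.
by move=> z; rewrite lee_fin mulr_ge0// ?sqr_ge0.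
Qed.

(** By Tonelli's theorem the mean energy is the time integral of the second moments. *)
Lemma energy_expectation s t Y (c : R) : s <= t -> jointly_measurable Y ->
  (forall r, s <= r -> r <= t -> L1 P (fun w => Y r w ^+ 2) /\
    Ex P (fun w => Y r w ^+ 2) <= c) ->
  (\int[P]_w energy s t (Y^~ w) <= (c * (t - s))%:E)%E.
Proof.
move=> st mY Yc; under eq_integral do rewrite energyE.
rewrite -(fubini_tonelli (m1 := leb) (m2 := P)
  (fun z => ((Y z.1 z.2) ^+ 2 * ind s t z.1)%:E)); last 2 first.
- exact: mind.
- by move=> z; rewrite lee_fin mulr_ge0// ?sqr_ge0.
rewrite -(integral_itv_cst c st).
have c0 : 0 <= c.
  have [] := Yc s (lexx _) st; move=> _; apply: le_trans.
  by apply: Ex_ge0 => w; exact: sqr_ge0.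
rewrite [leRHS]integral_mkcond; apply: ge0_le_integral => //.
- move=> r _; apply: integral_ge0 => w _.
  by rewrite lee_fin mulr_ge0// ?sqr_ge0.
- apply: (measurable_fun_fubini_tonelli_F (m2 := P)
    (fun z => ((Y z.1 z.2) ^+ 2 * ind s t z.1)%:E)).
    exact: mind.
  by move=> z; rewrite lee_fin mulr_ge0// ?sqr_ge0.
- apply/measurable_restrict => //; exact: measurable_cst.
- move=> r _; rewrite /= patchE; case: ifPn => h.
    have e1 : ind s t r = 1 by rewrite /ind indicE h.
    under eq_integral do rewrite e1 mulr1.
    move: h; rewrite inE/= in_itv/= => /andP[sr rt].
    have [i e] := Yc r sr rt.
    by rewrite -ExE// lee_fin.
  have e0 : ind s t r = 0 by rewrite /ind indicE (negbTE h).
  by under eq_integral do rewrite e0 mulr0; rewrite integral0.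
Qed.

Lemma energy_subset a b s t f : measurable_fun [set: measurableTypeR R] f ->
  s <= a -> b <= t -> (energy a b f <= energy s t f)%E.
Proof.
move=> mf sa bt; apply: ge0_subset_integral => //=.
- apply/measurable_EFinP/measurable_funTS; exact: measurable_funX.
- by move=> r _; rewrite lee_fin sqr_ge0.
- by move=> r /=; rewrite !in_itv/= => /andP[ar rb]; rewrite (le_trans sa ar) (le_trans rb bt).
Qed.

Lemma energy_bounded s t f K : s <= t -> measurable_fun [set: measurableTypeR R] f ->
  (forall r, s <= r -> r <= t -> `|f r| <= K) ->
  (energy s t f <= (K ^+ 2 * (t - s))%:E)%E.
Proof.
move=> st mf fK.
rewrite -(integral_itv_cst _ st).
apply: ge0_le_integral => //=.
- by move=> r _; rewrite lee_fin sqr_ge0.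
- apply/measurable_EFinP/measurable_funTS; exact: measurable_funX.
- move=> r; rewrite in_itv/= => /andP[sr rt].
  rewrite lee_fin -(real_normK (num_real (f r))).
  by rewrite lerXn2r ?nnegrE// ?fK// (le_trans _ (fK r sr rt)).
Qed.

(* (x + y)^2 <= (1 + k) x^2 + (1 + 1/k) y^2 *)
Lemma energy_add s t f g (k : R) : 0 < k ->
  measurable_fun [set: measurableTypeR R] f ->
  measurable_fun [set: measurableTypeR R] g ->
  (energy s t (fun r => f r + g r)%R <=
    (1 + k)%:E * energy s t f + (1 + k^-1)%:E * energy s t g)%E.
Proof.
move=> k0 mf mg.
have mf2 : measurable_fun (`[s, t]%classic : set (measurableTypeR R)) (fun r => (f r ^+ 2)%:E).
  apply/measurable_EFinP/measurable_funTS; exact: measurable_funX.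
have mg2 : measurable_fun (`[s, t]%classic : set (measurableTypeR R)) (fun r => (g r ^+ 2)%:E).
  apply/measurable_EFinP/measurable_funTS; exact: measurable_funX.
have k1 : 0 <= 1 + k by rewrite addr_ge0// ltW.
have k2 : 0 <= 1 + k^-1 by rewrite addr_ge0// invr_ge0 ltW.
rewrite /energy -ge0_integralZl//=; last by move=> r _; rewrite lee_fin sqr_ge0.
rewrite -ge0_integralZl//=; last by move=> r _; rewrite lee_fin sqr_ge0.
rewrite -ge0_integralD//=; last 4 first.
- by move=> r _; rewrite -EFinM lee_fin mulr_ge0// sqr_ge0.
- exact: measurable_funeM.
- by move=> r _; rewrite -EFinM lee_fin mulr_ge0// sqr_ge0.
- exact: measurable_funeM.
apply: ge0_le_integral => //=.
- by move=> r _; rewrite lee_fin sqr_ge0.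
- apply/measurable_EFinP/measurable_funTS; apply: measurable_funX.
  exact: measurable_funD.
- by apply: emeasurable_funD; exact: measurable_funeM.
- move=> r _; rewrite -!EFinM -EFinD lee_fin; move: (f r) (g r) => x y.
  have -> : (1 + k) * x ^+ 2 + (1 + k^-1) * y ^+ 2 =
      (x + y) ^+ 2 + k * (x - k^-1 * y) ^+ 2.
    by field; rewrite gt_eqF.
  by rewrite lerDl mulr_ge0 ?sqr_ge0// ltW.
Qed.

End Energy.

(** * Step processes *)

Section StepProcesses.
Context (R : realType) (d : measure_display) (T : measurableType d)
  (P : probability T R) (n : nat) (W : R -> T -> 'cV[R]_n).
Hypothesis bm : standard_brownian_motion P W.
Variable j : 'I_n.

Let F := augmented_filtration P W.

Definition bounded_rv (f : T -> R) := exists M, forall w, `|f w| <= M.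

Section Grid.
Variables (s t : R) (g : nat -> R) (c : nat -> T -> R).
Hypotheses (s_ge0 : 0 <= s) (g_mono : forall l, g l <= g l.+1)
  (g_itv : forall l, s <= g l <= t)
  (c_meas : forall l, measurable_wrt (F (g l)) (c l))
  (c_bnd : forall l, bounded_rv (c l)).

Definition step_integral N w := \sum_(l < N) c l w * increment W j (g l) (g l.+1) w.
Definition step_value N r w : R := \sum_(l < N) c l w * (g l < r <= g l.+1)%R%:R.
Definition step_quad N w := \sum_(l < N) c l w ^+ 2 * (g l.+1 - g l).

Let gnd k l : (k <= l)%N -> g k <= g l.
Proof. by move=> kl; have /nondecreasing_seqP h := g_mono; exact: h. Qed.

Let g0 l : 0 <= g l.
Proof. by have /andP[h _] := g_itv l; exact: le_trans h. Qed.

Let mc l : measurable_fun setT (c l).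
Proof. exact: (measurable_wrt_fun bm (c_meas (l := l))). Qed.

Let c2 l : L1 P (fun w => c l w ^+ 2).
Proof.
have [M cM] := c_bnd l.
apply: (@L1_bounded _ _ _ P _ (M ^+ 2)); first exact: measurable_funX.
move=> w; rewrite ger0_norm ?sqr_ge0// -(real_normK (num_real (c l w))).
by rewrite lerXn2r ?nnegrE// (le_trans _ (cM w)).
Qed.

Lemma step_quad_L1 N : L1 P (step_quad N).
Proof.
apply: L1_sum => l; rewrite (_ : (fun _ => _) =
  (fun w => (g l.+1 - g l) * c l w ^+ 2)); first exact: L1Z.
by apply/funext => w; rewrite mulrC.
Qed.

Lemma step_integral_meas N : measurable_wrt (F (g N)) (step_integral N).
Proof.
apply: measurable_wrt_sum => -[l /= lN]; apply: measurable_wrtM.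
  by apply: measurable_wrt_sub (c_meas (l := l)); exact: (filtration_mono (gnd (ltnW lN))).
by apply: measurable_wrtB; apply: filtration_bm => //; apply: gnd => //; exact: ltnW.
Qed.

(** Induction on the number of steps: the cross term with the last increment has mean zero because
    its coefficient is known at the left end of the interval, and it is integrable because the last
    coefficient is bounded and the earlier sum is square integrable. *)
Lemma step_isometry N : L1 P (fun w => step_integral N w ^+ 2) /\
  Ex P (fun w => step_integral N w ^+ 2) = Ex P (step_quad N).
Proof.
elim: N => [|N [iN eN]].
  rewrite (_ : (fun _ => _) = (fun=> 0)); last first.
    by apply/funext => w; rewrite /step_integral big_ord0 expr0n.
  rewrite (_ : step_quad 0 = (fun=> 0)); last first.
    by apply/funext => w; rewrite /step_quad big_ord0.
  by split => //; exact: L1_cst.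
have mS := @step_integral_meas N.
have iS := L1_sqr (measurable_wrt_fun bm mS) iN.
have [M cM] := c_bnd N.
have iSc : L1 P (fun w => c N w * step_integral N w) by exact: L1_boundedM cM iS.
have [i1 e1] := increment_moment1 bm j (g0 N) (g_mono N)
  (measurable_wrtM (c_meas (l := N)) mS) iSc.
have [i2 e2] := increment_moment2 bm j (g0 N) (g_mono N)
  (measurable_wrtM (c_meas (l := N)) (c_meas (l := N))) (c2 N).
rewrite (_ : (fun _ => _) = (fun w => step_integral N w ^+ 2 +
  (2 * (c N w * step_integral N w * increment W j (g N) (g N.+1) w) +
   c N w * c N w * increment W j (g N) (g N.+1) w ^+ 2))); last first.
  by apply/funext => w; rewrite /step_integral big_ord_recr/=; ring.
have i3 := L1Z 2 i1; have i4 := L1D i3 i2.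
split; first exact: L1D.
rewrite ExD// ExD// ExZ// e1 mulr0 add0r eN e2.
have -> : step_quad N.+1 = (fun w => step_quad N w + (g N.+1 - g N) * c N w ^+ 2).
  by apply/funext => w; rewrite /step_quad big_ord_recr/= [X in _ + X]mulrC.
have i5 := L1Z (g N.+1 - g N) (c2 N).
rewrite ExD//; last exact: step_quad_L1.
by rewrite ExZ.
Qed.

Lemma step_orthogonal N (xi : T -> R) : measurable_wrt (F s) xi ->
  bounded_rv xi ->
  L1 P (fun w => step_integral N w * xi w) /\
  Ex P (fun w => step_integral N w * xi w) = 0.
Proof.
move=> mxi [M xiM].
pose e (l : 'I_N) w := xi w * c l w * increment W j (g l) (g l.+1) w.
have eP l : L1 P (e l) /\ Ex P (e l) = 0.
  apply: increment_moment1 => //.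
    apply: measurable_wrtM; last exact: c_meas.
    apply: measurable_wrt_sub mxi; apply: filtration_mono.
    by have /andP[] := g_itv l.
  have [M' cM] := c_bnd l.
  exact: (L1_boundedM (measurable_wrt_fun bm mxi) xiM (L1_bounded P (@mc l) cM)).
rewrite (_ : (fun _ => _) = (fun w => \sum_(l < N) e l w)); last first.
  apply/funext => w; rewrite /step_integral mulr_suml.
  by apply: eq_bigr => l _; rewrite /e mulrC mulrA.
split; first by apply: L1_sum => l; have [] := eP l.
rewrite Ex_sum; first by apply: big1 => l _; have [] := eP l.
by move=> l; have [] := eP l.
Qed.

(** The intervals of the grid are disjoint, so all cross terms vanish pointwise. *)
Lemma step_value_sqr N r w : step_value N r w ^+ 2 =
  \sum_(l < N) c l w ^+ 2 * (g l < r <= g l.+1)%R%:R.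
Proof.
elim: N => [|N IH]; first by rewrite /step_value !big_ord0 expr0n.
rewrite /step_value big_ord_recr/= -/(step_value N r w) big_ord_recr/= -IH.
have [gr|_] := boolP (g N < r <= g N.+1); last by rewrite !mulr0 !addr0.
rewrite (_ : step_value N r w = 0) ?expr0n ?add0r ?mulr1//.
rewrite /step_value big1// => -[l /= lN] _.
have := gnd lN; move: gr => /andP[gr _] gl.
by rewrite (leNgt r) (le_lt_trans gl gr) andbF mulr0.
Qed.

Lemma step_value_jointly_measurable N : jointly_measurable (step_value N).
Proof.
apply: jointly_measurable_sum => l; apply: jointly_measurableM.
  exact: jointly_measurable_event.
apply: jointly_measurable_time; exact: measurable_time_itv.
Qed.

Lemma step_energy N w : energy s t (step_value N ^~ w) = (step_quad N w)%:E.
Proof.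
rewrite /energy; under eq_integral do rewrite step_value_sqr -sumEFin.
rewrite ge0_integral_sum//=; last 2 first.
- move=> l; apply/measurable_EFinP/measurable_funTS.
  by apply: measurable_funM => //; exact: measurable_time_itv.
- by move=> l r _; rewrite lee_fin mulr_ge0// sqr_ge0.
rewrite -sumEFin; apply: eq_bigr => l _.
under eq_integral do rewrite EFinM.
rewrite ge0_integralZl//=; last 2 first.
- by apply/measurable_EFinP/measurable_funTS; exact: measurable_time_itv.
- by rewrite lee_fin sqr_ge0.
rewrite [RHS]EFinM; congr (_ * _)%E.
have /andP[sl _] := g_itv l; have /andP[_ lt] := g_itv l.+1.
transitivity (\int[lebesgue_measure]_(r in `[s, t])
    (\1_(`]g l, g l.+1]%classic : set (measurableTypeR R)) r)%:E)%E.
  apply: eq_integral => r _; rewrite indicE; congr ((nat_of_bool _)%:R%:E).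
  by apply/idP/idP => [h|]; [rewrite inE/= in_itv/=|rewrite inE/= in_itv/=].
rewrite integral_indic//.
suff : lebesgue_measure (`]g l, g l.+1]%classic `&` `[s, t]%classic : set R) =
    (g l.+1 - g l)%:E by apply.
rewrite setIidl.
  rewrite lebesgue_measure_itv/= lte_fin.
  by case: ltgtP (g_mono l) => // <- _; rewrite subrr.
move=> r /=; rewrite !in_itv/= => /andP[gr rg].
by rewrite (le_trans sl (ltW gr)) (le_trans rg lt).
Qed.

End Grid.

(* The coefficients are set to zero once the accumulated energy exceeds [L];
   by predictability the result is again a step process. *)
Section Truncation.
Variables (s t : R) (g : nat -> R) (c : nat -> T -> R) (L : R).
Hypotheses (s_ge0 : 0 <= s) (g_mono : forall l, g l <= g l.+1)
  (g_itv : forall l, s <= g l <= t)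
  (c_meas : forall l, measurable_wrt (F (g l)) (c l))
  (c_bnd : forall l, bounded_rv (c l)) (L_ge0 : 0 <= L).

(** The index [l.+1] matters twice: the energy up to and including the l-th term involves only
    coefficients known at time [g l], so the truncation is predictable; and counting that term
    prevents an overshoot beyond [L]. *)
Definition truncated l w := c l w * \1_[set w | step_quad g c l.+1 w <= L] w.

Let gnd k l : (k <= l)%N -> g k <= g l.
Proof. by move=> kl; have /nondecreasing_seqP h := g_mono; exact: h. Qed.

Lemma truncated_meas l : measurable_wrt (F (g l)) (truncated l).
Proof.
apply: measurable_wrtM; first exact: c_meas.
apply: measurable_wrt_indic.
apply: measurable_wrt_le; last exact: measurable_wrt_cst.
apply: measurable_wrt_sum => -[k /= kl]; apply: measurable_wrtM.
  have h : measurable_wrt (F (g l)) (c k).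
    exact: (measurable_wrt_sub (filtration_mono (@gnd k l kl)) (@c_meas k)).
  exact: measurable_wrtM.
exact: measurable_wrt_cst.
Qed.

Lemma truncated_sqr_le l w : truncated l w ^+ 2 <= c l w ^+ 2.
Proof.
rewrite /truncated exprMn indicE; case: (_ \in _) => /=.
  by rewrite expr1n mulr1.
by rewrite expr0n mulr0 sqr_ge0.
Qed.

Lemma truncated_bnd l : bounded_rv (truncated l).
Proof.
have [M cM] := c_bnd l; exists M => w; apply: le_trans (cM w).
rewrite /truncated normrM indicE; case: (_ \in _) => /=.
  by rewrite normr1 mulr1.
by rewrite normr0 mulr0.
Qed.

Let quad_mono k l w : (k <= l)%N -> step_quad g c k w <= step_quad g c l w.
Proof.
move=> kl; have /nondecreasing_seqP : forall l, step_quad g c l w <= step_quad g c l.+1 w.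
  move=> i; rewrite /step_quad big_ord_recr/= lerDl.
  by rewrite mulr_ge0 ?sqr_ge0// subr_ge0.
exact.
Qed.

Lemma truncated_quad_le N w : step_quad g truncated N w <= step_quad g c N w.
Proof.
apply: ler_sum => l _; apply: ler_wpM2r; first by rewrite subr_ge0.
exact: truncated_sqr_le.
Qed.

(** Either the untruncated energy is still below [L], or the newest coefficient has been set to zero
    and nothing is added. *)
Lemma truncated_quad_bounded N w : step_quad g truncated N w <= L.
Proof.
elim: N => [|N IH]; first by rewrite /step_quad big_ord0.
have [h|h] := leP (step_quad g c N.+1 w) L.
  exact: le_trans (truncated_quad_le _ _) h.
rewrite /step_quad big_ord_recr/= -/(step_quad g truncated N w).
rewrite {2}/truncated indicE memNset ?mulr0 ?expr0n ?mul0r ?addr0//=.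
by apply/negP; rewrite -ltNge.
Qed.

Lemma truncated_id N l w : (l < N)%N -> step_quad g c N w <= L ->
  truncated l w = c l w.
Proof.
move=> lN h; rewrite /truncated indicE mem_set ?mulr1//=.
exact: le_trans (quad_mono _ lN) h.
Qed.

End Truncation.

(** [I] is the elementary stochastic integral of the step process [V]. Hiding the grid allows
    combinations of integrals over different partitions to be treated alike. *)
Definition is_step (s t : R) (I : T -> R) (V : R -> T -> R) := exists N g c,
  [/\ [/\ forall l, g l <= g l.+1, forall l, s <= g l <= t,
      forall l, measurable_wrt (F (g l)) (c l) & forall l, bounded_rv (c l)],
      I = step_integral g c N & V = step_value g c N].

Lemma is_step_jointly_measurable s t I V : is_step s t I V -> jointly_measurable V.
Proof.
move=> [N [g [c [[_ _ mc _] _ ->]]]]; exact: step_value_jointly_measurable.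
Qed.

(** Convergence in probability controls no moments of [I]. The truncated integral [J] does have
    them: its second moment is the mean of its energy [Q], which is at most [L], and [J] differs
    from [I] only where the energy of [V] exceeds [L]. *)
Lemma step_truncation s t I V L : 0 <= s -> 0 <= L -> is_step s t I V ->
  exists J Q : T -> R,
  [/\ [/\ measurable_fun setT J, L1 P (fun w => J w ^+ 2), L1 P Q &
         Ex P (fun w => J w ^+ 2) = Ex P Q],
      (forall w, 0 <= Q w <= L) /\
        (forall w, (Q w)%:E <= energy s t (V^~ w))%E,
      (forall xi, measurable_wrt (F s) xi -> bounded_rv xi ->
         Ex P (fun w => J w * xi w) = 0) &
      (forall w, (energy s t (V^~ w) <= L%:E)%E -> J w = I w)].
Proof.
move=> s0 L0 [N [g [c [[g_mono g_itv c_meas c_bnd] -> ->]]]].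
have tm := truncated_meas L g_mono c_meas.
have tb := truncated_bnd g L c_bnd.
have [i e] := step_isometry s0 g_mono g_itv tm tb N.
exists (step_integral g (truncated g c L) N), (step_quad g (truncated g c L) N).
split; first split => //.
- exact: (measurable_wrt_fun bm (step_integral_meas s0 g_mono g_itv tm (N := N))).
- exact: step_quad_L1 tm tb N.
- split => w; last first.
    by rewrite (step_energy c g_mono g_itv) lee_fin truncated_quad_le.
  rewrite truncated_quad_bounded// andbT.
  by apply: sumr_ge0 => l _; rewrite mulr_ge0 ?sqr_ge0// subr_ge0.
- by move=> xi mxi bxi; have [] := step_orthogonal s0 g_mono g_itv tm tb N mxi bxi.
- move=> w; rewrite (step_energy c g_mono g_itv) lee_fin => h.
  by apply: eq_bigr => l _; rewrite (truncated_id g_mono _ h).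
Qed.

End StepProcesses.

Lemma grid_exists (R : realType) (s t : R) (e : seq R) : s <= t ->
  (forall x, x \in e -> s <= x <= t) ->
  exists N (g : nat -> R), [/\ forall l, g l <= g l.+1, forall l, s <= g l <= t &
    forall x, x \in e -> exists2 l, (l <= N)%N & g l = x].
Proof.
move=> st he; pose u := sort <=%R (s :: e).
have hu x : x \in u -> s <= x <= t.
  by rewrite mem_sort inE => /predU1P[->|/he]; rewrite ?lexx.
have su : sorted <=%R u by exact: sort_le_sorted.
(* Reading beyond the list returns the default [t], so the grid stays nondecreasing and inside the
   interval for all indices. *)
exists (size u), (nth t u); split.
- move=> l; have [lu|ul] := ltnP l.+1 (size u).
    by apply: (sorted_ltn_nth le_trans) => //; rewrite inE ltnW.
  rewrite [leRHS]nth_default//; have [lu|ul'] := ltnP l (size u).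
    by have /andP[] := hu _ (mem_nth t lu).
  by rewrite nth_default.
- move=> l; have [lu|ul] := ltnP l (size u); first exact/hu/mem_nth.
  by rewrite nth_default// st lexx.
- move=> x xe; have xu : x \in u by rewrite mem_sort inE xe orbT.
  by exists (index x u); rewrite ?nth_index// index_size.
Qed.

(* Both sides are increments of [f (max (g la) (min (g lb) _))] along the grid. *)
Lemma telescope_grid (R : realType) (g : nat -> R) (f : R -> R) (N la lb : nat) :
  (forall l, g l <= g l.+1) -> (la <= N)%N -> (lb <= N)%N -> g la <= g lb ->
  f (g lb) - f (g la) = \sum_(l < N) (g la <= g l < g lb)%R%:R * (f (g l.+1) - f (g l)).
Proof.
move=> gm laN lbN ab.
have gnd k l : (k <= l)%N -> g k <= g l.
  by move=> kl; have /nondecreasing_seqP h := gm; exact: h.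
have gS k l : g l < g k -> g l.+1 <= g k.
  move=> lk; apply: (gnd); rewrite ltnNge; apply/negP => kl.
  by have := gnd _ _ kl; rewrite leNgt lk.
pose h x := f (Num.max (g la) (Num.min (g lb) x)).
transitivity (h (g N) - h (g 0%N)).
  rewrite /h (min_l (gnd _ _ lbN)) (max_r ab).
  rewrite (max_l (_ : Num.min (g lb) (g 0) <= g la))//.
  by rewrite ge_min (gnd 0%N la) ?orbT.
rewrite -(big_mkord xpredT (fun l => (g la <= g l < g lb)%R%:R * (f (g l.+1) - f (g l)))).
rewrite -(telescope_sumr (fun l => h (g l))) //.
apply: eq_big_nat => l _; rewrite /h.
have [lal|] := boolP (g la <= g l); last first.
  rewrite -ltNge => lla.
  rewrite /= mul0r (max_l (_ : Num.min _ (g l.+1) <= _)) ?(max_l (_ : Num.min _ (g l) <= _)) ?subrr//.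
    by rewrite ge_min (ltW lla) orbT.
  by rewrite ge_min gS ?orbT.
have [llb|] := boolP (g l < g lb); last first.
  rewrite -leNgt => lbl.
  rewrite /= mul0r (min_l lbl) (min_l (le_trans lbl (gm l))).
  by rewrite subrr.
rewrite /= mul1r (min_r (gS _ _ llb)) (min_r (ltW llb)) (max_r lal).
by rewrite (max_r (le_trans lal (gm l))).
Qed.

Section Items.
Context (R : realType) (d : measure_display) (T : measurableType d)
  (P : probability T R) (n : nat) (W : R -> T -> 'cV[R]_n).
Variable j : 'I_n.
Let F := augmented_filtration P W.

(** Elementary integrals over overlapping intervals are rewritten on the common refinement of all
    their end points. Differences of simple processes with unrelated partitions, and the subtraction
    of a frozen coefficient, thereby become single step integrals. *)
Lemma is_step_items (s t : R) (I : finType) (a b : I -> R) (xi : I -> T -> R) :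
  s <= t -> (forall i, s <= a i /\ a i <= b i /\ b i <= t) ->
  (forall i, measurable_wrt (F (a i)) (xi i)) -> (forall i, bounded_rv (xi i)) ->
  is_step P W j s t (fun w => \sum_i xi i w * increment W j (a i) (b i) w)
    (fun r w => \sum_i xi i w * (a i < r <= b i)%R%:R).
Proof.
move=> st ab mxi bxi.
pose e := [seq a i | i <- enum I] ++ [seq b i | i <- enum I].
have ae i : a i \in e by rewrite mem_cat map_f// mem_enum.
have be i : b i \in e by rewrite mem_cat orbC map_f// mem_enum.
have [|N [g [g_mono g_itv ge]]] := @grid_exists R s t e st.
  move=> x; rewrite mem_cat => /orP[] /mapP[i _ ->].
    by have [-> [h /(le_trans h)]] := ab i.
  by have [h [/(le_trans h) -> ->]] := ab i.
pose c l w := \sum_i xi i w * (a i <= g l < b i)%R%:R.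
have tele i (f : R -> R) : f (b i) - f (a i) =
    \sum_(l < N) (a i <= g l < b i)%R%:R * (f (g l.+1) - f (g l)).
  have [la laN ga] := ge _ (ae i); have [lb lbN gb] := ge _ (be i).
  have [_ [h _]] := ab i.
  have := telescope_grid f g_mono laN lbN; rewrite ga gb; exact.
exists N, g, c; split; first split => //.
- move=> l.
  (* The coefficient [xi i] need not be known at time [g l] when [a i] lies later, but its indicator
     then vanishes and it may be replaced by 0. *)
  pose y i w : R := if a i <= g l then xi i w else 0.
  have my i : measurable_wrt (F (g l)) (y i).
    rewrite /y; case: (boolP (a i <= g l)) => ai; last exact: measurable_wrt_cst.
    exact: (measurable_wrt_sub (filtration_mono ai) (@mxi i)).
  rewrite (_ : c l = fun w => \sum_i y i w * (g l < b i)%R%:R).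
    apply: measurable_wrt_sum => i; apply: measurable_wrtM; first exact: my.
    exact: measurable_wrt_cst.
  apply/funext => w; apply: eq_bigr => i _; rewrite /y.
  by case: ifP => _ //=; rewrite mulr0 mul0r.
- move=> l; have /choice[M hM] := bxi.
  exists (\sum_i M i) => w; apply: le_trans (ler_norm_sum _ _ _) _.
  apply: ler_sum => i _; apply: le_trans (hM i w).
  by rewrite normrM ler_piMr//; case: (_ && _); rewrite ?normr1 ?normr0.
- apply/funext => w; rewrite /step_integral.
  under [RHS]eq_bigr do rewrite mulr_suml.
  rewrite exchange_big/=; apply: eq_bigr => i _.
  rewrite /increment (tele i (fun r => component W j r w)) mulr_sumr.
  by apply: eq_bigr => l _; rewrite mulrA.
- apply/funext => r; apply/funext => w; rewrite /step_value.
  under [RHS]eq_bigr do rewrite mulr_suml.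
  rewrite exchange_big/=; apply: eq_bigr => i _.
  (* The indicator of a half-open interval is the increment of the function that tests r <= x, so
     the telescoping used for the integral also serves for the integrand. *)
  have ind (x y : R) : x <= y ->
      (x < r <= y)%R%:R = (r <= y)%R%:R - (r <= x)%R%:R :> R.
    move=> xy; case: (leP r x) => rx /=; last by rewrite subr0.
    by rewrite (le_trans rx xy) subrr.
  have [_ [h _]] := ab i; rewrite (ind _ _ h) (tele i (fun x => (r <= x)%R%:R)) mulr_sumr.
  by apply: eq_bigr => l _; rewrite mulrA (ind _ _ (g_mono l)).
Qed.

End Items.

Lemma le_of_small (R : realFieldType) (x y M : R) : 0 <= M ->
  (forall k, 0 < k -> k <= 1 -> x <= y + k * M) -> x <= y.
Proof.
move=> M0 h; apply/ler_addgt0Pr => e e0.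
have M1 : 0 < M + 1 by rewrite ltr_wpDl.
pose k := Num.min 1 (e / (M + 1)).
have k0 : 0 < k by rewrite lt_min ltr01 divr_gt0.
have k1 : k <= 1 by rewrite ge_min lexx.
have ke : k * (M + 1) <= e by rewrite -ler_pdivlMr// ge_min lexx orbT.
by apply: le_trans (h k k0 k1) _; lra.
Qed.

(** * Increments of Ito integrals *)

Section LimitsInProbability.
Context (R : realType) (d : measure_display) (T : measurableType d)
  (P : probability T R).

(** Monotone convergence. Capping at m is what makes a bound provable from closeness off an event of
    small probability, since the capped variable contributes at most m times that probability
    there. *)
Lemma L1_truncations (f : T -> R) (c : R) : measurable_fun setT f ->
  (forall w, 0 <= f w) ->
  (forall m : nat, Ex P (fun w => Num.min (f w) m%:R) <= c) ->
  L1 P f /\ Ex P f <= c.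
Proof.
move=> mf f0 fc.
have mm m : measurable_fun setT (fun w => Num.min (f w) m%:R : R).
  exact: measurable_minr.
have m0 m w : 0 <= Num.min (f w) m%:R by rewrite le_min f0 ler0n.
have im m : L1 P (fun w => Num.min (f w) m%:R).
  apply: (L1_bounded (M := m%:R) P (mm m)) => w.
  by rewrite ger0_norm// ge_min lexx orbT.
have : (\int[P]_w (f w)%:E <= c%:E)%E.
  have cv := @cvg_monotone_convergence _ T R P setT measurableT
    (fun m w => (Num.min (f w) m%:R)%:E).
  have -> : (\int[P]_w (f w)%:E =
      \int[P]_w limn (fun m => (Num.min (f w) m%:R)%:E))%E.
    apply: eq_integral => w _; apply/esym/cvg_lim => //.
    apply: cvg_EFin; first exact: nearW.
    apply: cvg_near_cst; exists (Num.truncn (f w)).+1 => // k /= fk.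
    rewrite min_l//; apply: le_trans (_ : (Num.truncn (f w)).+1%:R <= _).
      exact/ltW/truncnS_gt.
    by rewrite ler_nat.
  have {}cv := cv (fun m => proj2 (measurable_EFinP _ _) (mm m))
    (fun m w _ => m0 m w).
  have nd (x : T) : [set: T] x ->
      {homo (fun m => (Num.min (f x) m%:R)%:E) : m p / (m <= p)%N >-> (m <= p)%E}.
    move=> _ m p mp; rewrite lee_fin le_min !ge_min lexx/= orbC.
    by rewrite ler_nat mp.
  have {}cv := cv nd.
  rewrite -(cvg_lim _ cv)//; apply: lime_le; first by apply/cvg_ex; eexists; exact: cv.
  by apply: nearW => m; rewrite -ExE// lee_fin.
move=> fle.
have i : L1 P f.
  apply/integrableP; split; first exact/measurable_EFinP.
  under eq_integral do rewrite /= ger0_norm//.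
  exact: le_lt_trans fle (ltry _).
by split => //; rewrite -lee_fin ExE.
Qed.

Lemma indic_bound (A : set T) (c : R) : measurable A -> (P A <= c%:E)%E ->
  Ex P \1_A <= c.
Proof. by move=> mA; rewrite -(Ex_indic P mA) lee_fin. Qed.

End LimitsInProbability.

Section ItoLimit.
Context (R : realType) (d : measure_display) (T : measurableType d)
  (P : probability T R) (n : nat) (W : R -> T -> 'cV[R]_n).
Hypothesis bm : standard_brownian_motion P W.
Variable j : 'I_n.
Let F := augmented_filtration P W.

Lemma is_step_measurable s t I V : 0 <= s -> is_step P W j s t I V ->
  measurable_fun setT I.
Proof.
move=> s0 [N [g [c [[gm gi mc _] -> _]]]].
apply: (measurable_wrt_fun bm (t := g N)) => B mB.
exact: (step_integral_meas j s0 gm gi mc).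
Qed.

Lemma measurable_ge_set (f : T -> R) (c : R) : measurable_fun setT f ->
  measurable [set w | c <= f w].
Proof.
move=> mf; rewrite -[X in measurable X]setTI.
exact: (measurable_fun_le measurableT (measurable_cst c) mf).
Qed.

Lemma measurable_ge_eset (f : T -> \bar R) (c : \bar R) : measurable_fun setT f ->
  measurable [set w | (c <= f w)%E].
Proof.
move=> mf; rewrite -[X in measurable X]setTI.
exact: (emeasurable_fun_c_infty measurableT mf).
Qed.

(** An inequality of Lenglart type: where the energy stays below [del] the integral agrees with its
    truncation, whose second moment is at most [del], and Chebyshev's inequality applies to the
    latter. *)
Lemma small_energy s t I V (e del : R) : 0 <= s -> 0 < e -> 0 <= del ->
  is_step P W j s t I V ->
  (P [set w | (e <= `|I w|)%R] <=
    P [set w | del%:E <= energy s t (V^~ w)] + (del / e ^+ 2)%:E)%E.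
Proof.
move=> s0 e0 del0 st.
have [J [Q [[mJ J2 iQ EJ] [Q1 _] _ JI]]] := step_truncation bm s0 del0 st.
have mI := is_step_measurable s0 st.
have mA : measurable [set w | e <= `|J w|].
  by apply: measurable_ge_set; exact: measurableT_comp.
have mB : measurable [set w | (del%:E <= energy s t (V^~ w))%E].
  apply: measurable_ge_eset; apply: energy_measurable.
  exact: is_step_jointly_measurable st.
apply: (@le_trans _ _ (P ([set w | (del%:E <= energy s t (V^~ w))%E] `|`
    [set w | (e <= `|J w|)%R]))).
  apply: le_measure; rewrite ?inE//.
  - by apply: measurable_ge_set; exact: measurableT_comp.
  - exact: measurableU.
  - move=> w /= eI; have [h|h] := leP del%:E (energy s t (V^~ w)); first by left.
    by right; rewrite /= JI// ltW.
apply: le_trans (measureU2 P mB mA) _; rewrite leeD2l//.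
have : e ^+ 2 * fine (P [set w | e <= `|J w|]) <= Ex P (fun w => J w ^+ 2).
  apply: Ex_markov => // [w|w /= eJ]; first exact: sqr_ge0.
  by rewrite -(real_normK (num_real (J w))) lerXn2r ?nnegrE// ltW.
rewrite EJ => h.
have EQ : Ex P Q <= del.
  rewrite -[leRHS](Ex_cst P); apply: Ex_le => //; first exact: L1_cst.
  by move=> w; have /andP[] := Q1 w.
have fP : (P [set w | e <= `|J w|]) \is a fin_num by exact: fin_num_measure.
rewrite -[leLHS]fineK// lee_fin ler_pdivlMr ?exprn_gt0// mulrC.
exact: le_trans h EQ.
Qed.

(** Isometry and orthogonality pass to a limit in probability because the energy of [G] is bounded
    pathwise: off an event of small probability the energies of the approximating steps are bounded
    too, so a fixed truncation level does not alter them there and uniform second moments result. *)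
Lemma ito_limit s t (D : T -> R) (G : R -> T -> R) (K gam : R) :
  0 <= s -> s <= t -> measurable_fun setT D -> jointly_measurable G ->
  (forall r w, s <= r -> r <= t -> `|G r w| <= K) ->
  (\int[P]_w energy s t (G^~ w) <= gam%:E)%E ->
  (forall del : R, 0 < del -> exists I V, [/\ is_step P W j s t I V,
     (P [set w | (del <= `|I w - D w|)%R] <= del%:E)%E &
     (P [set w | del%:E <= energy s t (fun r => V r w - G r w)%R] <= del%:E)%E]) ->
  [/\ L1 P (fun w => D w ^+ 2), Ex P (fun w => D w ^+ 2) <= gam &
      forall xi, measurable_wrt (F s) xi -> bounded_rv xi ->
        Ex P (fun w => D w * xi w) = 0].
Proof.
move=> s0 st mD mG GK Gg happ.
pose L := K ^+ 2 * (t - s).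
have L0 : 0 <= L by rewrite mulr_ge0 ?sqr_ge0 ?subr_ge0.
have mGp w := jointly_measurable_path w mG.
have Gen w : (energy s t (G^~ w) <= L%:E)%E.
  by apply: energy_bounded => // r sr rt; exact: GK.
have Gfin w : energy s t (G^~ w) \is a fin_num.
  by rewrite ge0_fin_numE ?energy_ge0// (le_lt_trans (Gen w)) ?ltry.
pose q w := fine (energy s t (G^~ w)).
have qE w : (q w)%:E = energy s t (G^~ w) by rewrite /q fineK.
have q0 w : 0 <= q w by rewrite -lee_fin qE energy_ge0.
have qL w : q w <= L by rewrite -lee_fin qE.
have mq : measurable_fun setT q.
  apply/measurable_EFinP.
  rewrite (_ : _ \o _ = (fun w => energy s t (G^~ w))); last first.
    by apply/funext => w /=; rewrite qE.
  exact: energy_measurable.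
have iq : L1 P q.
  by apply: (L1_bounded (M := L) P mq) => w; rewrite ger0_norm.
have Eq : Ex P q <= gam.
  by rewrite -lee_fin ExE//; under eq_integral do rewrite qE.
have g0 : 0 <= gam by apply: le_trans Eq; exact: Ex_ge0.
(* Off the exceptional event the energy of [V] is at most (1 + k) L + k^2 + k, hence at most 2 L +
   2, so truncation at [L'] has no effect there. The constant [C] adds up the errors of order k: L
   from the factor 1 + k, 2 from k^2 + k, and 2 L' from the exceptional event. *)
pose L' := 2 * L + 4.
have L'0 : 0 <= L' by rewrite /L'; lra.
pose C := L + 2 + 2 * L'.
have C0 : 0 <= C by rewrite /C; lra.
have key (k : R) : 0 < k -> k <= 1 -> exists (J : T -> R) (A : set T),
    [/\ [/\ measurable_fun setT J, L1 P (fun w => J w ^+ 2) &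
          Ex P (fun w => J w ^+ 2) <= gam + k * C],
        (forall xi, measurable_wrt (F s) xi -> bounded_rv xi ->
          Ex P (fun w => J w * xi w) = 0),
        measurable A, Ex P \1_A <= 2 * k ^+ 2 &
        forall w, ~ A w -> `|J w - D w| <= k ^+ 2].
  move=> k0 k1.
  have kk : 0 < k ^+ 2 by rewrite exprn_gt0.
  have k2 : k ^+ 2 <= k by rewrite expr2 ler_piMr// ltW.
  have [I [V [stV PI PV]]] := happ _ kk.
  have [J [Q [[mJ J2 iQ EJ] [Q1 Q2] Jxi JI]]] := step_truncation bm s0 L'0 stV.
  have mI := is_step_measurable s0 stV.
  have mV := is_step_jointly_measurable bm stV.
  pose A1 := [set w | k ^+ 2 <= `|I w - D w|].
  pose A2 := [set w | ((k ^+ 2)%:E <= energy s t (fun r => V r w - G r w)%R)%E].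
  have mA1 : measurable A1.
    apply: measurable_ge_set; apply: measurableT_comp => //.
    exact: measurable_funB.
  have mA2 : measurable A2.
    apply: measurable_ge_eset; apply: (energy_measurable _ _ (Y := fun r w => V r w - G r w)).
    exact: jointly_measurableB.
  have mA : measurable (A1 `|` A2) by exact: measurableU.
  have EA : Ex P \1_(A1 `|` A2) <= 2 * k ^+ 2.
    apply: indic_bound => //; apply: le_trans (measureU2 P mA1 mA2) _.
    by rewrite mulr_natl mulr2n EFinD leeD.
  (* The tolerance k^2 is chosen to absorb the factor 1 + 1/k of [energy_add]: their product is k^2
     + k. *)
  have en w : ~ (A1 `|` A2) w ->
      (energy s t (V^~ w) <= ((1 + k) * q w + (k ^+ 2 + k))%:E)%E.
    move=> /not_orP[_ nA2].
    have nA2' : (energy s t (fun r => V r w - G r w)%R <= (k ^+ 2)%:E)%E.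
      by rewrite ltW// ltNge; apply/negP.
    have mVp := jointly_measurable_path w mV.
    have := @energy_add R s t (G^~ w) (fun r => V r w - G r w) k k0 (mGp w)
      (measurable_funB mVp (mGp w)).
    rewrite (_ : (fun r => G r w + (V r w - G r w)) = V^~ w); last first.
      by apply/funext => r; rewrite addrC subrK.
    move/le_trans; apply; rewrite [leRHS]EFinD -qE [((1 + k) * q w)%:E]EFinM leeD2l//.
    apply: (@le_trans _ _ ((1 + k^-1)%:E * (k ^+ 2)%:E)%E).
      by apply: lee_wpmul2l => //; rewrite lee_fin addr_ge0// invr_ge0 ltW.
    rewrite -EFinM lee_fin le_eqVlt; apply/orP; left; apply/eqP; field.
    by rewrite gt_eqF.
  exists J, (A1 `|` A2); split => //.
    split => //; rewrite EJ.
    have iA := L1_indic P mA.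
    have i1 : L1 P (fun w => (1 + k) * q w + (k ^+ 2 + k) + L' * \1_(A1 `|` A2) w).
      by apply: L1D; [apply: L1D; [exact: L1Z|exact: L1_cst]|exact: L1Z].
    apply: (@le_trans _ _ (Ex P (fun w => (1 + k) * q w + (k ^+ 2 + k) + L' * \1_(A1 `|` A2) w))).
      apply: Ex_le => // w; have [Aw|nAw] := pselect ((A1 `|` A2) w).
        rewrite indicE mem_set// mulr1; have /andP[_ h] := Q1 w.
        apply: le_trans h _; rewrite lerDr addr_ge0// ?mulr_ge0// ?addr_ge0// ltW//.
      rewrite indicE memNset// mulr0 addr0 -lee_fin.
      exact: le_trans (Q2 w) (en w nAw).
    rewrite ExD ?ExD ?ExZ ?Ex_cst//; try exact: L1Z; try exact: L1_cst.
      have EqL : Ex P q <= L.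
        rewrite -[leRHS](Ex_cst P); apply: Ex_le => //; exact: L1_cst.
      have h1 : k * Ex P q <= k * L by rewrite ler_wpM2l// ltW.
      have h2 : L' * Ex P \1_(A1 `|` A2) <= L' * (2 * k).
        apply: ler_wpM2l => //; apply: le_trans EA _; lra.
      rewrite /C; move: h1 h2 Eq k2.
      by move: (Ex P q) (Ex P _) => x y; lra.
    by apply: L1D; [exact: L1Z|exact: L1_cst].
  move=> w nA; rewrite JI.
    by move: nA => /not_orP[nA1 _]; rewrite ltW// ltNge; apply/negP.
  apply: le_trans (en w nA) _; rewrite lee_fin.
  have : k * q w <= q w by rewrite ler_piMl.
  by have := qL w; rewrite /L'; move: (q w) (k ^+ 2) k2 => x y; lra.
have [iD ED] : L1 P (fun w => D w ^+ 2) /\ Ex P (fun w => D w ^+ 2) <= gam.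
  apply: L1_truncations => [|w|m]; [exact: measurable_funX|exact: sqr_ge0|].
  apply: (@le_of_small _ _ _ (gam + 2 * C + 2 + 2 * m%:R)) => [|k k0 k1].
    by have := ler0n R m; lra.
  have [J [A [[mJ J2 EJ] _ mA EA JD]]] := key k k0 k1.
  have k2 : k ^+ 2 <= k by rewrite expr2 ler_piMr// ltW.
  have kk : 0 <= k ^+ 2 by exact: sqr_ge0.
  have iA := L1_indic P mA.
  have i1 : L1 P (fun w => (1 + k) * J w ^+ 2 + (k ^+ 4 + k ^+ 3) + m%:R * \1_A w).
    by apply: L1D; [apply: L1D; [exact: L1Z|exact: L1_cst]|exact: L1Z].
  have m0 w : 0 <= Num.min (D w ^+ 2) m%:R by rewrite le_min sqr_ge0 ler0n.
  apply: (@le_trans _ _ (Ex P (fun w => (1 + k) * J w ^+ 2 + (k ^+ 4 + k ^+ 3) + m%:R * \1_A w))).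
    apply: Ex_le => //.
      apply: (@L1_bounded _ _ _ P _ m%:R) => [|w].
        by apply: measurable_minr => //; exact: measurable_funX.
      by rewrite ger0_norm// ge_min lexx orbT.
    move=> w; have [Aw|nAw] := pselect (A w).
      rewrite indicE mem_set// mulr1 ge_min; apply/orP; right.
      rewrite lerDr; have k0' := ltW k0.
      by apply: addr_ge0; [apply: mulr_ge0; [lra|exact: sqr_ge0]|apply: addr_ge0; exact: exprn_ge0].
    rewrite indicE memNset// mulr0 addr0 ge_min; apply/orP; left.
    have := JD w nAw; move: (J w) (D w) => x y xy.
    (* The square k (|x| - k)^2 pays for the cross term 2 k^2 |x| of (|x| + k^2)^2; the remaining
       summands are zero and only let the identity be checked before replacing |x|^2 by x^2. *)
    have -> : (1 + k) * x ^+ 2 + (k ^+ 4 + k ^+ 3) =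
       k * (`|x| - k) ^+ 2 * 1 + (`|x| + k ^+ 2) ^+ 2 + k * (`|x| ^+ 2 * 0)
       + (k * x ^+ 2 - k * `|x| ^+ 2) + (x ^+ 2 - `|x| ^+ 2).
      by ring.
    rewrite (real_normK (num_real x)) !subrr !mulr0 mulr1 !addr0.
    apply: le_trans (_ : (`|x| + k ^+ 2) ^+ 2 <= _); last first.
      by rewrite lerDr mulr_ge0 ?sqr_ge0// ltW.
    rewrite -(real_normK (num_real y)) lerXn2r ?nnegrE ?addr_ge0//.
    have -> : y = x - (x - y) by ring.
    by apply: le_trans (ler_normB _ _) _; rewrite lerD2l.
  rewrite ExD ?ExD ?ExZ ?Ex_cst//; try exact: L1Z; try exact: L1_cst.
    have h1 : (1 + k) * Ex P (fun w => J w ^+ 2) <= (1 + k) * (gam + k * C).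
      by apply: ler_wpM2l => //; lra.
    have h2 : m%:R * Ex P \1_A <= m%:R * (2 * k).
      apply: ler_wpM2l => //; apply: le_trans EA _; lra.
    have h3 : k * k * C <= k * C by apply: ler_wpM2r => //; rewrite -expr2.
    have k3 : k ^+ 3 <= k.
      by rewrite exprS; apply: ler_piMr; [exact: ltW|exact: le_trans k2 k1].
    have k4 : k ^+ 4 <= k.
      by rewrite exprS; apply: ler_piMr; [exact: ltW|exact: le_trans k3 k1].
    move: h1 h2 h3 k3 k4.
    by lra.
  by apply: L1D; [exact: L1Z|exact: L1_cst].
split => // xi mxi [M xiM].
have M0 : 0 <= M by exact: le_trans (xiM point).
apply/eqP; rewrite -normr_le0.
apply: (@le_of_small _ _ _ (M * (2 + 2 * gam + C))) => [|k k0 k1].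
  by rewrite mulr_ge0//; lra.
rewrite add0r.
have [J [A [[mJ J2 EJ] Jxi mA EA JD]]] := key k k0 k1.
have iA := L1_indic P mA.
have mxi' := measurable_wrt_fun bm mxi.
have iJ := L1_sqr mJ J2; have iD1 := L1_sqr mD iD.
have iJxi : L1 P (fun w => J w * xi w).
  by rewrite (_ : (fun _ => _) = (fun w => xi w * J w)); [exact: L1_boundedM xiM iJ|apply/funext => w; rewrite mulrC].
have iDxi : L1 P (fun w => D w * xi w).
  by rewrite (_ : (fun _ => _) = (fun w => xi w * D w)); [exact: L1_boundedM xiM iD1|apply/funext => w; rewrite mulrC].
(* On the exceptional event |D - J| <= 1/(2k) + k (D^2 + J^2) by completing squares. As that event
   has probability at most 2 k^2, the first term costs only k in mean. *)
have i2 : L1 P (fun w => k ^+ 2 + (2 * k)^-1 * \1_A w + k * (D w ^+ 2 + J w ^+ 2)).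
  apply: L1D; last by apply: L1Z; exact: L1D.
  by apply: L1D; [exact: L1_cst|exact: L1Z].
have -> : Ex P (fun w => D w * xi w) = Ex P (fun w => D w * xi w - J w * xi w).
  by rewrite ExB// Jxi ?subr0//; exists M.
apply: (@le_trans _ _ (Ex P (fun w => M * (k ^+ 2 + (2 * k)^-1 * \1_A w + k * (D w ^+ 2 + J w ^+ 2))))).
  apply: Ex_norm_le; [exact: L1B|exact: L1Z|] => w.
  rewrite -mulrBl normrM mulrC; apply: ler_pM => //.
  have [Aw|nAw] := pselect (A w).
    rewrite indicE mem_set// mulr1 -[leLHS]add0r -addrA; apply: lerD; first exact: sqr_ge0.
    have h : (2 * k)^-1 + k * (D w ^+ 2 + J w ^+ 2) - `|D w - J w| =
        (2 * k)^-1 * (1 - k * `|D w - J w|) ^+ 2 + k / 2 * (D w + J w) ^+ 2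
        + k / 2 * ((D w - J w) ^+ 2 - `|D w - J w| ^+ 2).
      by field; rewrite gt_eqF.
    rewrite -subr_ge0 h (real_normK (num_real _)) subrr mulr0 addr0.
    by apply: addr_ge0; rewrite mulr_ge0 ?sqr_ge0// ?invr_ge0 ?divr_ge0 ?mulr_ge0// ltW.
  rewrite indicE memNset// mulr0 addr0 distrC.
  apply: le_trans (JD w nAw) _; rewrite lerDl mulr_ge0 ?addr_ge0 ?sqr_ge0// ltW//.
rewrite ExZ//.
have -> : k * (M * (2 + 2 * gam + C)) = M * (k * (2 + 2 * gam + C)) by ring.
apply: ler_wpM2l => //.
rewrite ExD ?ExD ?ExZ ?ExD ?Ex_cst//; try exact: L1Z; try exact: L1_cst.
- have h1 : (2 * k)^-1 * Ex P \1_A <= k.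
    by rewrite ler_pdivrMl ?mulr_gt0//; apply: le_trans EA _; rewrite expr2 mulrA.
  have k2 : k ^+ 2 <= k by rewrite expr2 ler_piMr// ltW.
  have h2 : k * (Ex P (fun w => D w ^+ 2) + Ex P (fun w => J w ^+ 2)) <= k * (gam + (gam + C)).
    apply: ler_wpM2l; first exact: ltW.
    apply: lerD => //; apply: le_trans EJ _; rewrite lerD2l ler_piMl//.
  by lra.
- exact: L1D.
- by apply: L1D; [exact: L1_cst|exact: L1Z].
- by apply: L1Z; exact: L1D.
Qed.

End ItoLimit.

Section RestrictedSimple.
Context (R : realType) (d : measure_display) (T : measurableType d)
  (P : probability T R) (n : nat) (W : R -> T -> 'cV[R]_n).
Variable j : 'I_n.
Let F := augmented_filtration P W.
Variables (Phi : simple_process F) (s t : R).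
Hypotheses (s_ge0 : 0 <= s) (st : s <= t).

Definition clamp_time k := Num.max s (Num.min t (sp_time Phi k)).
(** If the original time is at least [t], the coefficient need not be known at the clamped time; the
    clamped interval is then degenerate, so zero can be used instead. *)
Definition clamp_coef k w := if sp_time Phi k < t then sp_coef Phi k w else 0.

Lemma clamp_time_itv k :
  s <= clamp_time k /\ clamp_time k <= clamp_time k.+1 /\ clamp_time k.+1 <= t.
Proof.
rewrite /clamp_time; split; first by rewrite le_max lexx.
have h := sp_time_mono Phi k.
split; last by rewrite ge_max st ge_min lexx.
rewrite ge_max le_max lexx/= le_max; apply/orP; right.
by rewrite le_min !ge_min lexx/= h orbT.
Qed.

Lemma clamp_coef_meas k : measurable_wrt (F (clamp_time k)) (clamp_coef k).
Proof.
rewrite /clamp_coef; case: (boolP (sp_time Phi k < t)) => kt; last exact: measurable_wrt_cst.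
apply: (measurable_wrt_sub _ (@sp_coef_measurable _ _ _ Phi k)).
by apply: filtration_mono; rewrite /clamp_time (min_r (ltW kt)) le_max lexx orbT.
Qed.

Lemma clamp_coef_bounded k : bounded_rv (clamp_coef k).
Proof.
have [M hM] := sp_coef_bounded Phi k; exists M => w.
rewrite /clamp_coef; case: ifP => _ //; rewrite normr0.
exact: le_trans (hM w).
Qed.

Lemma clamp_integral w :
  \sum_(k < sp_size Phi) clamp_coef k w * increment W j (clamp_time k) (clamp_time k.+1) w =
  sp_integral Phi (component W j) t w - sp_integral Phi (component W j) s w.
Proof.
rewrite /sp_integral -sumrB; apply: eq_bigr => k _; rewrite -mulrBr.
have phi x : component W j (Num.max s (Num.min t x)) w - component W j s w =
    component W j (Num.min x t) w - component W j (Num.min x s) w.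
  have [xs|sx] := leP x s.
    by rewrite (min_r (le_trans xs st)) (min_l (le_trans xs st)) max_l// !subrr.
  by rewrite max_r ?[Num.min t x]minC// le_min (ltW sx) st.
have -> : component W j (Num.min (sp_time Phi k.+1) t) w -
    component W j (Num.min (sp_time Phi k) t) w -
    (component W j (Num.min (sp_time Phi k.+1) s) w -
     component W j (Num.min (sp_time Phi k) s) w) =
    increment W j (clamp_time k) (clamp_time k.+1) w.
  have := phi (sp_time Phi k); have := phi (sp_time Phi k.+1).
  by rewrite /increment -/(clamp_time k) -/(clamp_time k.+1); lra.
rewrite /clamp_coef; case: ltP => // tk.
rewrite mul0r /increment /clamp_time (min_l tk) (min_l (le_trans tk _)) ?subrr ?mulr0//.
exact: sp_time_mono.
Qed.

Lemma clamp_value r w : s < r -> r <= t ->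
  \sum_(k < sp_size Phi) clamp_coef k w * (clamp_time k < r <= clamp_time k.+1)%R%:R =
  sp_value Phi r w.
Proof.
move=> sr rt; apply: eq_bigr => k _.
have lt_clamp x : (Num.max s (Num.min t x) < r) = (x < r).
  by rewrite gt_max sr/= gt_min ltNge rt.
have ge_clamp x : (r <= Num.max s (Num.min t x)) = (r <= x).
  by rewrite le_max (leNgt r s) sr/= le_min rt.
rewrite /clamp_time lt_clamp ge_clamp /clamp_coef; case: ltP => // tk.
by rewrite mul0r ltNge (le_trans rt tk) mulr0.
Qed.

End RestrictedSimple.

Section ItoIncrement.
Context (R : realType) (d : measure_display) (T : measurableType d)
  (P : probability T R) (n : nat) (W : R -> T -> 'cV[R]_n).
Hypothesis bm : standard_brownian_motion P W.
Variable j : 'I_n.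
Let F := augmented_filtration P W.

Lemma sp_integral0 (Phi : simple_process F) (B : R -> T -> R) w : sp_integral Phi B 0 w = 0.
Proof.
by apply: big1 => k _; rewrite !min_r ?sp_time_ge0// subrr mulr0.
Qed.

Lemma sp_value_jointly_measurable (Phi : simple_process F) :
  jointly_measurable (sp_value Phi).
Proof.
apply: jointly_measurable_sum => k; apply: jointly_measurableM.
  apply: jointly_measurable_event.
  exact: (measurable_wrt_fun bm (@sp_coef_measurable _ _ _ Phi k)).
apply: jointly_measurable_time; exact: measurable_time_itv.
Qed.

Lemma eq_energy (s t : R) (f g : R -> R) : (forall r, s <= r -> r <= t -> f r = g r) ->
  energy s t f = energy s t g.
Proof.
move=> fg; apply: eq_integral => r; rewrite inE/= in_itv/= => /andP[sr rt].
by rewrite fg.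
Qed.

(** Clamping to the interval may change the value of a simple process at the left end point, which
    is Lebesgue null. *)
Lemma eq_energy_ocitv (s t : R) (f g : R -> R) :
  measurable_fun [set: measurableTypeR R] f -> measurable_fun [set: measurableTypeR R] g ->
  (forall r, s < r -> r <= t -> f r = g r) ->
  energy s t f = energy s t g.
Proof.
move=> mf mg fg; rewrite /energy.
rewrite -!integral_itv_obnd_cbnd.
- apply: eq_integral => r; rewrite inE/= in_itv/= => /andP[sr rt].
  by rewrite fg.
- apply/measurable_EFinP/measurable_funTS; exact: measurable_funX.
- apply/measurable_EFinP/measurable_funTS; exact: measurable_funX.
Qed.

Lemma cvge0_near (u : nat -> \bar R) (e : R) : u @ \oo --> 0%E -> 0 < e ->
  \forall m \near \oo, (u m <= e%:E)%E.
Proof.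
move=> u0 e0.
have : nbhs (0%E : \bar R) [set x | (x < e%:E)%E].
  by apply: open_nbhs_nbhs; split; [exact: open_ereal_lt_ereal|rewrite /= lte_fin].
move=> /u0; rewrite /= => h; near=> m; apply/ltW; near: m; exact: h.
Unshelve. all: by end_near. Qed.

Lemma measurable_dist_set (f g : T -> R) (e : R) :
  measurable_fun setT f -> measurable_fun setT g ->
  measurable [set w | e <= `|f w - g w|].
Proof.
move=> mf mg; apply: measurable_ge_set; apply: measurableT_comp => //.
exact: measurable_funB.
Qed.

Lemma sp_integral_measurable (Phi : simple_process F) t : 0 <= t ->
  measurable_fun setT (sp_integral Phi (component W j) t).
Proof.
move=> t0; apply: measurable_sum => k.
apply: measurable_funM.
  exact: (measurable_wrt_fun bm (@sp_coef_measurable _ _ _ Phi k)).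
by apply: measurable_funB; apply: (bm_measurable bm); rewrite le_min t0 sp_time_ge0.
Qed.

Lemma le_P_setU3 (A A1 A2 A3 : set T) (a1 a2 a3 : \bar R) :
  measurable A -> measurable A1 -> measurable A2 -> measurable A3 ->
  A `<=` A1 `|` (A2 `|` A3) ->
  (P A1 <= a1 -> P A2 <= a2 -> P A3 <= a3 -> P A <= a1 + (a2 + a3))%E.
Proof.
move=> mA m1 m2 m3 sub p1 p2 p3.
have m23 := measurableU _ _ m2 m3.
apply: (@le_trans _ _ (P (A1 `|` (A2 `|` A3)))).
  by apply: le_measure; rewrite ?inE//; exact: measurableU.
apply: le_trans (measureU2 P m1 m23) _; apply: leeD => //.
by apply: le_trans (measureU2 P m2 m3) _; exact: leeD.
Qed.

Lemma le_P_setU2 (A A1 A2 : set T) (a1 a2 : \bar R) :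
  measurable A -> measurable A1 -> measurable A2 ->
  A `<=` A1 `|` A2 -> (P A1 <= a1 -> P A2 <= a2 -> P A <= a1 + a2)%E.
Proof.
move=> mA m1 m2 sub p1 p2.
apply: (@le_trans _ _ (P (A1 `|` A2))).
  by apply: le_measure; rewrite ?inE//; exact: measurableU.
by apply: le_trans (measureU2 P m1 m2) _; exact: leeD.
Qed.

(** Two simple processes close to the same integrand have close integrals: the difference is one
    step integral, and (x + y)^2 <= 2 x^2 + 2 y^2 turns two energies below del/4 into one below
    del. *)
Lemma sp_integral_diff_small (Phi Psi : simple_process F) s (e del : R) (H : R -> T -> R)
    (a b : \bar R) :
  0 <= s -> 0 < e -> 0 < del -> jointly_measurable H ->
  (P [set w | ((del / 4)%:E <= energy 0 s (fun r => sp_value Phi r w - H r w)%R)%E] <= a)%E ->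
  (P [set w | ((del / 4)%:E <= energy 0 s (fun r => sp_value Psi r w - H r w)%R)%E] <= b)%E ->
  (P [set w | (e <= `|sp_integral Phi (component W j) s w -
                      sp_integral Psi (component W j) s w|)%R] <=
    a + b + (del / e ^+ 2)%:E)%E.
Proof.
move=> s0 e0 del0 mH Pa Pb.
(* The disjoint union of the two index sets, with the coefficients of [Psi] negated, represents the
   difference as one family of items. *)
pose I := ('I_(sp_size Phi) + 'I_(sp_size Psi))%type.
pose ta (i : I) := match i with inl k => clamp_time Phi 0 s k | inr k => clamp_time Psi 0 s k end.
pose tb (i : I) := match i with inl k => clamp_time Phi 0 s k.+1 | inr k => clamp_time Psi 0 s k.+1 end.
pose xi (i : I) w := match i with inl k => clamp_coef Phi s k w | inr k => - clamp_coef Psi s k w end.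
have stp := @is_step_items _ _ _ P _ W j 0 s I ta tb xi s0.
have {}stp := stp (fun i => match i with inl k => clamp_time_itv Phi s0 k | inr k => clamp_time_itv Psi s0 k end).
have {}stp := stp _ _.
set A := (X in P X); set II := fun w => \sum_i _ in stp; set V := fun r w => \sum_i _ in stp.
have stp' : is_step P W j 0 s II V.
  apply: stp => -[k|k].
  - exact: clamp_coef_meas.
  - move=> B mB; rewrite /xi (_ : (fun w => - clamp_coef Psi s k w) =
      (fun w => 0 - clamp_coef Psi s k w)); last by apply/funext => w; rewrite sub0r.
    move: B mB; apply: measurable_wrtB; first exact: measurable_wrt_cst.
    exact: clamp_coef_meas.
  - exact: clamp_coef_bounded.
  - have [M hM] := clamp_coef_bounded Psi s k; exists M => w.
    by rewrite /= normrN.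
have IIE w : II w = sp_integral Phi (component W j) s w - sp_integral Psi (component W j) s w.
  rewrite /II big_sumType/= (clamp_integral j Phi s0).
  under [X in _ + X]eq_bigr do rewrite mulNr.
  by rewrite sumrN (clamp_integral j Psi s0) !sp_integral0 !subr0.
have VE r w : 0 < r -> r <= s -> V r w = sp_value Phi r w - sp_value Psi r w.
  move=> r0 rs; rewrite /V big_sumType/= (clamp_value Phi _ r0 rs).
  under [X in _ + X]eq_bigr do rewrite mulNr.
  by rewrite sumrN (clamp_value Psi _ r0 rs).
have mV := is_step_jointly_measurable bm stp'.
have mPhi := sp_value_jointly_measurable Phi.
have mPsi := sp_value_jointly_measurable Psi.
have -> : A = [set w | e <= `|II w|].
  by apply/seteqP; split => w; rewrite /A/= IIE.
apply: le_trans (small_energy bm (lexx 0) e0 (ltW del0) stp') _.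
rewrite leeD2r//.
apply: (@le_P_setU2 _ [set w | ((del / 4)%:E <= energy 0 s (fun r => sp_value Phi r w - H r w)%R)%E]
  [set w | ((del / 4)%:E <= energy 0 s (fun r => sp_value Psi r w - H r w)%R)%E]) => //.
- by apply: measurable_ge_eset; exact: energy_measurable.
- apply: measurable_ge_eset; apply: (energy_measurable _ _ (Y := fun r w => _ - _)).
  exact: jointly_measurableB.
- apply: measurable_ge_eset; apply: (energy_measurable _ _ (Y := fun r w => _ - _)).
  exact: jointly_measurableB.
- move=> w /= hw; apply: contrapT => /not_orP[/negP h1 /negP h2].
  rewrite -ltNge in h1; rewrite -ltNge in h2.
  move: hw; apply/negP; rewrite -ltNge.
  have mf := jointly_measurable_path w (jointly_measurableB mPhi mH).
  have mg := jointly_measurable_path w (jointly_measurableB mH mPsi).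
  rewrite (@eq_energy_ocitv 0 s _ (fun r => (sp_value Phi r w - H r w) + (H r w - sp_value Psi r w))).
  + apply: le_lt_trans (energy_add 0 s ltr01 mf mg) _.
    rewrite (@eq_energy 0 s (fun r => H r w - sp_value Psi r w)
       (fun r => - (sp_value Psi r w - H r w))); last by move=> r _ _; rewrite opprB.
    have -> : energy 0 s (fun r => - (sp_value Psi r w - H r w)) =
       energy 0 s (fun r => sp_value Psi r w - H r w).
      by apply: eq_integral => r _; rewrite sqrrN.
    rewrite invr1 (_ : del%:E = (1 + 1)%:E * (del / 4)%:E + (1 + 1)%:E * (del / 4)%:E)%E.
      by apply: lteD; rewrite lte_pmul2l.
    by rewrite -!EFinM -EFinD; congr EFin; field.
  + exact: jointly_measurable_path.
  + exact: measurable_funD.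
  + by move=> r r0 rs; rewrite (VE _ _ r0 rs) addrA subrK.
Qed.

End ItoIncrement.

Section ItoIncrementMain.
Context (R : realType) (d : measure_display) (T : measurableType d)
  (P : probability T R) (n : nat) (W : R -> T -> 'cV[R]_n).
Hypothesis bm : standard_brownian_motion P W.
Variable j : 'I_n.
Let F := augmented_filtration P W.

(** The sequences approximating [Js] and [Jt] are unrelated, so [Js] is first compared with the
    integral up to [s] of the sequence chosen for [t]. The increment minus its frozen part is then a
    limit of step integrals over the interval from [s] to [t], to which [ito_limit] applies. [Hc] is
    a version of [H] with good measurability and bounds on every path. *)
Lemma ito_increment (s t : R) (H Hc : R -> T -> R) (Js Jt zeta : T -> R) (K gam : R) :
  0 <= s -> s <= t ->
  is_ito_integral P F (component W j) H s Js ->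
  is_ito_integral P F (component W j) H t Jt ->
  jointly_measurable (fun r w => H (Num.max 0 r) w) -> jointly_measurable Hc ->
  {ae P, forall w, forall r, 0 <= r -> H r w = Hc r w} ->
  measurable_wrt (F s) zeta -> bounded_rv zeta ->
  (forall r w, s <= r -> r <= t -> `|Hc r w - zeta w| <= K) ->
  (\int[P]_w energy s t (fun r => Hc r w - zeta w)%R <= gam%:E)%E ->
  let D w := Jt w - Js w - zeta w * increment W j s t w in
  [/\ measurable_fun setT D, L1 P (fun w => D w ^+ 2),
      Ex P (fun w => D w ^+ 2) <= gam &
      forall xi, measurable_wrt (F s) xi -> bounded_rv xi ->
        Ex P (fun w => D w * xi w) = 0].
Proof.
move=> s0 st [mJs [Phis [Hs1 Hs2]]] [mJt [Phit [Ht1 Ht2]]] mH mHc HHc mz bz GK Gg D.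
have t0 := le_trans s0 st.
pose H0 r w := H (Num.max 0 r) w.
pose G r w := Hc r w - zeta w.
have mzf := measurable_wrt_fun bm mz.
have mG : jointly_measurable G.
  by apply: jointly_measurableB => //; exact: jointly_measurable_event.
have mD : measurable_fun setT D.
  apply: measurable_funB; first exact: measurable_funB.
  by apply: measurable_funM => //; exact: (increment_measurable bm).
suff [D2 ED Dxi] : [/\ L1 P (fun w => D w ^+ 2), Ex P (fun w => D w ^+ 2) <= gam &
    forall xi, measurable_wrt (F s) xi -> bounded_rv xi ->
      Ex P (fun w => D w * xi w) = 0] by [].
apply: (ito_limit bm (j := j) (G := G) (K := K) s0 st mD mG GK Gg).
move=> del del0.
(* Three errors below [e] add up to [del]. With dl / e^2 = del / 4 and four events of probability at
   most [eta], the total probability is at most 3 del / 4. *)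
pose e := del / 3.
have e0 : 0 < e by rewrite divr_gt0.
pose dl := e ^+ 2 * (del / 4).
have dl0 : 0 < dl by rewrite mulr_gt0 ?exprn_gt0// divr_gt0.
have dl4 : 0 < dl / 4 by rewrite divr_gt0.
pose eta := del / 8.
have eta0 : 0 < eta by rewrite divr_gt0.
have enE (u : R) (Phi : simple_process F) w : 0 <= u ->
    (\int[lebesgue_measure]_(r in `[0%R, u]) ((sp_value Phi r w - H r w) ^+ 2)%:E)%E =
    energy 0 u (fun r => sp_value Phi r w - H0 r w).
  move=> u0; rewrite -/(energy 0 u (fun r => sp_value Phi r w - H r w)).
  by apply: eq_energy => r r0 _; rewrite /H0 max_r.
have near_en (u : R) (Phi : nat -> simple_process F) (c : R) : 0 <= u -> 0 < c ->
    (forall e : R, 0 < e -> (fun m => P [set w |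
          (e%:E <= \int[lebesgue_measure]_(s in `[0%R, u])
                     ((sp_value (Phi m) s w - H s w) ^+ 2)%:E)%E]) @ \oo --> 0%E) ->
    \forall m \near \oo, (P [set w | (c%:E <= energy 0 u (fun r => sp_value (Phi m) r w - H0 r w)%R)%E]
       <= eta%:E)%E.
  move=> u0 c0 /(_ c c0) /cvge0_near /(_ eta0); apply: filterS => m.
  rewrite (_ : [set w | (_ <= energy _ _ _)%E] = [set w |
          (c%:E <= \int[lebesgue_measure]_(s in `[0%R, u])
                     ((sp_value (Phi m) s w - H s w) ^+ 2)%:E)%E]) //.
  by apply/seteqP; split => w /=; rewrite enE.
near \oo => m.
have pt1 : (P [set w | ((dl / 4)%:E <= energy 0 t (fun r => sp_value (Phit m) r w - H0 r w)%R)%E]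
       <= eta%:E)%E by near: m; exact: near_en.
have pt2 : (P [set w | (del%:E <= energy 0 t (fun r => sp_value (Phit m) r w - H0 r w)%R)%E]
       <= eta%:E)%E by near: m; exact: near_en.
have ps1 : (P [set w | ((dl / 4)%:E <= energy 0 s (fun r => sp_value (Phis m) r w - H0 r w)%R)%E]
       <= eta%:E)%E by near: m; exact: near_en.
have pt3 : (P [set w | (e <= `|sp_integral (Phit m) (component W j) t w - Jt w|)%R] <= eta%:E)%E.
  by near: m; exact: (cvge0_near (Ht2 e e0) eta0).
have ps3 : (P [set w | (e <= `|sp_integral (Phis m) (component W j) s w - Js w|)%R] <= eta%:E)%E.
  by near: m; exact: (cvge0_near (Hs2 e e0) eta0).
have mPt := sp_value_jointly_measurable bm (Phit m).
have mPs := sp_value_jointly_measurable bm (Phis m).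
have mPtH := jointly_measurableB mPt mH.
have pt1s : (P [set w | ((dl / 4)%:E <= energy 0 s (fun r => sp_value (Phit m) r w - H0 r w)%R)%E]
       <= eta%:E)%E.
  apply: le_trans pt1; apply: le_measure; rewrite ?inE.
  - by apply: measurable_ge_eset; exact: (energy_measurable _ _ mPtH).
  - by apply: measurable_ge_eset; exact: (energy_measurable _ _ mPtH).
  - move=> w /= h; apply: le_trans h _; apply: energy_subset => //.
    exact: (jointly_measurable_path w mPtH).
have pI := sp_integral_diff_small bm j s0 e0 dl0 mH pt1s ps1.
pose I := ('I_(sp_size (Phit m)) + 'I_1)%type.
pose ta (i : I) := if i is inl k then clamp_time (Phit m) s t k else s.
pose tb (i : I) := if i is inl k then clamp_time (Phit m) s t k.+1 else t.
pose xi (i : I) w := if i is inl k then clamp_coef (Phit m) t k w else - zeta w.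
pose II w := \sum_i xi i w * increment W j (ta i) (tb i) w.
pose V r w := \sum_i xi i w * (ta i < r <= tb i)%R%:R.
have stp : is_step P W j s t II V.
  apply: is_step_items => // -[k|k].
  - exact: clamp_time_itv.
  - by rewrite /= lexx.
  - exact: clamp_coef_meas.
  - have -> : xi (inr k) = (fun w => 0 - zeta w) by apply/funext => w; rewrite /xi sub0r.
    by apply: measurable_wrtB => //; exact: measurable_wrt_cst.
  - exact: clamp_coef_bounded.
  - have [M hM] := bz; exists M => w.
    by rewrite /= normrN.
have IIE w : II w = sp_integral (Phit m) (component W j) t w -
    sp_integral (Phit m) (component W j) s w - zeta w * increment W j s t w.
  rewrite /II big_sumType/= big_ord1/= mulNr.
  by congr (_ - _); exact: clamp_integral.
have VE r w : s < r -> r <= t -> V r w = sp_value (Phit m) r w - zeta w.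
  move=> sr rt; rewrite /V big_sumType/= big_ord1/= sr rt mulr1.
  by congr (_ - _); exact: clamp_value.
exists II, V; split => //.
- have mIt := sp_integral_measurable bm j (Phit m) t0.
  have mIts := sp_integral_measurable bm j (Phit m) s0.
  have mIs := sp_integral_measurable bm j (Phis m) s0.
  have mII := is_step_measurable bm s0 stp.
  apply: (@le_trans _ _ (eta%:E + ((eta%:E + eta%:E + (dl / e ^+ 2)%:E) + eta%:E))%E).
    apply: (le_P_setU3 _ _ _ _ _ pt3 pI ps3); try exact: measurable_dist_set.
    move=> w /= h; apply: contrapT => /not_orP[/negP h1 /not_orP[/negP h2 /negP h3]].
    rewrite -ltNge in h1; rewrite -ltNge in h2; rewrite -ltNge in h3.
    move: h; apply/negP; rewrite -ltNge IIE /D.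
    set x := sp_integral (Phit m) _ t w in h1 *.
    set y := sp_integral (Phit m) _ s w in h2 *.
    set z := sp_integral (Phis m) _ s w in h2 h3 *.
    have -> : x - y - zeta w * increment W j s t w -
      (Jt w - Js w - zeta w * increment W j s t w) = (x - Jt w) - (y - z) - (z - Js w) by ring.
    apply: le_lt_trans (ler_normB _ _) _.
    apply: le_lt_trans (_ : `|x - Jt w| + `|y - z| + `|z - Js w| < _).
      by rewrite lerD2r; exact: ler_normB.
    by move: h1 h2 h3; rewrite /e; lra.
  rewrite -!EFinD lee_fin /dl /eta.
  rewrite (_ : e ^+ 2 * (del / 4) / e ^+ 2 = del / 4); first lra.
  by rewrite mulrAC divff ?mul1r// expf_neq0// gt_eqF.
- have mVG := jointly_measurableB (is_step_jointly_measurable bm stp) mG.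
  have [N [mN PN HN]] := HHc.
  apply: (@le_trans _ _ (eta%:E + 0)%E); last first.
    by rewrite adde0 lee_fin /eta; lra.
  apply: (le_P_setU2 (A2 := N) _ _ mN _ pt2); last by rewrite PN.
  + by apply: measurable_ge_eset; exact: (energy_measurable _ _ mVG).
  + by apply: measurable_ge_eset; exact: (energy_measurable _ _ mPtH).
  move=> w /= h; have [Nw|nN] := pselect (N w); first by right.
  left; have HE r : 0 <= r -> H r w = Hc r w.
    by move=> r0; apply: contrapT => ne; apply: nN; apply: HN => /(_ r r0).
  apply: le_trans h _.
  have mPtHw := jointly_measurable_path w mPtH.
  rewrite (@eq_energy_ocitv _ s t _ (fun r => sp_value (Phit m) r w - H0 r w)) //.
  + exact: energy_subset.
  + exact: (jointly_measurable_path w mVG).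
  + move=> r sr rt; rewrite (VE _ _ sr rt) /G /H0 max_r ?(le_trans s0 (ltW sr))//.
    by rewrite HE ?(le_trans s0 (ltW sr))//; ring.
Unshelve. all: by end_near. Qed.

End ItoIncrementMain.

(** * Power-sum inequalities and short-time moments of a diffusion *)

Lemma sqr_sum_le (R : realFieldType) n (a : 'I_n -> R) :
  (\sum_i a i) ^+ 2 <= n%:R * \sum_i a i ^+ 2.
Proof.
pose S := \sum_i a i ^+ 2.
have e i : \sum_(j < n) ((a i ^+ 2 + a j ^+ 2) / 2) = (a i ^+ 2 *+ n + S) / 2.
  by rewrite -mulr_suml big_split/= sumr_const card_ord.
have -> : n%:R * \sum_i a i ^+ 2 = \sum_i \sum_(j < n) ((a i ^+ 2 + a j ^+ 2) / 2).
  rewrite (eq_bigr _ (fun i _ => e i)) -mulr_suml big_split/= sumrMnl.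
  by rewrite sumr_const card_ord -/S -mulr_natl; field.
rewrite expr2 mulr_suml; apply: ler_sum => i _; rewrite mulr_sumr.
apply: ler_sum => j _; have := sqr_ge0 (a i - a j).
by move: (a i) (a j) => x y; nra.
Qed.

Lemma pow4_sum_le (R : realFieldType) n (a : 'I_n -> R) :
  (\sum_i a i) ^+ 4 <= n%:R ^+ 3 * \sum_i a i ^+ 4.
Proof.
rewrite (_ : 4 = 2 * 2)%N// exprM.
apply: (@le_trans _ _ ((n%:R * \sum_i a i ^+ 2) ^+ 2)).
  rewrite lerXn2r ?nnegrE ?sqr_ge0 ?sqr_sum_le// mulr_ge0//.
  by apply: sumr_ge0 => i _; exact: sqr_ge0.
rewrite exprMn (_ : n%:R ^+ 3 = n%:R ^+ 2 * n%:R); last by rewrite -exprSr.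
rewrite -mulrA ler_wpM2l ?sqr_ge0//.
apply: le_trans (sqr_sum_le _) _.
by under eq_bigr do rewrite -exprM.
Qed.

Lemma young2 (R : realFieldType) (x y k : R) : 0 < k ->
  `|x * y| <= (k * x ^+ 2 + y ^+ 2 / k) / 2.
Proof.
move=> k0; rewrite normrM -(real_normK (num_real x)) -(real_normK (num_real y)).
move: `|x| `|y| => {x y} x y.
have -> : (k * x ^+ 2 + y ^+ 2 / k) / 2 = x * y + k / 2 * (x - y / k) ^+ 2.
  by field; rewrite gt_eqF.
by rewrite lerDl mulr_ge0 ?sqr_ge0// divr_ge0 ?ltW.
Qed.

Section Diffusion.
Context (R : realType) (d : measure_display) (T : measurableType d)
  (P : probability T R) (n : nat) (W : R -> T -> 'cV[R]_n).
Let F := augmented_filtration P W.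

(* The coefficients are only controlled on the simplex; the stochastic
   integrals enter through the two properties of [J] proved for Ito integrals. *)
Record regular_diffusion (b : 'I_n -> 'cV[R]_n -> R)
    (C : 'I_n -> 'I_n -> 'cV[R]_n -> R) (K : R) (Y : R -> T -> 'cV[R]_n) : Prop := {
  rd_simplex : forall r w, simplex (Y r w);
  rd_adapted : forall i s, 0 <= s -> measurable_wrt (F s) (component Y i s);
  rd_b_joint : forall i, jointly_measurable (fun r w => b i (Y r w));
  rd_b_adapted : forall i s, 0 <= s -> measurable_wrt (F s) (fun w => b i (Y s w));
  rd_C_joint : forall i j, jointly_measurable (fun r w => C i j (Y r w));
  rd_C_adapted : forall i j s, 0 <= s -> measurable_wrt (F s) (fun w => C i j (Y s w));
  rd_b_bound : forall i x, simplex x -> `|b i x| <= K;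
  rd_C_bound : forall i j x, simplex x -> `|C i j x| <= K;
  rd_b_lip : forall i x y, simplex x -> simplex y ->
    `|b i x - b i y| <= K * \sum_k `|x k 0 - y k 0|;
  rd_C_lip : forall i j x y, simplex x -> simplex y ->
    `|C i j x - C i j y| <= K * \sum_k `|x k 0 - y k 0|;
  rd_increment : forall s t i, 0 <= s -> s <= t -> exists J : 'I_n -> T -> R,
    (forall j zeta gam, measurable_wrt (F s) zeta -> bounded_rv zeta ->
      (\int[P]_w energy s t (fun r => C i j (Y r w) - zeta w)%R <= gam%:E)%E ->
      let D w := J j w - zeta w * increment W j s t w in
      [/\ measurable_fun setT D, L1 P (fun w => D w ^+ 2),
          Ex P (fun w => D w ^+ 2) <= gam &
          forall xi, measurable_wrt (F s) xi -> bounded_rv xi ->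
            Ex P (fun w => D w * xi w) = 0]) /\
    {ae P, forall w, Y t w i 0 - Y s w i 0 =
       \int[lebesgue_measure]_(r in `[s, t]) b i (Y r w) + \sum_j J j w}
}.

Hypothesis bm : standard_brownian_motion P W.
Variables (b : 'I_n -> 'cV[R]_n -> R) (C : 'I_n -> 'I_n -> 'cV[R]_n -> R)
  (K : R) (Y : R -> T -> 'cV[R]_n).
Hypothesis Yd : regular_diffusion b C K Y.
Hypothesis K_ge0 : 0 <= K.

Lemma simplex_diff_le1 (x y : 'cV[R]_n) i : simplex x -> simplex y ->
  `|x i 0 - y i 0| <= 1.
Proof.
move=> [hx _] [hy _]; have /andP[x0 x1] := hx i; have /andP[y0 y1] := hy i.
by rewrite ler_norml; lra.
Qed.

Let delta i s t w := Y t w i 0 - Y s w i 0.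

Let delta_le1 i s t w : `|delta i s t w| <= 1.
Proof. by apply: simplex_diff_le1; exact: (rd_simplex Yd). Qed.

Let delta_meas i s t : 0 <= s -> 0 <= t -> measurable_fun setT (delta i s t).
Proof.
move=> s0 t0; apply: measurable_funB; [exact: (measurable_wrt_fun bm (rd_adapted Yd i t0))|].
exact: (measurable_wrt_fun bm (rd_adapted Yd i s0)).
Qed.

Let delta_sqr_L1 i s t : 0 <= s -> 0 <= t -> L1 P (fun w => delta i s t w ^+ 2).
Proof.
move=> s0 t0; apply: (@L1_bounded _ _ _ P _ 1).
  by apply: measurable_funX; exact: delta_meas.
move=> w; rewrite ger0_norm ?sqr_ge0// -(real_normK (num_real (delta i s t w))).
by rewrite expr_le1// delta_le1.
Qed.

Let drift_bound i s t w : 0 <= s -> s <= t ->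
  `|\int[lebesgue_measure]_(r in `[s, t]) b i (Y r w)| <= K * (t - s).
Proof.
move=> s0 st.
have mb : measurable_fun [set: measurableTypeR R] (fun r => b i (Y r w)).
  exact: (jointly_measurable_path w (rd_b_joint Yd i)).
have fin : (lebesgue_measure (`[s, t]%classic : set R) < +oo)%E.
  by rewrite lebesgue_measure_itv/= lte_fin; case: ifP => _; rewrite -?EFinB ltry.
have ib : lebesgue_measure.-integrable `[s, t] (EFin \o (fun r => b i (Y r w))).
  apply: measurable_bounded_integrable => //; first exact: measurable_funTS.
  exists K; split; first exact: num_real.
  move=> x Kx r _ /=; apply: le_trans (ltW Kx); exact/(rd_b_bound Yd)/(rd_simplex Yd).
apply: le_trans (le_normr_Rintegral _ ib) _ => //.
rewrite -lee_fin -(integral_itv_cst K st) /Rintegral fineK.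
  apply: ge0_le_integral => //=.
  - by apply/measurable_EFinP; apply: measurableT_comp => //; exact: measurable_funTS.
  - by move=> r _; rewrite lee_fin; exact/(rd_b_bound Yd)/(rd_simplex Yd).
by apply: integrable_fin_num => //; exact: integrable_norm.
Qed.

(** Taking zeta = 0 in [rd_increment] bounds each stochastic integral by its own energy; the drift
    contributes (t - s)^2, absorbed by t - s <= 1. *)
Let incr_sqr_le i s t : 0 <= s -> s <= t -> t - s <= 1 ->
  Ex P (fun w => delta i s t w ^+ 2) <= (2 * K ^+ 2 + 2 * n%:R ^+ 2 * K ^+ 2) * (t - s).
Proof.
move=> s0 st h1; have t0 := le_trans s0 st.
have [J [JP Jae]] := rd_increment Yd i s0 st.
have JJ j : L1 P (fun w => J j w ^+ 2) /\ Ex P (fun w => J j w ^+ 2) <= K ^+ 2 * (t - s).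
  have [] := JP j (fun=> 0) (K ^+ 2 * (t - s)) (@measurable_wrt_cst _ _ _ 0).
  - by exists 0 => w; rewrite normr0.
  - apply: energy_expectation => // [|r sr rt].
      by apply: jointly_measurableB; [exact: (rd_C_joint Yd)|exact: jointly_measurable_event].
    have mC : measurable_fun setT (fun w => C i j (Y r w) - 0).
      apply: measurable_funB => //.
      exact: (measurable_wrt_fun bm (rd_C_adapted Yd i j (le_trans s0 sr))).
    have Cb w : `|(C i j (Y r w) - 0) ^+ 2| <= K ^+ 2.
      rewrite subr0 normrX lerXn2r ?nnegrE//.
      exact/(rd_C_bound Yd)/(rd_simplex Yd).
    have iC := L1_bounded P (measurable_funX 2 mC) Cb.
    split => //; rewrite -[leRHS](Ex_cst P); apply: Ex_le => //; first exact: L1_cst.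
    by move=> w; apply: le_trans (Cb w); exact: ler_norm.
  - move=> mD D2 ED _; have E : (fun w => (J j w - 0 * increment W j s t w) ^+ 2) = (fun w => J j w ^+ 2).
      by apply/funext => w; rewrite mul0r subr0.
    by rewrite E in D2 ED.
have i1 : L1 P (fun w => 2 * (K * (t - s)) ^+ 2 + 2 * n%:R * \sum_j J j w ^+ 2).
  by apply: L1D; [exact: L1_cst|apply: L1Z; apply: L1_sum => j; have [] := JJ j].
apply: (@le_trans _ _ (Ex P (fun w => 2 * (K * (t - s)) ^+ 2 + 2 * n%:R * \sum_j J j w ^+ 2))).
  apply: Ex_ae_le => //; first exact: delta_sqr_L1.
  apply: filterS Jae => w; rewrite /delta => ->.
  have := drift_bound i w s0 st; have /= := sqr_sum_le (fun j => J j w).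
  set A := \int[_]_(r in _) _; set S := \sum_j J j w; set Q := \sum_j J j w ^+ 2.
  move=> SQ AK.
  have A2 : A ^+ 2 <= (K * (t - s)) ^+ 2.
    by rewrite -(real_normK (num_real A)) lerXn2r ?nnegrE// mulr_ge0// subr_ge0.
  have := sqr_ge0 (A - S); rewrite -[2 * n%:R * Q]mulrA; move: A2 SQ.
  by move: ((K * (t - s)) ^+ 2) (n%:R * Q) => x y; nra.
rewrite ExD ?Ex_cst; first last.
- by apply: L1Z; apply: L1_sum => j; have [] := JJ j.
- exact: L1_cst.
rewrite ExZ; last by apply: L1_sum => j; have [] := JJ j.
rewrite Ex_sum; last by move=> j; have [] := JJ j.
have S : \sum_j Ex P (fun w => J j w ^+ 2) <= n%:R * (K ^+ 2 * (t - s)).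
  rewrite mulr_natl -[X in _ *+ X](card_ord n) -sumr_const.
  by apply: ler_sum => j _; have [] := JJ j.
rewrite [leRHS]mulrDl; apply: lerD.
  rewrite exprMn mulrA; apply: ler_wpM2l; first by rewrite mulr_ge0// sqr_ge0.
  by rewrite expr2 ler_piMl// subr_ge0.
have -> : 2 * n%:R ^+ 2 * K ^+ 2 * (t - s) = 2 * n%:R * (n%:R * (K ^+ 2 * (t - s))) by ring.
by apply: ler_wpM2l => //; rewrite mulr_ge0.
Qed.

Let K2 : R := 2 * K ^+ 2 + 2 * n%:R ^+ 2 * K ^+ 2.
Let K3 : R := K ^+ 2 * n%:R ^+ 2 * K2.

Let K2_ge0 : 0 <= K2.
Proof. by rewrite addr_ge0 ?mulr_ge0 ?sqr_ge0// exprn_ge0. Qed.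

Let K3_ge0 : 0 <= K3.
Proof. by rewrite !mulr_ge0 ?sqr_ge0. Qed.

(** Freezing a Lipschitz coefficient at time s leaves an error of second moment O(t - s), and
    integration in time yields another factor t - s. *)
Let lip_energy (f : 'cV[R]_n -> R) s t : 0 <= s -> s <= t -> t - s <= 1 ->
  jointly_measurable (fun r w => f (Y r w)) ->
  (forall x y, simplex x -> simplex y -> `|f x - f y| <= K * \sum_k `|x k 0 - y k 0|) ->
  (\int[P]_w energy s t (fun r => f (Y r w) - f (Y s w))%R <= (K3 * (t - s) ^+ 2)%:E)%E.
Proof.
move=> s0 st h1 mf lf.
have mfs := jointly_measurable_section s mf.
rewrite (_ : K3 * (t - s) ^+ 2 = (K3 * (t - s)) * (t - s)); last by rewrite expr2 mulrA.
apply: energy_expectation => // [|r sr rt].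
  by apply: jointly_measurableB => //; exact: jointly_measurable_event.
have r0 := le_trans s0 sr.
have mD : measurable_fun setT (fun w => f (Y r w) - f (Y s w)).
  by apply: measurable_funB => //; exact: jointly_measurable_section r mf.
have bd w : (f (Y r w) - f (Y s w)) ^+ 2 <= K ^+ 2 * n%:R * \sum_k delta k s r w ^+ 2.
  rewrite -(real_normK (num_real (f _ - _))).
  apply: (@le_trans _ _ ((K * \sum_k `|delta k s r w|) ^+ 2)).
    rewrite lerXn2r ?nnegrE ?mulr_ge0 ?sumr_ge0//.
    by apply: lf; exact: (rd_simplex Yd).
  rewrite exprMn -mulrA ler_wpM2l ?sqr_ge0//.
  apply: le_trans (sqr_sum_le _) _.
  by under eq_bigr do rewrite (real_normK (num_real _)).
have isum : L1 P (fun w => K ^+ 2 * n%:R * \sum_k delta k s r w ^+ 2).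
  by apply: L1Z; apply: L1_sum => k; exact: delta_sqr_L1.
have iD : L1 P (fun w => (f (Y r w) - f (Y s w)) ^+ 2).
  apply: (L1_le _ _ isum); first exact: measurable_funX.
  by move=> w; rewrite ger0_norm ?sqr_ge0.
split => //; apply: le_trans (Ex_le iD isum bd) _.
rewrite ExZ; last by apply: L1_sum => k; exact: delta_sqr_L1.
rewrite Ex_sum; last by move=> k; exact: delta_sqr_L1.
rewrite /K3 (_ : K ^+ 2 * n%:R ^+ 2 * K2 * (t - s) =
  K ^+ 2 * n%:R * (n%:R * (K2 * (t - s)))); last by ring.
apply: ler_wpM2l; first by rewrite mulr_ge0// sqr_ge0.
rewrite [leRHS]mulr_natl -[X in _ *+ X](card_ord n) -sumr_const.
apply: ler_sum => k _; apply: le_trans (incr_sqr_le _ s0 sr _) _.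
  by apply: le_trans h1; rewrite lerD2r.
by rewrite ler_wpM2l// lerD2r.
Qed.

(** The weight [eta] is tuned to t - s = eta^2: with mean energy of order eta^4, both terms are of
    order eta^3. *)
Let integral_young (g : R -> R) (M s t eta : R) : s <= t -> 0 < eta ->
  measurable_fun [set: measurableTypeR R] g -> (forall r, `|g r| <= M) ->
  `|\int[lebesgue_measure]_(r in `[s, t]) g r| <=
    (eta * (t - s) + fine (energy s t g) / eta) / 2.
Proof.
move=> st eta0 mg gM.
have fin : (lebesgue_measure (`[s, t]%classic : set R) < +oo)%E.
  by rewrite lebesgue_measure_itv/= lte_fin; case: ifP => _; rewrite -?EFinB ltry.
have bi (g' : R -> R) M' : measurable_fun [set: measurableTypeR R] g' -> (forall r, `|g' r| <= M') ->
    lebesgue_measure.-integrable `[s, t] (EFin \o g').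
  move=> mg' gM'; apply: measurable_bounded_integrable => //; first exact: measurable_funTS.
  exists M'; split; first exact: num_real.
  by move=> x Mx r _ /=; apply: le_trans (ltW Mx).
have ig := bi g M mg gM.
have ig2 : lebesgue_measure.-integrable `[s, t] (EFin \o (fun r => g r ^+ 2)).
  apply: (bi _ (M ^+ 2)); first exact: measurable_funX.
  move=> r; rewrite normrX lerXn2r ?nnegrE//.
  exact: le_trans (gM r).
have i1 : lebesgue_measure.-integrable `[s, t] (EFin \o (fun=> eta / 2)).
  by apply: (bi _ `|eta / 2|).
have i2 : lebesgue_measure.-integrable `[s, t] (EFin \o (fun r => (2 * eta)^-1 * g r ^+ 2)).
  exact: (integrableZl _ _ ig2).
apply: le_trans (le_normr_Rintegral _ ig) _ => //.
apply: (@le_trans _ _ (\int[lebesgue_measure]_(r in `[s, t]) (eta / 2 + (2 * eta)^-1 * g r ^+ 2))).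
  apply: le_Rintegral => //; first exact: integrable_norm.
    exact: (integrableD _ i1 i2).
  move=> r _; have := young2 1 (g r) eta0; rewrite mul1r expr1n mulr1.
  have -> : (eta + g r ^+ 2 / eta) / 2 = eta / 2 + (2 * eta)^-1 * g r ^+ 2.
    by field; rewrite gt_eqF.
  by [].
rewrite RintegralD// [X in _ + X]RintegralZl// /Rintegral (integral_itv_cst _ st)/= /energy.
rewrite le_eqVlt; apply/orP; left; apply/eqP.
by move: (fine _) => q; field; rewrite gt_eqF.
Qed.

(** The martingale part of an Euler step: its coefficients are frozen at time s, so the Gaussian
    moments of the increments apply directly. *)
Let U i s t w := \sum_j C i j (Y s w) * increment W j s t w.

Let C_bounded i j s : bounded_rv (fun w => C i j (Y s w)).
Proof. by exists K => w; exact/(rd_C_bound Yd)/(rd_simplex Yd). Qed.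

Let C_meas i j s : 0 <= s -> measurable_fun setT (fun w => C i j (Y s w)).
Proof. by move=> s0; exact: (measurable_wrt_fun bm (rd_C_adapted Yd i j s0)). Qed.

Let bounded_cst (c : R) : bounded_rv (fun _ : T => c).
Proof. by exists `|c|. Qed.

Let bounded_rvM (f g : T -> R) : bounded_rv f -> bounded_rv g ->
  bounded_rv (fun w => f w * g w).
Proof.
move=> [M fM] [M' gM]; exists (M * M') => w; rewrite normrM.
by apply: ler_pM.
Qed.

Let U_meas i s t : 0 <= s -> s <= t -> measurable_fun setT (U i s t).
Proof.
move=> s0 st; apply: measurable_sum => j; apply: measurable_funM; first exact: C_meas.
exact: (increment_measurable bm).
Qed.

Let U_mean i s t zeta : 0 <= s -> s <= t -> measurable_wrt (F s) zeta -> bounded_rv zeta ->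
  L1 P (fun w => zeta w * U i s t w) /\ Ex P (fun w => zeta w * U i s t w) = 0.
Proof.
move=> s0 st mz bz.
pose a j w := (zeta w * C i j (Y s w)) * increment W j s t w.
have aP j : L1 P (a j) /\ Ex P (a j) = 0.
  have mzC : measurable_wrt (F s) (fun w => zeta w * C i j (Y s w)).
    by apply: measurable_wrtM => //; exact: (rd_C_adapted Yd).
  apply: (increment_moment1 bm) => //.
  have [M hM] := bounded_rvM bz (C_bounded i j s).
  exact: L1_bounded (measurable_wrt_fun bm mzC) hM.
rewrite (_ : (fun _ => _) = (fun w => \sum_j a j w)); last first.
  by apply/funext => w; rewrite /U mulr_sumr; apply: eq_bigr => j _; rewrite mulrA.
split; first by apply: L1_sum => j; have [] := aP j.
rewrite Ex_sum; first by apply: big1 => j _; have [] := aP j.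
by move=> j; have [] := aP j.
Qed.

Let U_cov i k s t zeta : 0 <= s -> s <= t -> measurable_wrt (F s) zeta -> bounded_rv zeta ->
  L1 P (fun w => zeta w * U i s t w * U k s t w) /\
  Ex P (fun w => zeta w * U i s t w * U k s t w) =
    (t - s) * Ex P (fun w => zeta w * \sum_j C i j (Y s w) * C k j (Y s w)).
Proof.
move=> s0 st mz bz.
pose c j l w := zeta w * (C i j (Y s w) * C k l (Y s w)).
have mc j l : measurable_wrt (F s) (c j l).
  by apply: measurable_wrtM => //; apply: measurable_wrtM; exact: (rd_C_adapted Yd).
have ic j l : L1 P (c j l).
  have [M hM] := bounded_rvM bz (bounded_rvM (C_bounded i j s) (C_bounded k l s)).
  exact: L1_bounded (measurable_wrt_fun bm (mc j l)) hM.
pose a j l w := c j l w * increment W j s t w * increment W l s t w.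
have aP j l : L1 P (a j l) /\ Ex P (a j l) = (j == l)%:R * ((t - s) * Ex P (c j l)).
  have [->|jl] := eqVneq j l.
    have [i2 e2] := increment_moment2 bm l s0 st (mc l l) (ic l l).
    rewrite mul1r -e2.
    have -> : a l l = (fun w => c l l w * increment W l s t w ^+ 2).
      by apply/funext => w; rewrite /a expr2 mulrA.
    by [].
  by rewrite mul0r; exact: (increment_cross bm).
rewrite (_ : (fun _ => _) = (fun w => \sum_j \sum_l a j l w)); last first.
  apply/funext => w; rewrite /U [zeta w * _]mulr_sumr mulr_suml; apply: eq_bigr => j _.
  rewrite mulr_sumr; apply: eq_bigr => l _; rewrite /a /c; ring.
have i1 j : L1 P (fun w => \sum_l a j l w) by apply: L1_sum => l; have [] := aP j l.
split; first exact: L1_sum.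
rewrite Ex_sum//.
have -> : Ex P (fun w => zeta w * \sum_j C i j (Y s w) * C k j (Y s w)) =
    \sum_j Ex P (c j j).
  rewrite -Ex_sum//; congr Ex; apply/funext => w.
  by rewrite mulr_sumr.
rewrite mulr_sumr; apply: eq_bigr => j _.
rewrite Ex_sum; last by move=> l; have [] := aP j l.
rewrite (bigD1 j)//= big1 ?addr0; first by have [_ ->] := aP j j; rewrite eqxx mul1r.
by move=> l lj; have [_ ->] := aP j l; rewrite eq_sym (negbTE lj) mul0r.
Qed.

Let U_sqr i s t : 0 <= s -> s <= t ->
  L1 P (fun w => U i s t w ^+ 2) /\ Ex P (fun w => U i s t w ^+ 2) <= n%:R * K ^+ 2 * (t - s).
Proof.
move=> s0 st.
have [i1 e1] := @U_cov i i s t (fun=> 1) s0 st (@measurable_wrt_cst _ _ _ 1)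
  (bounded_cst 1).
have E : (fun w => 1 * U i s t w * U i s t w) = (fun w => U i s t w ^+ 2).
  by apply/funext => w; rewrite mul1r expr2.
rewrite E in i1 e1; split => //; rewrite e1 mulrC; apply: ler_wpM2r; first by rewrite subr_ge0.
rewrite -[leRHS](Ex_cst P); apply: Ex_le; [|exact: L1_cst|].
  have m1 : measurable_fun setT (fun w => 1 * \sum_j C i j (Y s w) * C i j (Y s w)).
    apply: measurable_funM => //; apply: measurable_sum => j.
    by apply: measurable_funM; exact: C_meas.
  apply: (L1_bounded (M := n%:R * K ^+ 2) P m1) => w; rewrite mul1r.
  apply: le_trans (ler_norm_sum _ _ _) _.
  rewrite mulr_natl -[X in _ *+ X](card_ord n) -sumr_const; apply: ler_sum => j _.
  by rewrite normrM expr2; apply: ler_pM => //; exact/(rd_C_bound Yd)/(rd_simplex Yd).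
move=> w; rewrite mul1r.
rewrite mulr_natl -[X in _ *+ X](card_ord n) -sumr_const; apply: ler_sum => j _.
apply: le_trans (ler_norm _) _.
by rewrite normrM expr2; apply: ler_pM => //; exact/(rd_C_bound Yd)/(rd_simplex Yd).
Qed.

Let K4 : R := n%:R ^+ 4 * K ^+ 4 * (48 * expR (1 / 2)).

Let U_pow4 i s t : 0 <= s -> s <= t ->
  L1 P (fun w => U i s t w ^+ 4) /\ Ex P (fun w => U i s t w ^+ 4) <= K4 * (t - s) ^+ 2.
Proof.
move=> s0 st.
pose a j w := K ^+ 4 * increment W j s t w ^+ 4.
have ia j : L1 P (a j) by apply: L1Z; have [] := increment_moment4 bm j s0 st.
have bd w : U i s t w ^+ 4 <= n%:R ^+ 3 * \sum_j a j w.
  apply: le_trans (pow4_sum_le _) _; apply: ler_wpM2l; first exact: exprn_ge0.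
  apply: ler_sum => j _; rewrite exprMn /a; apply: ler_wpM2r; first exact: exprn_even_ge0.
  apply: le_trans (ler_norm _) _; rewrite normrX lerXn2r ?nnegrE//.
  exact/(rd_C_bound Yd)/(rd_simplex Yd).
have i3 : L1 P (fun w => n%:R ^+ 3 * \sum_j a j w) by apply: L1Z; exact: L1_sum.
have i4 : L1 P (fun w => U i s t w ^+ 4).
  apply: (L1_le _ _ i3); first by apply: measurable_funX; exact: U_meas.
  by move=> w; rewrite ger0_norm ?exprn_even_ge0.
split => //; apply: le_trans (Ex_le i4 i3 bd) _.
rewrite ExZ ?Ex_sum//; last exact: L1_sum.
rewrite /K4 (_ : n%:R ^+ 4 * K ^+ 4 * (48 * expR (1 / 2)) * (t - s) ^+ 2 =
  n%:R ^+ 3 * (n%:R * (K ^+ 4 * (48 * expR (1 / 2) * (t - s) ^+ 2)))); last by ring.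
apply: ler_wpM2l; first exact: exprn_ge0.
rewrite [leRHS]mulr_natl -[X in _ *+ X](card_ord n) -sumr_const; apply: ler_sum => j _.
have [i' e'] := increment_moment4 bm j s0 st.
by rewrite ExZ//; apply: ler_wpM2l => //; exact: exprn_ge0.
Qed.

(** Here [r] is the error of freezing the drift and [e] that of freezing the diffusion coefficients.
    In mean square [e] is only of order eta^2, which is not enough for first moments; its
    orthogonality to the past removes it there altogether. *)
Let decomposition i s eta : 0 <= s -> 0 < eta -> eta <= 1 -> exists r e : T -> R,
  [/\ [/\ measurable_fun setT r, measurable_fun setT e &
        {ae P, forall w, delta i s (s + eta ^+ 2) w =
          eta ^+ 2 * b i (Y s w) + r w + U i s (s + eta ^+ 2) w + e w}],
      [/\ L1 P r, Ex P (fun w => `|r w|) <= (1 + K3) * eta ^+ 3,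
        L1 P (fun w => r w ^+ 2) &
        Ex P (fun w => r w ^+ 2) <= 4 * K ^+ 2 * eta ^+ 4],
      L1 P (fun w => e w ^+ 2) /\ Ex P (fun w => e w ^+ 2) <= n%:R ^+ 2 * K3 * eta ^+ 4 &
      forall xi, measurable_wrt (F s) xi -> bounded_rv xi -> Ex P (fun w => e w * xi w) = 0].
Proof.
move=> s0 eta0 eta1; set t := s + eta ^+ 2.
have h0 : 0 < eta ^+ 2 by rewrite exprn_gt0.
have ts : t - s = eta ^+ 2 by rewrite /t addrAC subrr add0r.
have st : s <= t by rewrite lerDl ltW.
have h1 : t - s <= 1 by rewrite ts expr_le1// ltW.
have t0 := le_trans s0 st.
have [J [JP Jae]] := rd_increment Yd i s0 st.
pose D j w := J j w - C i j (Y s w) * increment W j s t w.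
have DP j : [/\ measurable_fun setT (D j), L1 P (fun w => D j w ^+ 2),
    Ex P (fun w => D j w ^+ 2) <= K3 * (t - s) ^+ 2 &
    forall xi, measurable_wrt (F s) xi -> bounded_rv xi -> Ex P (fun w => D j w * xi w) = 0].
  apply: (JP j (fun w => C i j (Y s w))).
  - exact: (rd_C_adapted Yd).
  - exact: C_bounded.
  - apply: (lip_energy (f := C i j)) => //; first exact: (rd_C_joint Yd).
    exact: (rd_C_lip Yd).
have mb : measurable_fun setT (fun w => b i (Y s w)).
  exact: (measurable_wrt_fun bm (rd_b_adapted Yd i s0)).
pose e w := \sum_j D j w.
have me : measurable_fun setT e by apply: measurable_sum => j; have [] := DP j.
have mU := U_meas i s0 st.
pose r w := delta i s t w - eta ^+ 2 * b i (Y s w) - U i s t w - e w.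
have mr : measurable_fun setT r.
  apply: measurable_funB => //; apply: measurable_funB => //; apply: measurable_funB.
    exact: delta_meas.
  exact: measurable_funM.
pose g w q := b i (Y q w) - b i (Y s w).
have mbp w : measurable_fun [set: measurableTypeR R] (fun q => b i (Y q w)).
  exact: (jointly_measurable_path w (rd_b_joint Yd i)).
have mg w : measurable_fun [set: measurableTypeR R] (g w) by exact: measurable_funB.
have bb q w : `|b i (Y q w)| <= K by exact/(rd_b_bound Yd)/(rd_simplex Yd).
have gb w q : `|g w q| <= 2 * K.
  by apply: le_trans (ler_normB _ _) _; rewrite mulr_natl mulr2n lerD.
have fin : (lebesgue_measure (`[s, t]%classic : set R) < +oo)%E.
  by rewrite lebesgue_measure_itv/= lte_fin; case: ifP => _; rewrite -?EFinB ltry.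
have bi (g' : R -> R) M' : measurable_fun [set: measurableTypeR R] g' -> (forall r, `|g' r| <= M') ->
    lebesgue_measure.-integrable `[s, t] (EFin \o g').
  move=> mg' gM'; apply: measurable_bounded_integrable => //; first exact: measurable_funTS.
  exists M'; split; first exact: num_real.
  by move=> x Mx q _ /=; apply: le_trans (ltW Mx).
have rE w : delta i s t w = \int[lebesgue_measure]_(q in `[s, t]) b i (Y q w) + \sum_j J j w ->
    r w = \int[lebesgue_measure]_(q in `[s, t]) g w q.
  move=> dE; rewrite /g RintegralB//.
  - rewrite /r dE /e /U /D [X in _ = _ - X]/Rintegral (integral_itv_cst _ st)/= ts.
    by rewrite sumrB; ring.
  - exact: (bi _ K).
  - exact: (bi _ K).
have rb : {ae P, forall w, `|r w| <= (eta * (t - s) + fine (energy s t (g w)) / eta) / 2}.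
  by apply: filterS Jae => w dE; rewrite rE//; exact: (integral_young st eta0 (mg w) (gb w)).
have mgj : jointly_measurable (fun q w => g w q).
  apply: jointly_measurableB; first exact: (rd_b_joint Yd).
  exact: jointly_measurable_event.
have gen w : (energy s t (g w) <= ((2 * K) ^+ 2 * (t - s))%:E)%E.
  by apply: energy_bounded.
have gfin w : energy s t (g w) \is a fin_num.
  by rewrite ge0_fin_numE ?energy_ge0// (le_lt_trans (gen w)) ?ltry.
pose q w := fine (energy s t (g w)).
have qE w : (q w)%:E = energy s t (g w) by rewrite /q fineK.
have mq : measurable_fun setT q.
  apply/measurable_EFinP.
  rewrite (_ : _ \o _ = (fun w => energy s t (g w))); last first.
    by apply/funext => w /=; rewrite qE.
  exact: (energy_measurable _ _ mgj).
have iq : L1 P q.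
  apply: (L1_bounded (M := (2 * K) ^+ 2 * (t - s)) P mq) => w.
  by rewrite ger0_norm -lee_fin qE ?gen ?energy_ge0.
have Eq : Ex P q <= K3 * (t - s) ^+ 2.
  rewrite -lee_fin ExE//; under eq_integral do rewrite qE.
  apply: (lip_energy (f := b i)) => //; first exact: (rd_b_joint Yd).
  exact: (rd_b_lip Yd).
have rb2 : {ae P, forall w, `|r w| <= 2 * K * (t - s)}.
  apply: filterS Jae => w dE; rewrite rE// -lee_fin -(integral_itv_cst _ st).
  have ig := bi _ _ (mg w) (gb w).
  apply: (@le_trans _ _ (\int[lebesgue_measure]_(x in `[s, t]) `|g w x|)%:E).
    by rewrite lee_fin; exact: le_normr_Rintegral.
  rewrite /Rintegral fineK; last by apply: integrable_fin_num => //; exact: integrable_norm.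
  apply: ge0_le_integral => //=.
  - by apply/measurable_EFinP; apply: measurableT_comp => //; exact: measurable_funTS.
  - by move=> x _; rewrite lee_fin.
(* The bound on |r| holds only almost surely; integrability is transferred from this version, which
   is bounded everywhere. *)
pose rc w := Num.min `|r w| (2 * K * (t - s)).
have mrc : measurable_fun setT rc.
  by apply: measurable_minr => //; exact: measurableT_comp.
have c0 : 0 <= 2 * K * (t - s) by rewrite !mulr_ge0// subr_ge0.
have rc0 w : 0 <= rc w by rewrite le_min normr_ge0.
have rcb w : `|rc w| <= 2 * K * (t - s) by rewrite ger0_norm// ge_min lexx orbT.
have irc := L1_bounded P mrc rcb.
have rcE : {ae P, forall w, rc w = `|r w|}.
  by apply: filterS rb2 => w h; rewrite /rc min_l.
have mnr : measurable_fun setT (fun w => `|r w|) by exact: measurableT_comp.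
have inr : L1 P (fun w => `|r w|) by exact: (L1_ae_eq mnr irc rcE).
have ir : L1 P r by apply: (L1_le _ _ inr).
have mr2 : measurable_fun setT (fun w => r w ^+ 2) by exact: measurable_funX.
have rc2E : {ae P, forall w, rc w ^+ 2 = r w ^+ 2}.
  by apply: filterS rcE => w ->; rewrite (real_normK (num_real _)).
have mrc2 : measurable_fun setT (fun w => rc w ^+ 2) by exact: measurable_funX.
have rc2b w : `|rc w ^+ 2| <= (2 * K * (t - s)) ^+ 2.
  by rewrite normrX lerXn2r ?nnegrE.
have irc2 := L1_bounded P mrc2 rc2b.
have ir2 : L1 P (fun w => r w ^+ 2) by exact: (L1_ae_eq mr2 irc2 rc2E).
exists r, e; split.
- split => //; apply: aeW => w; rewrite /r; ring.
- split => //.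
    have iy : L1 P (fun w => eta * (t - s) / 2 + (2 * eta)^-1 * q w).
      by apply: L1D; [exact: L1_cst|exact: L1Z].
    apply: (@le_trans _ _ (Ex P (fun w => eta * (t - s) / 2 + (2 * eta)^-1 * q w))).
      apply: Ex_ae_le => //; apply: filterS rb => w /le_trans; apply.
      rewrite le_eqVlt; apply/orP; left; apply/eqP; rewrite -/(q w).
      by field; rewrite gt_eqF.
    rewrite ExD; [|exact: L1_cst|exact: L1Z].
    rewrite Ex_cst ExZ//.
    have h : (2 * eta)^-1 * Ex P q <= (2 * eta)^-1 * (K3 * (t - s) ^+ 2).
      by apply: ler_wpM2l => //; rewrite invr_ge0 mulr_ge0// ltW.
    have e1 : (2 * eta)^-1 * (K3 * (t - s) ^+ 2) = K3 * eta ^+ 3 / 2.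
      by rewrite ts; field; rewrite gt_eqF.
    have e2 : eta * (t - s) / 2 = eta ^+ 3 / 2 by rewrite ts -exprS.
    have e3 : 0 <= eta ^+ 3 by rewrite exprn_ge0// ltW.
    have e4 : 0 <= K3 * eta ^+ 3 by rewrite mulr_ge0.
    by rewrite e1 in h; rewrite e2; move: h; lra.
  rewrite -(Ex_ae_eq mrc2 mr2 rc2E); apply: (@le_trans _ _ (Ex P (fun=> (2 * K * (t - s)) ^+ 2))).
    apply: Ex_le => //; first exact: L1_cst.
    by move=> w; apply: le_trans (ler_norm _) (rc2b w).
  by rewrite Ex_cst ts le_eqVlt; apply/orP; left; apply/eqP; ring.
- have iD2 j : L1 P (fun w => D j w ^+ 2) by have [] := DP j.
  have iS : L1 P (fun w => n%:R * \sum_j D j w ^+ 2) by apply: L1Z; exact: L1_sum.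
  have e2 : L1 P (fun w => e w ^+ 2).
    apply: (L1_le _ _ iS); first exact: measurable_funX.
    by move=> w; rewrite ger0_norm ?sqr_ge0//; exact: sqr_sum_le.
  split => //; apply: le_trans (Ex_le e2 iS _) _; first by move=> w; exact: sqr_sum_le.
  rewrite ExZ ?Ex_sum//; last exact: L1_sum.
  rewrite (_ : n%:R ^+ 2 * K3 * eta ^+ 4 = n%:R * (n%:R * (K3 * (eta ^+ 2) ^+ 2))); last by ring.
  apply: ler_wpM2l => //; rewrite -ts [leRHS]mulr_natl -[X in _ *+ X](card_ord n) -sumr_const.
  by apply: ler_sum => j _; have [] := DP j.
- move=> xi mxi bxi; pose a j w := D j w * xi w.
  have ia j : L1 P (a j).
    have [mDj iDj _ _] := DP j; have [M hM] := bxi.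
    rewrite /a (_ : (fun _ => _) = (fun w => xi w * D j w)); last first.
      by apply/funext => w; rewrite mulrC.
    exact: (L1_boundedM (measurable_wrt_fun bm mxi) hM (L1_sqr mDj iDj)).
  rewrite (_ : (fun _ => _) = (fun w => \sum_j a j w)); last first.
    by apply/funext => w; rewrite /e mulr_suml.
  rewrite Ex_sum//; apply: big1 => j _; have [_ _ _ h] := DP j; exact: h.
Qed.

Let K5 : R := 3 * (K ^+ 2 + 4 * K ^+ 2 + n%:R ^+ 2 * K3).

Let K5_ge0 : 0 <= K5.
Proof.
have := sqr_ge0 K; have : 0 <= n%:R ^+ 2 * K3 by rewrite mulr_ge0// sqr_ge0.
by rewrite /K5; lra.
Qed.

Let err i s t w := delta i s t w - U i s t w.

Let err_meas i s t : 0 <= s -> s <= t -> measurable_fun setT (err i s t).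
Proof.
move=> s0 st; apply: measurable_funB; last exact: U_meas.
by apply: delta_meas => //; exact: le_trans st.
Qed.

Let err_sqr i s eta : 0 <= s -> 0 < eta -> eta <= 1 ->
  L1 P (fun w => err i s (s + eta ^+ 2) w ^+ 2) /\
  Ex P (fun w => err i s (s + eta ^+ 2) w ^+ 2) <= K5 * eta ^+ 4.
Proof.
move=> s0 eta0 eta1; set t := s + eta ^+ 2.
have st : s <= t by rewrite lerDl sqr_ge0.
have t0 := le_trans s0 st.
have [r [e [[mr me ae] [_ _ ir er] [ie ee] _]]] := decomposition i s0 eta0 eta1.
have iE : L1 P (fun w => err i s t w ^+ 2).
  apply: (L1_le (g := fun w => 2 * (delta i s t w ^+ 2 + U i s t w ^+ 2))).
  - by apply: measurable_funX; exact: err_meas.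
  - move=> w; rewrite ger0_norm ?sqr_ge0// /err.
    have := sqr_ge0 (delta i s t w + U i s t w).
    by move: (delta i s t w) (U i s t w) => x y; nra.
  - by apply: L1Z; apply: L1D; [exact: delta_sqr_L1|have [] := U_sqr i s0 st].
split => //.
have i1 : L1 P (fun w => 3 * K ^+ 2 * eta ^+ 4 + 3 * (r w ^+ 2 + e w ^+ 2)).
  by apply: L1D; [exact: L1_cst|apply: L1Z; exact: L1D].
apply: (@le_trans _ _ (Ex P (fun w => 3 * K ^+ 2 * eta ^+ 4 + 3 * (r w ^+ 2 + e w ^+ 2)))).
  apply: Ex_ae_le => //; apply: filterS ae => w; rewrite /err => ->.
  have := rd_b_bound Yd i (rd_simplex Yd s w).
  move: (b i (Y s w)) (r w) (e w) (U i s _ w) => x y z u xK.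
  have -> : eta ^+ 2 * x + y + u + z - u = eta ^+ 2 * x + y + z by ring.
  have x2 : (eta ^+ 2 * x) ^+ 2 <= K ^+ 2 * eta ^+ 4.
    rewrite exprMn mulrC (_ : (eta ^+ 2) ^+ 2 = eta ^+ 4); last by ring.
    rewrite ler_wpM2r ?exprn_even_ge0// -(real_normK (num_real x)).
    by rewrite lerXn2r ?nnegrE.
  move: x2; move: (eta ^+ 2 * x) (K ^+ 2) (eta ^+ 4) => X Q H XQ.
  have := sqr_ge0 (X - y); have := sqr_ge0 (X - z); have := sqr_ge0 (y - z).
  by rewrite -mulrA; move: XQ; move: (Q * H) => QH; nra.
rewrite ExD; [|exact: L1_cst|by apply: L1Z; exact: L1D].
rewrite Ex_cst ExZ; last exact: L1D.
rewrite ExD//.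
by rewrite /K5; move: er ee; lra.
Qed.

(** First moments: [U] and [e] drop out and [r] is O(eta^3) in mean. Second moments: the difference
    from the product of the Euler parts consists of terms with a factor [err], whose mean square is
    O(eta^4). Third moments interpolate between second and fourth ones. *)
Lemma moment_estimates : exists2 Q : R, 0 <= Q & forall s eta, 0 <= s -> 0 < eta -> eta <= 1 ->
  let d i w := Y (s + eta ^+ 2) w i 0 - Y s w i 0 in
  [/\ forall i zeta M, measurable_wrt (F s) zeta -> (forall w, `|zeta w| <= M) ->
        `|Ex P (fun w => zeta w * d i w) - eta ^+ 2 * Ex P (fun w => zeta w * b i (Y s w))|
          <= Q * M * eta ^+ 3,
      forall i k zeta M, measurable_wrt (F s) zeta -> (forall w, `|zeta w| <= M) ->
        `|Ex P (fun w => zeta w * d i w * d k w) -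
          eta ^+ 2 * Ex P (fun w => zeta w * \sum_j C i j (Y s w) * C k j (Y s w))|
          <= Q * M * eta ^+ 3 &
      forall i, Ex P (fun w => `|d i w| ^+ 3) <= Q * eta ^+ 3].
Proof.
have nK0 : 0 <= n%:R * K ^+ 2 by rewrite mulr_ge0// sqr_ge0.
have K40 : 0 <= K4.
  by rewrite !mulr_ge0 ?expR_ge0 ?exprn_ge0.
pose Q := (1 + K3) + (n%:R * K ^+ 2 + 2 * K5) + (K2 + K4 + 2 * K5).
have Q0 : 0 <= Q by rewrite /Q; move: nK0 K40 K2_ge0 K3_ge0 K5_ge0; lra.
exists Q => // s eta s0 eta0 eta1 /=; set t := s + eta ^+ 2.
have h0 : 0 < eta ^+ 2 by rewrite exprn_gt0.
have ts : t - s = eta ^+ 2 by rewrite /t addrAC subrr add0r.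
have st : s <= t by rewrite lerDl ltW.
have h1 : t - s <= 1 by rewrite ts expr_le1// ltW.
have t0 := le_trans s0 st.
have eta3 : 0 <= eta ^+ 3 by rewrite exprn_ge0// ltW.
have eta4 : eta ^+ 4 <= eta ^+ 3 by rewrite exprS ler_piMl.
have Qle (c M : R) : c <= Q -> 0 <= M -> M * (c * eta ^+ 3) <= Q * M * eta ^+ 3.
  move=> cQ M0; rewrite mulrA [M * c]mulrC; apply: ler_wpM2r => //.
  exact: ler_wpM2r.
have mdl i : measurable_fun setT (delta i s t) by exact: delta_meas.
have M_ge0 (zeta : T -> R) M : (forall w, `|zeta w| <= M) -> 0 <= M.
  by move=> zM; exact: le_trans (zM point).
split.
- move=> i zeta M mz zM.
  have M0 := M_ge0 _ _ zM.
  have mzf := measurable_wrt_fun bm mz.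
  have bz : bounded_rv zeta by exists M.
  have [r [e [[mr me ae] [ir er _ _] [ie ee] eorth]]] := decomposition i s0 eta0 eta1.
  have mb : measurable_fun setT (fun w => b i (Y s w)).
    exact: (measurable_wrt_fun bm (rd_b_adapted Yd i s0)).
  have ib : L1 P (fun w => zeta w * b i (Y s w)).
    apply: (L1_boundedM mzf zM); apply: (L1_bounded (M := K) P mb) => w.
    exact/(rd_b_bound Yd)/(rd_simplex Yd).
  have izr : L1 P (fun w => zeta w * r w) by exact: (L1_boundedM mzf zM).
  have ize : L1 P (fun w => zeta w * e w) by exact: (L1_boundedM mzf zM (L1_sqr me ie)).
  have [izU eU] := U_mean i s0 st mz bz.
  have i1 := L1Z (eta ^+ 2) ib; have i2 := L1D i1 izr; have i3 := L1D i2 izU.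
  have -> : Ex P (fun w => zeta w * (Y t w i 0 - Y s w i 0)) =
      Ex P (fun w => eta ^+ 2 * (zeta w * b i (Y s w)) + zeta w * r w + zeta w * U i s t w + zeta w * e w).
    apply: Ex_ae_eq.
    - by apply: measurable_funM => //; exact: mdl.
    - exact: L1_measurable (L1D i3 ize).
    - apply: filterS ae => w; rewrite -/(delta i s t w) => ->; ring.
  rewrite ExD// ExD// ExD// ExZ// eU.
  have -> : Ex P (fun w => zeta w * e w) = 0.
    by rewrite -(eorth _ mz bz); congr Ex; apply/funext => w; rewrite mulrC.
  rewrite !addr0 addrAC subrr add0r.
  apply: (@le_trans _ _ (Ex P (fun w => M * `|r w|))).
    apply: Ex_norm_le => // [|w]; first by apply: L1Z; exact: L1_norm.
    by rewrite normrM ler_wpM2r.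
  rewrite ExZ; last exact: L1_norm.
  apply: le_trans (ler_wpM2l M0 er) _; apply: Qle => //.
  by rewrite /Q; move: nK0 K40 K2_ge0 K5_ge0; lra.
- move=> i k zeta M mz zM.
  have M0 := M_ge0 _ _ zM.
  have mzf := measurable_wrt_fun bm mz.
  have bz : bounded_rv zeta by exists M.
  have [iUU] := U_cov i k s0 st mz bz; rewrite ts => <-.
  have [ei Eei] := err_sqr i s0 eta0 eta1; have [ek Eek] := err_sqr k s0 eta0 eta1.
  rewrite -/t in ei Eei ek Eek.
  have [Ui EUi] := U_sqr i s0 st; have [Uk EUk] := U_sqr k s0 st.
  have idd : L1 P (fun w => zeta w * (Y t w i 0 - Y s w i 0) * (Y t w k 0 - Y s w k 0)).
    apply: (@L1_bounded _ _ _ P _ M).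
      by apply: measurable_funM; [apply: measurable_funM => //; exact: mdl|exact: mdl].
    move=> w; rewrite !normrM; have di := delta_le1 i s t w; have dk := delta_le1 k s t w.
    apply: (@le_trans _ _ (M * 1 * 1)); last by rewrite !mulr1.
    by apply: ler_pM => //; apply: ler_pM.
  rewrite -ExB//.
  (* Young's inequality with weight [eta] balances the Euler part, of mean square O(eta^2), against
     [err], of mean square O(eta^4): both give eta^3. *)
  pose B w := M * ((eta / 2 * (U i s t w ^+ 2 + U k s t w ^+ 2)) +
    (2 * eta)^-1 * (err i s t w ^+ 2 + err k s t w ^+ 2) +
    2^-1 * (err i s t w ^+ 2 + err k s t w ^+ 2)).
  have iu := L1D Ui Uk; have iv := L1D ei ek.
  have iu' := L1Z (eta / 2) iu; have iv' := L1Z (2 * eta)^-1 iv; have iv'' := L1Z 2^-1 iv.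
  have iB : L1 P B by apply: L1Z; exact: (L1D (L1D iu' iv') iv'').
  apply: (@le_trans _ _ (Ex P B)).
    apply: Ex_norm_le => //; first exact: L1B.
    move=> w; rewrite -/(delta i s t w) -/(delta k s t w).
    have -> : zeta w * delta i s t w * delta k s t w - zeta w * U i s t w * U k s t w =
        zeta w * (U i s t w * err k s t w + U k s t w * err i s t w + err i s t w * err k s t w).
      by rewrite /err; ring.
    rewrite normrM /B; apply: ler_pM => //.
    have y1 := young2 (U i s t w) (err k s t w) eta0.
    have y2 := young2 (U k s t w) (err i s t w) eta0.
    have y3 := young2 (err i s t w) (err k s t w) ltr01.
    apply: le_trans (ler_normD _ _) _.
    apply: le_trans (_ : `|U i s t w * err k s t w| + `|U k s t w * err i s t w| +
      `|err i s t w * err k s t w| <= _); first by rewrite lerD2r; exact: ler_normD.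
    have e1 (x y : R) : (eta * x ^+ 2 + y ^+ 2 / eta) / 2 = eta / 2 * x ^+ 2 + (2 * eta)^-1 * y ^+ 2.
      by field; rewrite gt_eqF.
    rewrite e1 in y1; rewrite e1 in y2.
    by move: y1 y2 y3; rewrite invr1; lra.
  rewrite /B ExZ; last exact: (L1D (L1D iu' iv') iv'').
  rewrite ExD//; last exact: (L1D iu' iv').
  rewrite ExD// !ExZ// !ExD//.
  apply: le_trans (_ : M * ((n%:R * K ^+ 2 + 2 * K5) * eta ^+ 3) <= _); last first.
    by apply: Qle => //; rewrite /Q; move: K40 K2_ge0 K3_ge0 K5_ge0; lra.
  apply: ler_wpM2l => //.
  have a1 : eta / 2 * (Ex P (fun w => U i s t w ^+ 2) + Ex P (fun w => U k s t w ^+ 2)) <=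
      eta / 2 * (n%:R * K ^+ 2 * eta ^+ 2 + n%:R * K ^+ 2 * eta ^+ 2).
    by rewrite -ts; apply: ler_wpM2l; [rewrite divr_ge0// ltW|exact: lerD].
  have a2 : (2 * eta)^-1 * (Ex P (fun w => err i s t w ^+ 2) + Ex P (fun w => err k s t w ^+ 2)) <=
      (2 * eta)^-1 * (K5 * eta ^+ 4 + K5 * eta ^+ 4).
    by apply: ler_wpM2l; [rewrite invr_ge0 mulr_ge0// ltW|exact: lerD].
  have a3 : (2 * eta)^-1 * (K5 * eta ^+ 4 + K5 * eta ^+ 4) = K5 * eta ^+ 3.
    by field; rewrite gt_eqF.
  rewrite a3 in a2.
  have a4 : K5 * eta ^+ 4 <= K5 * eta ^+ 3 by exact: ler_wpM2l.
  have a5 : eta / 2 * (n%:R * K ^+ 2 * eta ^+ 2 + n%:R * K ^+ 2 * eta ^+ 2) = n%:R * K ^+ 2 * eta ^+ 3.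
    by field.
  rewrite a5 in a1.
  by move: a1 a2 a4 Eei Eek; lra.
- move=> i.
  have [ei Eei] := err_sqr i s0 eta0 eta1; rewrite -/t in ei Eei.
  have [U4 EU4] := U_pow4 i s0 st.
  have d2 := delta_sqr_L1 i s0 t0; have Ed2 := incr_sqr_le i s0 st h1.
  have i1 := L1Z eta d2; have i2 := L1Z eta^-1 U4; have i3 := L1Z 2 ei.
  have i12 := L1D i1 i2.
  have d3 : L1 P (fun w => `|delta i s t w| ^+ 3).
    apply: (@L1_bounded _ _ _ P _ 1).
      by apply: measurable_funX; apply: measurableT_comp => //; exact: mdl.
    by move=> w; rewrite ger0_norm ?exprn_ge0// expr_le1// delta_le1.
  (* One factor |delta| is kept and the other two are bounded by 2 (U^2 + err^2). Next to err^2 it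
     is bounded by 1; next to U^2 Young's inequality leads to eta delta^2 + U^4 / eta. *)
  apply: (@le_trans _ _ (Ex P (fun w => eta * delta i s t w ^+ 2 + eta^-1 * U i s t w ^+ 4 +
      2 * err i s t w ^+ 2))).
    apply: Ex_le => //; first exact: L1D.
    move=> w; have dl := delta_le1 i s t w.
    have y1 := young2 (delta i s t w) (U i s t w ^+ 2) eta0.
    have dE : delta i s t w = U i s t w + err i s t w by rewrite /err addrC subrK.
    have d2' : delta i s t w ^+ 2 <= 2 * (U i s t w ^+ 2 + err i s t w ^+ 2).
      rewrite dE; have := sqr_ge0 (U i s t w - err i s t w).
      by move: (U i s t w) (err i s t w) => x y; nra.
    have -> : `|Y t w i 0 - Y s w i 0| ^+ 3 = `|delta i s t w| * delta i s t w ^+ 2.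
      by rewrite -(real_normK (num_real (delta i s t w))) -exprS.
    apply: le_trans (ler_wpM2l (normr_ge0 _) d2') _.
    have p1 : `|delta i s t w| * err i s t w ^+ 2 <= err i s t w ^+ 2.
      by rewrite ler_piMl// sqr_ge0.
    have p2 : `|delta i s t w| * U i s t w ^+ 2 <= (eta * delta i s t w ^+ 2 + eta^-1 * U i s t w ^+ 4) / 2.
      have : `|delta i s t w| * U i s t w ^+ 2 = `|delta i s t w * U i s t w ^+ 2|.
        by rewrite normrM [X in _ = _ * X]ger0_norm// sqr_ge0.
      move=> ->; apply: le_trans y1 _; rewrite -exprM.
      by rewrite [in leRHS](mulrC eta^-1).
    have -> : `|delta i s t w| * (2 * (U i s t w ^+ 2 + err i s t w ^+ 2)) =
      2 * (`|delta i s t w| * U i s t w ^+ 2) + 2 * (`|delta i s t w| * err i s t w ^+ 2) by ring.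
    by move: p1 p2; lra.
  rewrite ExD// ExD// !ExZ//.
  have b1 : eta * Ex P (fun w => delta i s t w ^+ 2) <= K2 * eta ^+ 3.
    rewrite [leRHS](_ : _ = eta * (K2 * (t - s))); last by rewrite ts; ring.
    by apply: ler_wpM2l => //; exact: ltW.
  have b2 : eta^-1 * Ex P (fun w => U i s t w ^+ 4) <= K4 * eta ^+ 3.
    rewrite [leRHS](_ : _ = eta^-1 * (K4 * (t - s) ^+ 2)).
      by apply: ler_wpM2l => //; rewrite invr_ge0 ltW.
    by rewrite ts; field; rewrite gt_eqF.
  have b3 : K5 * eta ^+ 4 <= K5 * eta ^+ 3 by exact: ler_wpM2l.
  have b4 : (K2 + K4 + 2 * K5) * eta ^+ 3 <= Q * eta ^+ 3.
    by apply: ler_wpM2r => //; rewrite /Q; move: nK0 K3_ge0 K5_ge0; lra.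
  by apply: le_trans b4; move: b1 b2 b3 Eei; lra.
Qed.

End Diffusion.

Lemma cube_sum_le (R : realFieldType) n (a : 'I_n -> R) : (forall i, 0 <= a i) ->
  (\sum_i a i) ^+ 3 <= 2 * n%:R ^+ 2 * \sum_i a i ^+ 3.
Proof.
move=> a0; set S := \sum_i a i; have S0 : 0 <= S by exact: sumr_ge0.
rewrite exprS; apply: (@le_trans _ _ (S * (n%:R * \sum_i a i ^+ 2))).
  by rewrite ler_wpM2l// sqr_sum_le.
rewrite mulrCA (_ : 2 * n%:R ^+ 2 * \sum_i a i ^+ 3 = n%:R * (2 * n%:R * \sum_i a i ^+ 3)); last by ring.
apply: ler_wpM2l => //.
pose Q := \sum_i a i ^+ 3.
have e i : \sum_(j < n) (a i ^+ 3 + a j ^+ 3) = a i ^+ 3 *+ n + Q.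
  by rewrite big_split/= sumr_const card_ord.
have -> : 2 * n%:R * \sum_i a i ^+ 3 = \sum_i \sum_(j < n) (a i ^+ 3 + a j ^+ 3).
  rewrite (eq_bigr _ (fun i _ => e i)) big_split/= sumrMnl.
  by rewrite sumr_const card_ord -/Q -mulr_natl; ring.
rewrite /S mulr_suml; apply: ler_sum => i _; rewrite mulr_sumr.
apply: ler_sum => j _; have := a0 i; have := a0 j; move: (a i) (a j) => x y y0 x0.
have h : 0 <= (x - y) ^+ 2 * (x + y) by rewrite mulr_ge0 ?sqr_ge0// addr_ge0.
have h2 : 0 <= x ^+ 2 * y by rewrite mulr_ge0 ?sqr_ge0.
have h1 : 0 <= x ^+ 2 * y by rewrite mulr_ge0 ?sqr_ge0.
have -> : x ^+ 3 + y ^+ 3 = x * y ^+ 2 + (x ^+ 2 * y + (x - y) ^+ 2 * (x + y)) by ring.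
by rewrite lerDl addr_ge0.
Qed.

Lemma ln_ratio_bound (R : realType) (a b m : R) : 0 < m -> m <= a -> m <= b ->
  `|ln b - ln a| <= `|b - a| / m.
Proof.
move=> m0 ma mb.
have half (x y : R) : m <= x -> m <= y -> ln y - ln x <= `|y - x| / m.
  move=> mx my; have [x0 y0] := (lt_le_trans m0 mx, lt_le_trans m0 my).
  rewrite -ln_div ?posrE//.
  have -> : y / x = 1 + (y - x) / x by field; rewrite gt_eqF.
  apply: le_trans (le_ln1Dx _) _.
    rewrite ltr_pdivlMr// mulN1r; lra.
  apply: (@le_trans _ _ (`|y - x| / x)).
    by apply: ler_wpM2r; [rewrite invr_ge0 ltW|exact: ler_norm].
  by apply: ler_wpM2l => //; rewrite lef_pV2 ?posrE.
by rewrite ler_norml lerNl opprB half// andbT [`|b - a|]distrC half.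
Qed.

(** The expansion of the logarithm of 1 + z is obtained by inverting the Taylor formula of the
    exponential at [l]. [D] bounds [u] from above, so the constants do not depend on the size of the
    increment. *)
Lemma log_expansion (R : realType) (l u D : R) : 0 <= u -> u <= D -> `|l| <= u ->
  `|expR l - 1| <= u ->
  let z := expR l - 1 in
  `|z - l| <= u ^+ 2 * (1 / 2 + D * expR D) /\
  `|l - (z - z ^+ 2 / 2)| <= u ^+ 3 * (expR D + (1 / 2 + D * expR D)).
Proof.
move=> u0 uD lu zu z.
have D0 := le_trans u0 uD.
have t := exp_taylor2 l.
have rho : `|z - l - l ^+ 2 / 2| <= u ^+ 3 * expR D.
  apply: le_trans t _; apply: ler_pM => //; rewrite ?exprn_ge0 ?expR_ge0//.
    by rewrite lerXn2r ?nnegrE.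
  by rewrite ler_expR (le_trans lu).
have l2 : l ^+ 2 <= u ^+ 2 by rewrite -(real_normK (num_real l)) lerXn2r ?nnegrE.
have u3 : u ^+ 3 * expR D <= u ^+ 2 * (D * expR D).
  rewrite (_ : u ^+ 3 = u ^+ 2 * u); last by ring.
  by rewrite -mulrA ler_wpM2l ?sqr_ge0// ler_wpM2r ?expR_ge0.
have zl : `|z - l| <= u ^+ 2 * (1 / 2 + D * expR D).
  have -> : z - l = (z - l - l ^+ 2 / 2) + l ^+ 2 / 2 by ring.
  apply: le_trans (ler_normD _ _) _; rewrite [`|l ^+ 2 / 2|]ger0_norm ?divr_ge0 ?sqr_ge0//.
  by rewrite mulrDr; lra.
split => //.
have -> : l - (z - z ^+ 2 / 2) = - (z - l - l ^+ 2 / 2) + (z - l) * (z + l) / 2 by ring.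
apply: le_trans (ler_normD _ _) _; rewrite normrN [leRHS]mulrDr; apply: lerD => //.
rewrite normrM normrM (_ : `|2^-1| = 2^-1 :> R); last by rewrite ger0_norm.
have zl2 : `|z + l| <= 2 * u by apply: le_trans (ler_normD _ _) _; lra.
have : `|z - l| * `|z + l| <= u ^+ 2 * (1 / 2 + D * expR D) * (2 * u) by apply: ler_pM.
rewrite (_ : u ^+ 2 * _ * (2 * u) = 2 * (u ^+ 3 * (1 / 2 + D * expR D))); last by ring.
lra.
Qed.

(** * The regularised potential *)

Section Potential.
Context (R : realType) (n : nat).
Variables (theta : 'I_n -> R) (eps : R).
Hypotheses (eps_gt0 : 0 < eps) (eps_le1 : eps <= 1).

Definition potential (x : 'cV[R]_n) : R := expR (- \sum_i theta i * ln (x i 0 + eps)).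

Lemma potential_gt0 x : 0 < potential x.
Proof. exact: expR_gt0. Qed.

Let kap := \sum_i `|theta i|.
Let D := eps^-1.
Let kap0 : 0 <= kap. Proof. exact: sumr_ge0. Qed.
Let D0 : 0 < D. Proof. by rewrite invr_gt0. Qed.

Let pos (x : 'cV[R]_n) i : simplex x -> eps <= x i 0 + eps.
Proof. by move=> [h _]; have /andP[x0 _] := h i; rewrite lerDr. Qed.

Let theta_sum_le (a : 'I_n -> R) c : (forall i, `|a i| <= c) ->
  `|\sum_i theta i * a i| <= kap * c.
Proof.
move=> ac; apply: le_trans (ler_norm_sum _ _ _) _; rewrite /kap mulr_suml.
by apply: ler_sum => i _; rewrite normrM ler_wpM2l.
Qed.

Lemma potential_bounded : exists M, forall x, simplex x -> potential x <= M.
Proof.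
exists (expR (kap * (1 + D))) => x sx; rewrite ler_expR.
apply: le_trans (ler_norm _) _; rewrite normrN; apply: theta_sum_le => i.
have x0 := lt_le_trans eps_gt0 (pos i sx).
have x2 : x i 0 + eps <= 2.
  by have [h _] := sx; have /andP[_ h1] := h i; have := eps_le1; move: h1; lra.
have := @ln_ratio_bound R 1 (x i 0 + eps) eps eps_gt0 eps_le1 (pos i sx).
rewrite ln1 subr0 => /le_trans; apply.
rewrite (_ : 1 + D = (eps + 1) / eps); last by rewrite /D; field; rewrite gt_eqF.
apply: ler_wpM2r; first by rewrite invr_ge0 ltW.
by rewrite ler_norml; have := pos i sx; have := eps_gt0; move: x2; lra.
Qed.

(** The logarithm of the ratio of potentials is expanded through the relative increments [z], then
    exponentiated. An inequality in one direction suffices for a supermartingale. On the simplex x_i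
    + eps >= eps, which makes the remainder uniform. *)
Lemma potential_taylor : exists2 Q, 0 <= Q & forall (x y : 'cV[R]_n) (z : 'I_n -> R),
  simplex x -> simplex y -> (forall i, z i = (y i 0 - x i 0) / (x i 0 + eps)) ->
  potential y <= potential x * (1 - \sum_i theta i * z i + (\sum_i theta i * z i ^+ 2) / 2
     + (\sum_i theta i * z i) ^+ 2 / 2) + Q * (\sum_i `|y i 0 - x i 0|) ^+ 3.
Proof.
have [V hV] := potential_bounded.
pose A := kap * (n%:R * D).
pose c2 := 1 / 2 + (n%:R * D) * expR (n%:R * D).
pose c3 := expR (n%:R * D) + c2.
(* The three summands stem from the third-order error of the logarithms, from replacing a^2 by p^2,
   and from the cubic remainder of the exponential. *)
pose Q := `|V| * (kap * D ^+ 3 * c3 + kap * D ^+ 2 * c2 * (2 * kap * D) / 2 +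
   (kap * D) ^+ 3 * expR A).
have c20 : 0 <= c2 by rewrite addr_ge0// mulr_ge0 ?expR_ge0// mulr_ge0// ltW.
have c30 : 0 <= c3 by rewrite addr_ge0 ?expR_ge0.
have D0' := ltW D0.
exists Q; first by rewrite mulr_ge0// !addr_ge0// ?mulr_ge0// ?exprn_ge0 ?expR_ge0 ?mulr_ge0.
move=> x y z sx sy zdef.
pose l i := ln (y i 0 + eps) - ln (x i 0 + eps).
pose S := \sum_i `|y i 0 - x i 0|.
have S0 : 0 <= S by exact: sumr_ge0.
have dS i : `|y i 0 - x i 0| <= S by rewrite /S (bigD1 i)//= lerDl sumr_ge0.
have Sn : S <= n%:R.
  rewrite -[leRHS]mulr1 mulr_natl -[X in _ *+ X](card_ord n) -sumr_const.
  by apply: ler_sum => i _; exact: simplex_diff_le1.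
pose u := S * D.
have u0 : 0 <= u by rewrite mulr_ge0.
have uD : u <= n%:R * D by rewrite ler_wpM2r.
have xp i := lt_le_trans eps_gt0 (pos i sx).
have yp i := lt_le_trans eps_gt0 (pos i sy).
have lu i : `|l i| <= u.
  apply: le_trans (ln_ratio_bound eps_gt0 (pos i sx) (pos i sy)) _.
  rewrite /u ler_wpM2r//.
  by rewrite (_ : y i 0 + eps - (x i 0 + eps) = y i 0 - x i 0) //; ring.
have zE i : z i = expR (l i) - 1.
  rewrite zdef /l expRB !lnK ?posrE//; field; rewrite gt_eqF//.
have zu i : `|z i| <= u.
  rewrite zdef normrM normfV (gtr0_norm (xp i)); apply: ler_pM => //.
    by rewrite invr_ge0 ltW.
  by rewrite lef_pV2 ?posrE// pos.
have le i : `|z i - l i| <= u ^+ 2 * c2 /\ `|l i - (z i - z i ^+ 2 / 2)| <= u ^+ 3 * c3.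
  by rewrite zE; apply: log_expansion => //; rewrite -zE.
pose a := - \sum_i theta i * l i.
have -> : potential y = potential x * expR a.
  rewrite /potential -expRD; congr expR; rewrite /a -opprD -big_split/=; congr (- _).
  by apply: eq_bigr => i _; rewrite /l; ring.
pose p := - \sum_i theta i * z i.
pose a0 := - \sum_i theta i * (z i - z i ^+ 2 / 2).
have aa0 : `|a - a0| <= kap * (u ^+ 3 * c3).
  rewrite /a /a0 -opprD normrN -sumrN -big_split/=.
  rewrite (eq_bigr (fun i => theta i * (l i - (z i - z i ^+ 2 / 2)))); last first.
    by move=> i _; ring.
  by apply: theta_sum_le => i; have [] := le i.
have ap : `|a - p| <= kap * (u ^+ 2 * c2).
  rewrite /a /p -opprD normrN -sumrN -big_split/=.
  rewrite (eq_bigr (fun i => theta i * (l i - z i))); last by move=> i _; ring.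
  by apply: theta_sum_le => i; rewrite distrC; have [] := le i.
have ab : `|a| <= kap * u by rewrite normrN; exact: theta_sum_le.
have pb : `|p| <= kap * u by rewrite normrN; exact: theta_sum_le.
have a2p : a ^+ 2 - p ^+ 2 <= kap * (u ^+ 2 * c2) * (2 * kap * u).
  have -> : a ^+ 2 - p ^+ 2 = (a - p) * (a + p) by ring.
  apply: le_trans (ler_norm _) _; rewrite normrM; apply: ler_pM => //.
  by apply: le_trans (ler_normD _ _) _; lra.
have a3 : `|a| ^+ 3 * expR `|a| <= (kap * u) ^+ 3 * expR A.
  apply: ler_pM; rewrite ?exprn_ge0 ?expR_ge0//.
    by rewrite lerXn2r ?nnegrE ?mulr_ge0.
  by rewrite ler_expR (le_trans ab)// /A ler_wpM2l.
have ea : expR a <= 1 + a0 + p ^+ 2 / 2 + (kap * (u ^+ 3 * c3) +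
    kap * (u ^+ 2 * c2) * (2 * kap * u) / 2 + (kap * u) ^+ 3 * expR A).
  have := exp_taylor2 a; rewrite ler_norml => /andP[_ t].
  move: aa0; rewrite ler_norml => /andP[_ t'].
  by move: a3 a2p; lra.
have a0E : a0 = - (\sum_i theta i * z i) + (\sum_i theta i * z i ^+ 2) / 2.
  rewrite /a0 mulr_suml -!sumrN -big_split/=; apply: eq_bigr => i _; ring.
have V0 : potential x <= `|V| by apply: le_trans (hV x sx) _; exact: ler_norm.
apply: (@le_trans _ _ (potential x * (1 + a0 + p ^+ 2 / 2 + (kap * (u ^+ 3 * c3) +
    kap * (u ^+ 2 * c2) * (2 * kap * u) / 2 + (kap * u) ^+ 3 * expR A)))).
  by apply: ler_wpM2l => //; exact: ltW (potential_gt0 x).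
rewrite mulrDr; apply: lerD.
  rewrite le_eqVlt; apply/orP; left; apply/eqP; congr (_ * _).
  by rewrite a0E /p sqrrN; ring.
have -> : kap * (u ^+ 3 * c3) + kap * (u ^+ 2 * c2) * (2 * kap * u) / 2 + (kap * u) ^+ 3 * expR A =
   (kap * D ^+ 3 * c3 + kap * D ^+ 2 * c2 * (2 * kap * D) / 2 +
   (kap * D) ^+ 3 * expR A) * S ^+ 3.
  by rewrite /u; field.
rewrite /Q -[leRHS]mulrA; apply: ler_wpM2r => //.
rewrite mulr_ge0// ?exprn_ge0// !addr_ge0// ?mulr_ge0// ?exprn_ge0 ?expR_ge0 ?mulr_ge0//.
Qed.

End Potential.

(** * One-step estimate for the potential *)

Section OneStep.
Context (R : realType) (d : measure_display) (T : measurableType d)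
  (P : probability T R) (n : nat) (W : R -> T -> 'cV[R]_n).
Hypothesis bm : standard_brownian_motion P W.
Variables (b : 'I_n -> 'cV[R]_n -> R) (C : 'I_n -> 'I_n -> 'cV[R]_n -> R)
  (K : R) (Y : R -> T -> 'cV[R]_n).
Hypothesis Yd : regular_diffusion P W b C K Y.
Hypothesis K_ge0 : 0 <= K.
Variables (theta : 'I_n -> R) (eps : R).
Hypotheses (eps_gt0 : 0 < eps) (eps_le1 : eps <= 1).
Let F := augmented_filtration P W.
Let v := potential theta eps.

Definition covariation i k (x : 'cV[R]_n) := \sum_j C i j x * C k j x.

(* The generator applied to the potential, divided by the potential. *)
Definition log_generator (x : 'cV[R]_n) : R :=
  - (\sum_i theta i * (x i 0 + eps)^-1 * b i x)
  + (\sum_i theta i * (x i 0 + eps)^-1 ^+ 2 * covariation i i x) / 2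
  + (\sum_i \sum_k theta i * theta k * (x i 0 + eps)^-1 * (x k 0 + eps)^-1
       * covariation i k x) / 2.

Let wt i (x : 'cV[R]_n) : R := (x i 0 + eps)^-1.

Let den_gt0 r w i : 0 < Y r w i 0 + eps.
Proof.
have [h _] := rd_simplex Yd r w; have /andP[x0 _] := h i.
by rewrite ltr_wpDl.
Qed.

Let wt_bound r w i : `|wt i (Y r w)| <= eps^-1.
Proof.
rewrite /wt normfV (gtr0_norm (den_gt0 r w i)) lef_pV2 ?posrE//.
by have [h _] := rd_simplex Yd r w; have /andP[x0 _] := h i; rewrite lerDr.
Qed.

Let wt_meas i s : 0 <= s -> measurable_wrt (F s) (fun w => wt i (Y s w)).
Proof.
(* The inverse is written as exp(- ln) so that measurability follows from that of the exponential
   and the logarithm. *)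
move=> s0; rewrite (_ : (fun w => wt i (Y s w)) = (fun w => expR (- ln (Y s w i 0 + eps)))).
  apply: (measurable_wrt_comp (f := fun u => expR (- ln (u + eps)))).
    apply: measurableT_comp => //; apply: measurableT_comp => //.
    by apply: measurableT_comp => //; exact: measurable_funD.
  exact: (rd_adapted Yd).
by apply/funext => w; rewrite expRN lnK ?posrE.
Qed.

Lemma potential_adapted s : 0 <= s -> measurable_wrt (F s) (fun w => v (Y s w)).
Proof.
move=> s0; apply: (measurable_wrt_comp (f := fun u => expR (- u))).
  by apply: measurableT_comp.
apply: measurable_wrt_sum => i; apply: measurable_wrtM; first exact: measurable_wrt_cst.
apply: (measurable_wrt_comp (f := fun u => ln (u + eps))).
  by apply: measurableT_comp => //; exact: measurable_funD.
exact: (rd_adapted Yd).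
Qed.

Lemma potential_event_L1 s (G : set T) : 0 <= s -> F s G ->
  L1 P (fun w => v (Y s w) * \1_G w).
Proof.
move=> s0 FG.
have [V hV] := potential_bounded theta eps_gt0 eps_le1.
have m : measurable_wrt (F s) (fun w => v (Y s w) * \1_G w).
  by apply: measurable_wrtM; [exact: potential_adapted|exact: measurable_wrt_indic].
apply: (L1_bounded (M := V) P (measurable_wrt_fun bm m)) => w.
rewrite normrM (gtr0_norm (potential_gt0 _ _ _)) indicE.
have := hV _ (rd_simplex Yd s w); rewrite -/v => vV.
case: (_ \in _); first by rewrite normr1 mulr1.
by rewrite normr0 mulr0 (le_trans _ vV)// ltW// potential_gt0.
Qed.

Lemma covariation_bound i k x : simplex x -> `|covariation i k x| <= n%:R * K ^+ 2.
Proof.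
move=> sx; apply: le_trans (ler_norm_sum _ _ _) _.
rewrite mulr_natl -[X in _ *+ X](card_ord n) -sumr_const; apply: ler_sum => j _.
by rewrite normrM expr2; apply: ler_pM => //; exact: (rd_C_bound Yd).
Qed.

(** The Taylor inequality is multiplied by the indicator of [G]. Every factor other than the
    increments is then bounded and known at time s, so the moment estimates may be applied term by
    term, and the main terms reassemble into the generator. *)
Lemma one_step : exists2 Q : R, 0 <= Q & forall s eta (G : set T),
  0 <= s -> 0 < eta -> eta <= 1 -> F s G ->
  Ex P (fun w => v (Y (s + eta ^+ 2) w) * \1_G w) <=
  Ex P (fun w => v (Y s w) * \1_G w) +
  eta ^+ 2 * Ex P (fun w => v (Y s w) * log_generator (Y s w) * \1_G w) + Q * eta ^+ 3.
Proof.
have [V hV] := potential_bounded theta eps_gt0 eps_le1.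
have [Qt Qt0 taylor] := potential_taylor theta eps_gt0 eps_le1.
have [Q Q0 mom] := moment_estimates bm Yd K_ge0.
pose kap := \sum_i `|theta i|.
have kap0 : 0 <= kap by exact: sumr_ge0.
have thk i : `|theta i| <= kap by rewrite /kap (bigD1 i)//= lerDl sumr_ge0.
pose D := eps^-1.
have D0 : 0 <= D by rewrite invr_ge0 ltW.
pose B1 := kap * `|V| * D; pose B2 := kap * `|V| * (D * D) / 2.
pose B3 := kap * kap * `|V| * (D * D) / 2.
have B10 : 0 <= B1 by rewrite !mulr_ge0.
have B20 : 0 <= B2 by rewrite divr_ge0// !mulr_ge0.
have B30 : 0 <= B3 by rewrite divr_ge0// !mulr_ge0.
pose Qf := n%:R * (Q * B1) + n%:R * (Q * B2) + n%:R * (n%:R * (Q * B3)) +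
  Qt * (2 * n%:R ^+ 2 * (n%:R * Q)).
exists Qf.
  by rewrite !addr_ge0// !mulr_ge0.
move=> s eta G s0 eta0 eta1 FG; set t := s + eta ^+ 2.
have h0 : 0 < eta ^+ 2 by rewrite exprn_gt0.
have st : s <= t by rewrite lerDl ltW.
have t0 := le_trans s0 st.
have [mom1 mom2 mom3] := mom s eta s0 eta0 eta1; rewrite -/t in mom1 mom2 mom3.
pose dl i w := Y t w i 0 - Y s w i 0.
pose xi w := v (Y s w) * \1_G w.
have mxi : measurable_wrt (F s) xi.
  by apply: measurable_wrtM; [exact: potential_adapted|exact: measurable_wrt_indic].
have xiV w : `|xi w| <= `|V|.
  rewrite normrM (gtr0_norm (potential_gt0 _ _ _)) indicE.
  have := hV _ (rd_simplex Yd s w); rewrite -/v => vV.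
  case: (_ \in _); last by rewrite normr0 mulr0.
  by rewrite normr1 mulr1 (le_trans vV)// ler_norm.
have xi0 w : 0 <= xi w.
  by rewrite mulr_ge0// ?ltW ?potential_gt0.
have ixi : L1 P xi by exact: (L1_bounded P (measurable_wrt_fun bm mxi) xiV).
(* These weights multiply one or two coordinate increments in the expansion; they include the
   potential and the indicator of [G], which makes them adapted and bounded. *)
pose y1 i w := theta i * xi w * wt i (Y s w).
pose y2 i w := theta i * xi w * (wt i (Y s w) * wt i (Y s w)) / 2.
pose y3 i k w := theta i * theta k * xi w * (wt i (Y s w) * wt k (Y s w)) / 2.
have mth (c : R) : measurable_wrt (F s) (fun=> c) by exact: measurable_wrt_cst.
have my1 i : measurable_wrt (F s) (y1 i).
  by apply: measurable_wrtM; [exact: measurable_wrtM|exact: wt_meas].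
have my2 i : measurable_wrt (F s) (y2 i).
  apply: measurable_wrtM => //; apply: measurable_wrtM; first exact: measurable_wrtM.
  by apply: measurable_wrtM; exact: wt_meas.
have my3 i k : measurable_wrt (F s) (y3 i k).
  apply: measurable_wrtM => //; apply: measurable_wrtM; first exact: measurable_wrtM.
  by apply: measurable_wrtM; exact: wt_meas.
have wtD i w : `|wt i (Y s w)| <= D by exact: wt_bound.
have le2 (x y X' Y' : R) : `|x| <= X' -> `|y| <= Y' -> `|x * y| <= X' * Y'.
  by move=> xX yY; rewrite normrM; apply: ler_pM.
have b1 i w : `|y1 i w| <= B1 by do 2 (apply: (le2) => //).
have le_half (x X' : R) : `|x| <= X' -> `|x / 2| <= X' / 2.
  by move=> xX; apply: (le2) => //; rewrite ger0_norm.
have b2 i w : `|y2 i w| <= B2.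
  by apply: le_half; apply: (le2); apply: (le2).
have b3 i k w : `|y3 i k w| <= B3.
  by apply: le_half; apply: (le2); apply: (le2) => //; apply: (le2).
have mdl i : measurable_fun setT (dl i).
  apply: measurable_funB; first exact: (measurable_wrt_fun bm (rd_adapted Yd i t0)).
  exact: (measurable_wrt_fun bm (rd_adapted Yd i s0)).
have dl1 i w : `|dl i w| <= 1 by apply: simplex_diff_le1; exact: (rd_simplex Yd).
have bL1 (f g : T -> R) B : measurable_wrt (F s) f -> (forall w, `|f w| <= B) ->
    measurable_fun setT g -> (forall w, `|g w| <= 1) -> L1 P (fun w => f w * g w).
  move=> mf fB mg g1; apply: (L1_boundedM (measurable_wrt_fun bm mf) fB).
  exact: (L1_bounded P mg g1).
have i1 i : L1 P (fun w => y1 i w * dl i w) by exact: (bL1 _ _ _ (my1 i) (b1 i)).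
have mdd i k : measurable_fun setT (fun w => dl i w * dl k w) by exact: measurable_funM.
have dd1 i k w : `|dl i w * dl k w| <= 1.
  by rewrite normrM mulr_ile1.
have i2 i : L1 P (fun w => y2 i w * dl i w * dl i w).
  under eq_fun do rewrite -mulrA.
  exact: (bL1 _ _ _ (my2 i) (b2 i)).
have i3 i k : L1 P (fun w => y3 i k w * dl i w * dl k w).
  under eq_fun do rewrite -mulrA.
  exact: (bL1 _ _ _ (my3 i k) (b3 i k)).
have i4 i : L1 P (fun w => `|dl i w| ^+ 3).
  apply: (@L1_bounded _ _ _ P _ 1).
    by apply: measurable_funX; apply: measurableT_comp.
  by move=> w; rewrite ger0_norm ?exprn_ge0// expr_le1.
pose S1 w := \sum_i y1 i w * dl i w.
pose S2 w := \sum_i y2 i w * dl i w * dl i w.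
pose S3 w := \sum_i \sum_k y3 i k w * dl i w * dl k w.
pose S4 w := Qt * (2 * n%:R ^+ 2 * \sum_i `|dl i w| ^+ 3).
have iS1 : L1 P S1 by exact: L1_sum.
have iS2 : L1 P S2 by exact: L1_sum.
have iS3' i : L1 P (fun w => \sum_k y3 i k w * dl i w * dl k w) by exact: L1_sum.
have iS3 : L1 P S3 by exact: L1_sum.
have iS4' : L1 P (fun w => \sum_i `|dl i w| ^+ 3) by exact: L1_sum.
have iS4 : L1 P S4 by do 2 apply: L1Z.
have j1 := L1B ixi iS1; have j2 := L1D j1 iS2; have j3 := L1D j2 iS3; have j4 := L1D j3 iS4.
apply: (@le_trans _ _ (Ex P (fun w => xi w - S1 w + S2 w + S3 w + S4 w))).
  apply: Ex_le => //; first exact: potential_event_L1 (filtration_mono st FG).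
  move=> w; rewrite /xi /S1 /S2 /S3 /S4.
  have := taylor (Y s w) (Y t w) (fun i => dl i w * wt i (Y s w))
    (rd_simplex Yd s w) (rd_simplex Yd t w) (fun i => erefl).
  rewrite -/v /= => tay.
  have cube := cube_sum_le (fun i => normr_ge0 (dl i w)).
  have tay2 : v (Y t w) <= v (Y s w) * (1 - \sum_i theta i * (dl i w * wt i (Y s w)) +
    (\sum_i theta i * (dl i w * wt i (Y s w)) ^+ 2) / 2 +
    (\sum_i theta i * (dl i w * wt i (Y s w))) ^+ 2 / 2) + Qt * (2 * n%:R ^+ 2 * \sum_i `|dl i w| ^+ 3).
    by apply: le_trans tay _; rewrite lerD2l; apply: ler_wpM2l.
  have q40 : 0 <= Qt * (2 * n%:R ^+ 2 * \sum_i `|dl i w| ^+ 3).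
    by rewrite !mulr_ge0// sumr_ge0// => i _; exact: exprn_ge0.
  rewrite -/(xi w); have [Gw|Gw] := boolP (w \in G); last first.
    have x0 : xi w = 0 by rewrite /xi indicE (negbTE Gw) mulr0.
    have s1 : \sum_i y1 i w * dl i w = 0.
      by apply: big1 => i _; rewrite /y1 x0 mulr0 !mul0r.
    have s2 : \sum_i y2 i w * dl i w * dl i w = 0.
      by apply: big1 => i _; rewrite /y2 x0 mulr0 !mul0r.
    have s3 : \sum_i \sum_k y3 i k w * dl i w * dl k w = 0.
      by apply: big1 => i _; apply: big1 => k _; rewrite /y3 x0 mulr0 !mul0r.
    by rewrite indicE (negbTE Gw) mulr0 x0 s1 s2 s3 subr0 !add0r.
  have xE : xi w = v (Y s w) by rewrite /xi indicE Gw mulr1.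
  rewrite indicE Gw; rewrite /y1 /y2 /y3 xE.
  rewrite !mulr1; apply: le_trans tay2 _; rewrite lerD2r.
  rewrite le_eqVlt; apply/orP; left; apply/eqP.
  rewrite !mulrDr mulr1 mulrN.
  congr (_ - _ + _ + _).
  - by rewrite mulr_sumr; apply: eq_bigr => i _; ring.
  - by rewrite mulrA mulr_sumr mulr_suml; apply: eq_bigr => i _; field.
  - rewrite expr2 mulr_suml mulr_suml mulr_sumr; apply: eq_bigr => i _.
    rewrite mulr_sumr mulr_suml mulr_sumr; apply: eq_bigr => k _; by field.
rewrite ExD// ExD// ExD// ExB//.
have ES1 : Ex P S1 = \sum_i Ex P (fun w => y1 i w * dl i w) by exact: Ex_sum.
have ES2 : Ex P S2 = \sum_i Ex P (fun w => y2 i w * dl i w * dl i w) by exact: Ex_sum.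
have ES3 : Ex P S3 = \sum_i \sum_k Ex P (fun w => y3 i k w * dl i w * dl k w).
  by rewrite /S3 Ex_sum//; apply: eq_bigr => i _; exact: Ex_sum.
have ES4 : Ex P S4 <= Qt * (2 * n%:R ^+ 2 * (n%:R * Q)) * eta ^+ 3.
  rewrite /S4 ExZ; last exact: L1Z.
  rewrite ExZ// Ex_sum//.
  rewrite (_ : Qt * (2 * n%:R ^+ 2 * (n%:R * Q)) * eta ^+ 3 =
    Qt * (2 * n%:R ^+ 2 * (n%:R * (Q * eta ^+ 3)))); last by ring.
  apply: ler_wpM2l => //; apply: ler_wpM2l; first by rewrite mulr_ge0// exprn_ge0.
  rewrite [leRHS]mulr_natl -[X in _ *+ X](card_ord n) -sumr_const.
  by apply: ler_sum => i _; exact: mom3.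
have nsum (f g : 'I_n -> R) c : (forall i, f i <= g i + c) -> \sum_i f i <= \sum_i g i + n%:R * c.
  move=> fg; rewrite mulr_natl -[X in _ *+ X](card_ord n) -sumr_const -big_split/=.
  by apply: ler_sum => i _.
have L1' : - Ex P S1 <= - (\sum_i eta ^+ 2 * Ex P (fun w => y1 i w * b i (Y s w))) + n%:R * (Q * B1 * eta ^+ 3).
  rewrite ES1 -!sumrN; apply: (nsum) => i.
  have := mom1 i _ _ (my1 i) (b1 i); rewrite ler_norml => /andP[h _].
  by move: h; rewrite -/(dl i); lra.
have L2' : Ex P S2 <= \sum_i eta ^+ 2 * Ex P (fun w => y2 i w * covariation i i (Y s w)) + n%:R * (Q * B2 * eta ^+ 3).
  rewrite ES2; apply: (nsum) => i.
  have := mom2 i i _ _ (my2 i) (b2 i); rewrite ler_norml => /andP[_ h].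
  by move: h; rewrite -/(dl i); lra.
have L3' : Ex P S3 <= \sum_i \sum_k eta ^+ 2 * Ex P (fun w => y3 i k w * covariation i k (Y s w))
    + n%:R * (n%:R * (Q * B3 * eta ^+ 3)).
  rewrite ES3; apply: (nsum) => i; apply: (nsum) => k.
  have := mom2 i k _ _ (my3 i k) (b3 i k); rewrite ler_norml => /andP[_ h].
  by move: h; rewrite -/(dl i) -/(dl k); lra.
have mcov i k : measurable_fun setT (fun w => covariation i k (Y s w)).
  apply: measurable_sum => j.
  by apply: measurable_funM; exact: (measurable_wrt_fun bm (rd_C_adapted Yd _ j s0)).
have icov i k : L1 P (fun w => covariation i k (Y s w)).
  apply: (L1_bounded (M := n%:R * K ^+ 2) P (mcov i k)) => w.
  exact/covariation_bound/(rd_simplex Yd).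
have ib i : L1 P (fun w => b i (Y s w)).
  apply: (L1_bounded (M := K) P (measurable_wrt_fun bm (rd_b_adapted Yd i s0))) => w.
  exact/(rd_b_bound Yd)/(rd_simplex Yd).
have k1 i : L1 P (fun w => y1 i w * b i (Y s w)) by exact: (L1_boundedM (measurable_wrt_fun bm (my1 i)) (b1 i)).
have k2 i : L1 P (fun w => y2 i w * covariation i i (Y s w)).
  exact: (L1_boundedM (measurable_wrt_fun bm (my2 i)) (b2 i)).
have k3 i k : L1 P (fun w => y3 i k w * covariation i k (Y s w)).
  exact: (L1_boundedM (measurable_wrt_fun bm (my3 i k)) (b3 i k)).
have k3' i : L1 P (fun w => \sum_k y3 i k w * covariation i k (Y s w)) by exact: L1_sum.
have gen : eta ^+ 2 * Ex P (fun w => v (Y s w) * log_generator (Y s w) * \1_G w) =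
   - (\sum_i eta ^+ 2 * Ex P (fun w => y1 i w * b i (Y s w)))
   + \sum_i eta ^+ 2 * Ex P (fun w => y2 i w * covariation i i (Y s w))
   + \sum_i \sum_k eta ^+ 2 * Ex P (fun w => y3 i k w * covariation i k (Y s w)).
  have -> : \sum_i \sum_k eta ^+ 2 * Ex P (fun w => y3 i k w * covariation i k (Y s w)) =
      eta ^+ 2 * Ex P (fun w => \sum_i \sum_k y3 i k w * covariation i k (Y s w)).
    rewrite Ex_sum// mulr_sumr; apply: eq_bigr => i _.
    by rewrite Ex_sum// mulr_sumr.
  rewrite -!mulr_sumr -!Ex_sum// -mulrN -!mulrDr; congr (_ * _).
  rewrite -ExN; last exact: L1_sum.
  rewrite -ExD; [|by apply: L1N; exact: L1_sum|exact: L1_sum].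
  rewrite -ExD; [|by apply: L1D; [apply: L1N; exact: L1_sum|exact: L1_sum]|exact: L1_sum].
  congr Ex; apply/funext => w.
  rewrite (_ : v (Y s w) * log_generator (Y s w) * \1_G w = xi w * log_generator (Y s w)); last first.
    by rewrite /xi mulrAC.
  rewrite /log_generator !mulrDr mulrN; congr (- _ + _ + _).
  - by rewrite mulr_sumr; apply: eq_bigr => i _; rewrite /y1 /wt; ring.
  - rewrite mulrA mulr_sumr mulr_suml; apply: eq_bigr => i _; rewrite /y2 /wt expr2.
    by move: (_^-1) => z; field.
  - rewrite mulrA mulr_sumr mulr_suml; apply: eq_bigr => i _; rewrite mulr_sumr mulr_suml.
    apply: eq_bigr => k _; rewrite /y3 /wt; move: ((Y s w i 0 + eps)^-1) ((Y s w k 0 + eps)^-1) => z z'.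
    by field.
rewrite gen.
have e3 : 0 <= eta ^+ 3 by rewrite exprn_ge0// ltW.
rewrite /Qf; move: L1' L2' L3' ES4.
by move: (Ex P xi) (Ex P S1) (Ex P S2) (Ex P S3) (Ex P S4) => ????? ; lra.
Qed.

End OneStep.

(** * Discrete Gronwall argument for the potential *)

Section Gronwall.
Context (R : realType) (d : measure_display) (T : measurableType d)
  (P : probability T R) (n : nat) (W : R -> T -> 'cV[R]_n).
Hypothesis bm : standard_brownian_motion P W.
Variables (b : 'I_n -> 'cV[R]_n -> R) (C : 'I_n -> 'I_n -> 'cV[R]_n -> R)
  (K : R) (Y : R -> T -> 'cV[R]_n).
Hypothesis Yd : regular_diffusion P W b C K Y.
Hypothesis K_ge0 : 0 <= K.
Variables (theta : 'I_n -> R) (eps : R).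
Hypotheses (eps_gt0 : 0 < eps) (eps_le1 : eps <= 1).
Let F := augmented_filtration P W.
Let v := potential theta eps.

(** Since a_k >= 0, the factor 1 + rho h may be replaced by exp(rho h), also for negative rho. This
    keeps true exponential decay in the main term, while the accumulated error uses |rho|. *)
Lemma discrete_gronwall (a : nat -> R) (rho h del : R) N : 0 <= h -> 0 <= del ->
  (forall k, (k < N)%N -> a k.+1 <= (1 + rho * h) * a k + h * del) ->
  (forall k, 0 <= a k) ->
  forall k, (k <= N)%N ->
    a k <= expR (rho * (k%:R * h)) * a 0%N + k%:R * h * del * expR (`|rho| * (k%:R * h)).
Proof.
move=> h0 del0 step a0; elim=> [_|k IH kN].
  by rewrite !mul0r mulr0 expR0 mul1r addr0.
have {}IH := IH (ltnW kN).
have e1 : (1 + rho * h) * a k <= expR (rho * h) * a k.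
  by rewrite ler_wpM2r// expR_ge1Dx.
have e2 : expR (rho * h) * a k <= expR (rho * h) *
    (expR (rho * (k%:R * h)) * a 0%N + k%:R * h * del * expR (`|rho| * (k%:R * h))).
  by rewrite ler_wpM2l// expR_ge0.
have kE : k.+1%:R = k%:R + 1 :> R by rewrite -natr1.
have hd : 0 <= h * del by rewrite mulr_ge0.
have e3 : expR (rho * h) * (k%:R * h * del * expR (`|rho| * (k%:R * h))) <=
    k%:R * h * del * expR (`|rho| * (k.+1%:R * h)).
  rewrite mulrCA; apply: ler_wpM2l; first by rewrite -mulrA mulr_ge0.
  rewrite -expRD ler_expR kE mulrDl mul1r [leRHS]mulrDr addrC lerD2l.
  by rewrite ler_wpM2r// ler_norm.
have e4 : h * del <= h * del * expR (`|rho| * (k.+1%:R * h)).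
  by rewrite ler_peMr// -expR0 ler_expR !mulr_ge0.
have e5 : expR (rho * h) * (expR (rho * (k%:R * h)) * a 0%N) = expR (rho * (k.+1%:R * h)) * a 0%N.
  by rewrite mulrA -expRD kE; congr (expR _ * _); ring.
apply: le_trans (step k kN) _; rewrite -e5.
have -> : k.+1%:R * h * del * expR (`|rho| * (k.+1%:R * h)) =
    k%:R * h * del * expR (`|rho| * (k.+1%:R * h)) + h * del * expR (`|rho| * (k.+1%:R * h)).
  by rewrite kE; ring.
rewrite [X in _ <= X]mulrDr in e2.
by move: e1 e2 e3 e4; lra.
Qed.

(** Steps of length h = eta^2 have errors Q eta^3, and there are (t - s) / h of them, so the total
    is of order eta and disappears as the mesh is refined. *)
Lemma potential_gronwall s t (G : set T) (rho del : R) : 0 <= s -> s <= t -> F s G -> 0 <= del ->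
  (forall r, s <= r -> r <= t ->
    Ex P (fun w => v (Y r w) * log_generator b C theta eps (Y r w) * \1_G w) <=
      rho * Ex P (fun w => v (Y r w) * \1_G w) + del) ->
  Ex P (fun w => v (Y t w) * \1_G w) <=
    expR (rho * (t - s)) * Ex P (fun w => v (Y s w) * \1_G w) +
    (t - s) * del * expR (`|rho| * (t - s)).
Proof.
move=> s0; rewrite le_eqVlt => /predU1P[<-|st] FG del0 gen.
  by rewrite subrr !mulr0 !mul0r expR0 mul1r addr0.
have [Q Q0 one] := one_step bm Yd K_ge0 theta eps_gt0 eps_le1.
set tau := t - s; have tau0 : 0 < tau by rewrite subr_gt0.
apply: (@le_of_small _ _ _ (tau * Q * expR (`|rho| * tau))) => [|k k0 k1].
  by rewrite !mulr_ge0 ?expR_ge0// ltW.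
(* So many steps make h <= k^2, that is eta <= k, and the accumulated error becomes linear in k. *)
pose N := (Num.truncn (tau / k ^+ 2)).+1.
have N0 : 0 < N%:R :> R by rewrite ltr0n.
have kk : 0 < k ^+ 2 by rewrite exprn_gt0.
pose h := tau / N%:R.
have h0 : 0 < h by rewrite divr_gt0.
have hk : h <= k ^+ 2.
  rewrite /h ler_pdivrMr// mulrC -ler_pdivrMr//; exact/ltW/truncnS_gt.
pose eta := Num.sqrt h.
have eta0 : 0 < eta by rewrite sqrtr_gt0.
have eta2 : eta ^+ 2 = h by rewrite sqr_sqrtr// ltW.
have etak : eta <= k by rewrite -[k]ger0_norm ?(ltW k0)// -sqrtr_sqr ler_wsqrtr.
pose a m := Ex P (fun w => v (Y (s + m%:R * h) w) * \1_G w).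
have Nh : N%:R * h = tau by rewrite /h mulrC divfK// gt_eqF.
have hQ : 0 <= del + Q * eta by rewrite addr_ge0// mulr_ge0// ltW.
have h0' := ltW h0.
have step m : (m < N)%N -> a m.+1 <= (1 + rho * h) * a m + h * (del + Q * eta).
  move=> mN; pose r := s + m%:R * h.
  have sr : s <= r by rewrite lerDl mulr_ge0// ltW.
  have rt : r <= t.
    rewrite -lerBrDl -/tau -Nh ler_wpM2r//.
    by rewrite ler_nat ltnW.
  have := one r eta G (le_trans s0 sr) eta0 (le_trans etak k1) (filtration_mono sr FG).
  rewrite eta2 (_ : r + h = s + m.+1%:R * h); last by rewrite /r -natr1; ring.
  move/le_trans; apply; rewrite -/(a m).
  have := ler_wpM2l h0' (gen r sr rt); rewrite -/(a m).
  rewrite (_ : Q * eta ^+ 3 = h * (Q * eta)); last by rewrite -eta2; ring.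
  by lra.
have a0 m : 0 <= a m.
  by apply: Ex_ge0 => w; rewrite mulr_ge0// ltW// potential_gt0.
have := discrete_gronwall h0' hQ step a0 (leqnn N).
rewrite /a mul0r addr0 Nh [s + _]addrC subrK; move/le_trans; apply.
rewrite -[leRHS]addrA lerD2l.
have : tau * Q * expR (`|rho| * tau) * eta <= tau * Q * expR (`|rho| * tau) * k.
  by apply: ler_wpM2l => //; rewrite !mulr_ge0// ltW.
by move: (expR _) => E; nra.
Qed.

Let Yge0 r w k : 0 <= Y r w k 0.
Proof. by have [h _] := rd_simplex Yd r w; have /andP[] := h k. Qed.

Let wt_bound r w i : `|(Y r w i 0 + eps)^-1| <= eps^-1.
Proof.
have d0 : 0 < Y r w i 0 + eps by rewrite ltr_wpDl.
by rewrite normfV (gtr0_norm d0) lef_pV2 ?posrE// lerDr.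
Qed.

Lemma inverse_measurable s i : 0 <= s -> measurable_fun setT (fun w => (Y s w i 0 + eps)^-1).
Proof.
move=> s0; rewrite (_ : (fun w => _) = (fun w => expR (- ln (Y s w i 0 + eps)))).
  apply: measurableT_comp => //; apply: measurableT_comp => //; apply: measurableT_comp => //.
  by apply: measurable_funD => //; exact: (measurable_wrt_fun bm (rd_adapted Yd i s0)).
by apply/funext => w; rewrite expRN lnK ?posrE// ltr_wpDl.
Qed.

Lemma inverse_L1 s i : 0 <= s -> L1 P (fun w => (Y s w i 0 + eps)^-1).
Proof. by move=> s0; apply: (L1_bounded P (inverse_measurable i s0)) => w; exact: wt_bound. Qed.

Lemma generator_event_L1 s G : 0 <= s -> F s G ->
  L1 P (fun w => v (Y s w) * log_generator b C theta eps (Y s w) * \1_G w).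
Proof.
move=> s0 FG.
have ib i : L1 P (fun w => b i (Y s w)).
  apply: (L1_bounded (M := K) P (measurable_wrt_fun bm (rd_b_adapted Yd i s0))) => w.
  exact/(rd_b_bound Yd)/(rd_simplex Yd).
have ic i k : L1 P (fun w => covariation C i k (Y s w)).
  apply: (L1_bounded (M := n%:R * K ^+ 2) P).
    apply: measurable_sum => j.
    by apply: measurable_funM; exact: (measurable_wrt_fun bm (rd_C_adapted Yd _ j s0)).
  by move=> w; exact/(covariation_bound Yd)/(rd_simplex Yd).
have iw f i : L1 P f -> L1 P (fun w => (Y s w i 0 + eps)^-1 * f w).
  by move=> jf; exact: (L1_boundedM (inverse_measurable i s0) (fun w => wt_bound s w i) jf).
have il : L1 P (fun w => log_generator b C theta eps (Y s w)).
  apply: L1D; first apply: L1D.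
  - apply: L1N; apply: L1_sum => i.
    by under [X in L1 P X]eq_fun do rewrite -mulrA; apply: L1Z; exact: iw.
  - under [X in L1 P X]eq_fun do rewrite mulrC; apply: L1Z; apply: L1_sum => i.
    under [X in L1 P X]eq_fun do rewrite expr2 -mulrA -mulrA.
    by apply: L1Z; apply: (iw); exact: iw.
  - under [X in L1 P X]eq_fun do rewrite mulrC; apply: L1Z; apply: L1_sum => i.
    apply: L1_sum => k; under [X in L1 P X]eq_fun do rewrite -mulrA -mulrA.
    by apply: L1Z; apply: (iw); exact: iw.
have [V hV] := potential_bounded theta eps_gt0 eps_le1.
rewrite (_ : (fun w => _) = (fun w => (v (Y s w) * \1_G w) * log_generator b C theta eps (Y s w))).
  have m := L1_measurable (potential_event_L1 bm Yd theta eps_gt0 eps_le1 s0 FG).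
  apply: (@L1_boundedM _ _ _ P _ _ V m _ il) => w; have V0 := potential_gt0 theta eps (Y s w).
  have Vw := hV _ (rd_simplex Yd s w).
  rewrite normrM (gtr0_norm V0) indicE; case: (w \in G); rewrite ?normr1 ?mulr1//.
  by rewrite normr0 mulr0 (le_trans (ltW V0)).
by apply/funext => w; rewrite mulrAC.
Qed.

(** The generator inequality is allowed a defect that blows up like the inverse coordinates near the
    boundary; only the mean of this defect matters, and inverse moments control it. *)
Lemma potential_gronwall_pointwise s t (G : set T) (rho del c : R) :
  0 <= s -> s <= t -> F s G -> 0 <= del -> 0 <= c ->
  (forall x, simplex x -> v x * log_generator b C theta eps x <=
     rho * v x + del * \sum_i (x i 0 + eps)^-1) ->
  (forall r i, s <= r -> r <= t -> Ex P (fun w => (Y r w i 0 + eps)^-1) <= c) ->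
  Ex P (fun w => v (Y t w) * \1_G w) <=
    expR (rho * (t - s)) * Ex P (fun w => v (Y s w) * \1_G w) +
    (t - s) * (n%:R * c * del) * expR (`|rho| * (t - s)).
Proof.
move=> s0 st FG del0 c0 gen mom.
apply: potential_gronwall => // [|r sr rt]; first by rewrite !mulr_ge0.
have r0 := le_trans s0 sr; have FrG := filtration_mono sr FG.
have iv := potential_event_L1 bm Yd theta eps_gt0 eps_le1 r0 FrG.
have is_ : L1 P (fun w => \sum_i (Y r w i 0 + eps)^-1) by apply: L1_sum => i; exact: inverse_L1.
apply: (@le_trans _ _ (Ex P (fun w => rho * (v (Y r w) * \1_G w) +
    del * \sum_i (Y r w i 0 + eps)^-1))).
  apply: Ex_le => [||w]; first exact: generator_event_L1.
    by apply: L1D; exact: L1Z.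
  have S0 : 0 <= \sum_i (Y r w i 0 + eps)^-1.
    by apply: sumr_ge0 => i _; rewrite invr_ge0 addr_ge0// ltW.
  have := gen _ (rd_simplex Yd r w); rewrite indicE; case: (w \in G) => h.
    by rewrite !mulr1.
  by rewrite !mulr0 add0r mulr_ge0.
rewrite ExD; [|exact: L1Z|exact: L1Z].
rewrite ExZ// ExZ// lerD2l [leRHS]mulrC; apply: ler_wpM2l => //.
rewrite Ex_sum => [|i]; last exact: inverse_L1.
rewrite mulr_natl -[X in _ *+ X](card_ord n) -sumr_const.
by apply: ler_sum => i _; exact: mom.
Qed.

End Gronwall.

Lemma Ex_dominated_cvg (R : realType) (d : measure_display) (T : measurableType d)
    (P : probability T R) (f_ : nat -> T -> R) (f g : T -> R) :
  (forall m, measurable_fun setT (f_ m)) -> measurable_fun setT f -> L1 P g ->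
  {ae P, forall w, (fun m => f_ m w) @ \oo --> f w} ->
  {ae P, forall w m, `|f_ m w| <= g w} ->
  L1 P f /\ (fun m => Ex P (f_ m)) @ \oo --> Ex P f.
Proof.
move=> mf_ mf g1 cf fg.
(* The domination holds almost surely, so each [f_ m] is compared with a version set to 0 wherever
   the bound fails. *)
have i_ m : L1 P (f_ m).
  apply: (@L1_ae_eq _ _ _ P (fun w => if `|f_ m w| <= g w then f_ m w else 0)).
  - exact: mf_.
  - have mg := L1_measurable g1.
    apply: (L1_le (g := fun w => `|g w|)) => [|w|]; last exact: L1_norm.
    + apply: measurable_fun_ifT => //.
      apply: (measurable_fun_ler _ mg) => //; exact: measurableT_comp.
    + by case: ifP => [/le_trans->//|]; rewrite ?ler_norm// normr0.
  - by apply: filterS fg => w /(_ m) ->.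
have [] := @dominated_convergence _ T R P setT measurableT (fun m w => (f_ m w)%:E)
  (fun w => (f w)%:E) (fun w => (g w)%:E).
- by move=> m; exact/measurable_EFinP.
- exact/measurable_EFinP.
- by apply: filterS cf => w h _; exact: cvg_EFin (nearW _ _) h.
- exact: g1.
- by apply: filterS fg => w h m _; rewrite lee_fin.
move=> f1 _ h; split=> //; move: h.
by rewrite -(ExE (P := P) (f := f))// => /fine_cvgP[_].
Qed.

(** * Generators with coefficients proportional to the coordinates *)

Section Structured.
Context (R : realType) (d : measure_display) (T : measurableType d)
  (P : probability T R) (n : nat) (W : R -> T -> 'cV[R]_n).
Hypothesis bm : standard_brownian_motion P W.
Variables (b : 'I_n -> 'cV[R]_n -> R) (C : 'I_n -> 'I_n -> 'cV[R]_n -> R)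
  (K : R) (Y : R -> T -> 'cV[R]_n).
Hypothesis Yd : regular_diffusion P W b C K Y.
Hypothesis K_ge0 : 0 <= K.
Variables (beta : 'I_n -> 'cV[R]_n -> R) (alpha : 'I_n -> 'I_n -> 'cV[R]_n -> R) (B : R).
Hypothesis B_ge0 : 0 <= B.
Hypothesis b_beta : forall i x, simplex x -> b i x = x i 0 * beta i x.
Hypothesis C_alpha : forall i k x, simplex x ->
  covariation C i k x = x i 0 * x k 0 * alpha i k x.
Hypothesis beta_bound : forall i x, simplex x -> `|beta i x| <= B.
Hypothesis alpha_bound : forall i k x, simplex x -> `|alpha i k x| <= B.
Let F := augmented_filtration P W.

(** This is the formal value at eps = 0 of [log_generator]: the factors x_i of the coefficients
    cancel the inverse coordinates, so it stays bounded up to the boundary. *)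
Definition limit_generator (theta : 'I_n -> R) (x : 'cV[R]_n) : R :=
  - (\sum_i theta i * beta i x) + (\sum_i theta i * alpha i i x) / 2
  + (\sum_i \sum_k theta i * theta k * alpha i k x) / 2.

Definition total_weight (theta : 'I_n -> R) : R := \sum_i `|theta i|.

Lemma total_weight_ge0 theta : 0 <= total_weight theta.
Proof. by apply: sumr_ge0. Qed.

Section Bounds.
Variables (theta : 'I_n -> R) (eps : R).
Hypothesis eps_gt0 : 0 < eps.
Let kap := total_weight theta.

Let u i (x : 'cV[R]_n) := x i 0 / (x i 0 + eps).

Let u01 i x : simplex x -> 0 <= u i x <= 1.
Proof.
move=> [h _]; have /andP[x0 _] := h i; have d0 : 0 < x i 0 + eps by rewrite ltr_wpDl.
by rewrite /u divr_ge0 ?(ltW d0)//= ler_pdivrMr// mul1r lerDl ltW.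
Qed.

Let log_generatorE x : simplex x -> log_generator b C theta eps x =
  - (\sum_i theta i * (u i x * beta i x)) + (\sum_i theta i * (u i x ^+ 2 * alpha i i x)) / 2
  + (\sum_i \sum_k theta i * theta k * (u i x * u k x * alpha i k x)) / 2.
Proof.
move=> sx; rewrite /log_generator; congr (- _ + _ / 2 + _ / 2).
- by apply: eq_bigr => i _; rewrite b_beta// /u; ring.
- by apply: eq_bigr => i _; rewrite C_alpha// /u; ring.
- by apply: eq_bigr => i _; apply: eq_bigr => k _; rewrite C_alpha// /u; ring.
Qed.

Let weighted_bound (f : 'I_n -> R) (M : R) : (forall i, `|f i| <= M) ->
  `|\sum_i theta i * f i| <= kap * M.
Proof.
move=> fM; apply: le_trans (ler_norm_sum _ _ _) _.
rewrite /kap mulr_suml; apply: ler_sum => i _; rewrite normrM.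
by rewrite ler_wpM2l.
Qed.

Let weighted_bound2 (f : 'I_n -> 'I_n -> R) (M : R) : (forall i k, `|f i k| <= M) ->
  `|\sum_i \sum_k theta i * theta k * f i k| <= kap ^+ 2 * M.
Proof.
move=> fM; have -> : kap ^+ 2 * M = kap * (kap * M) by ring.
rewrite (eq_bigr (fun i => theta i * \sum_k theta k * f i k)).
  by apply: weighted_bound => i; exact: weighted_bound.
by move=> i _; rewrite mulr_sumr; apply: eq_bigr => k _; rewrite mulrA.
Qed.

(** Each inverse 1/(x_i + eps) meets a factor x_i from the coefficients, and their ratio lies
    between 0 and 1; hence the bound is independent of eps. *)
Lemma log_generator_bound x : simplex x ->
  log_generator b C theta eps x <= (2 * kap + kap ^+ 2) * B.
Proof.
move=> sx; rewrite log_generatorE//.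
have h1 : `|\sum_i theta i * (u i x * beta i x)| <= kap * B.
  apply: weighted_bound => i; have /andP[u0 u1] := u01 i sx.
  rewrite normrM [X in X * _ <= _]ger0_norm// -[leRHS]mul1r; apply: ler_pM => //; exact: beta_bound.
have h2 : `|\sum_i theta i * (u i x ^+ 2 * alpha i i x)| <= kap * B.
  apply: weighted_bound => i; have /andP[u0 u1] := u01 i sx.
  rewrite normrM [X in X * _ <= _]ger0_norm ?sqr_ge0// -[leRHS]mul1r; apply: ler_pM => //; last exact: alpha_bound.
    exact: sqr_ge0.
  by rewrite expr_le1.
have h3 : `|\sum_i \sum_k theta i * theta k * (u i x * u k x * alpha i k x)| <= kap ^+ 2 * B.
  apply: weighted_bound2 => i k; have /andP[u0 u1] := u01 i sx; have /andP[v0 v1] := u01 k sx.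
  have uu := mulr_ge0 u0 v0.
  rewrite normrM [X in X * _ <= _]ger0_norm// -[leRHS]mul1r; apply: ler_pM => //; last exact: alpha_bound.
  by rewrite mulr_ile1.
have := total_weight_ge0 theta; rewrite -/kap => k0.
have kB := mulr_ge0 k0 B_ge0.
have kB2 := mulr_ge0 (sqr_ge0 kap) B_ge0.
move: h1 h2 h3; rewrite !ler_norml => /andP[h1 _] /andP[_ h2] /andP[_ h3].
by move: kB kB2 h1 h2 h3; lra.
Qed.

(** Replacing the ratios x_i/(x_i + eps) by 1 costs eps/(x_i + eps), which equals 1 on a face; the
    error is therefore kept as a function of x instead of being bounded uniformly. *)
Lemma log_generator_limit x : simplex x ->
  log_generator b C theta eps x <= limit_generator theta x +
    (2 * kap + kap ^+ 2) * B * \sum_i eps / (x i 0 + eps).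
Proof.
move=> sx; rewrite log_generatorE// /limit_generator.
pose m i := eps / (x i 0 + eps); pose M := \sum_i m i.
have um i : u i x = 1 - m i.
  have [h _] := sx; have /andP[x0 _] := h i; have d0 : 0 < x i 0 + eps by rewrite ltr_wpDl.
  by rewrite /u /m; field; rewrite gt_eqF.
have m0 i : 0 <= m i by have /andP[_] := u01 i sx; rewrite um; lra.
have m1 i : m i <= 1 by have /andP[] := u01 i sx; rewrite um; lra.
have mM i : m i <= M.
  rewrite /M (bigD1 i)//= lerDl; apply: sumr_ge0 => j _; exact: m0.
have M0 : 0 <= M by apply: sumr_ge0 => i _; exact: m0.
have h1 : `|\sum_i theta i * (m i * beta i x)| <= kap * (M * B).
  apply: weighted_bound => i; rewrite normrM [X in X * _ <= _]ger0_norm//.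
  by apply: ler_pM => //; exact: beta_bound.
have h2 : `|\sum_i theta i * ((1 - u i x ^+ 2) * alpha i i x)| <= kap * (2 * M * B).
  apply: weighted_bound => i; rewrite normrM; apply: ler_pM => //; last exact: alpha_bound.
  rewrite um; have := m0 i; have := m1 i; have := mM i; move: (m i) => z zM z1 z0.
  by rewrite ger0_norm; nra.
have h3 : `|\sum_i \sum_k theta i * theta k * ((1 - u i x * u k x) * alpha i k x)| <=
    kap ^+ 2 * (2 * M * B).
  apply: weighted_bound2 => i k; rewrite normrM; apply: ler_pM => //; last exact: alpha_bound.
  rewrite !um; have := m0 i; have := m1 i; have := mM i; move: (m i) => z zM z1 z0.
  have := m0 k; have := m1 k; have := mM k; move: (m k) => y yM y1 y0.
  by rewrite ger0_norm; nra.
have e1 : \sum_i theta i * beta i x = \sum_i theta i * (u i x * beta i x) +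
    \sum_i theta i * (m i * beta i x).
  by rewrite -big_split/=; apply: eq_bigr => i _; rewrite um; ring.
have e2 : \sum_i theta i * alpha i i x = \sum_i theta i * (u i x ^+ 2 * alpha i i x) +
    \sum_i theta i * ((1 - u i x ^+ 2) * alpha i i x).
  by rewrite -big_split/=; apply: eq_bigr => i _; ring.
have e3 : \sum_i \sum_k theta i * theta k * alpha i k x =
    \sum_i \sum_k theta i * theta k * (u i x * u k x * alpha i k x) +
    \sum_i \sum_k theta i * theta k * ((1 - u i x * u k x) * alpha i k x).
  rewrite -big_split/=; apply: eq_bigr => i _; rewrite -big_split/=.
  by apply: eq_bigr => k _; ring.
rewrite e1 e2 e3 -/M.
move: h1 h2 h3; rewrite !ler_norml => /andP[_ h1] /andP[h2 _] /andP[h3 _].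
rewrite (_ : (2 * kap + kap ^+ 2) * B * M = kap * (M * B) + kap * (2 * M * B) / 2 +
  kap ^+ 2 * (2 * M * B) / 2); last by field.
by move: h1 h2 h3; lra.
Qed.
End Bounds.
End Structured.

(** * Positivity and inverse moments *)

Section Positivity.
Context (R : realType) (d : measure_display) (T : measurableType d)
  (P : probability T R) (n : nat) (W : R -> T -> 'cV[R]_n).
Hypothesis bm : standard_brownian_motion P W.
Variables (b : 'I_n -> 'cV[R]_n -> R) (C : 'I_n -> 'I_n -> 'cV[R]_n -> R)
  (K : R) (Y : R -> T -> 'cV[R]_n).
Hypothesis Yd : regular_diffusion P W b C K Y.
Hypothesis K_ge0 : 0 <= K.
Variables (beta : 'I_n -> 'cV[R]_n -> R) (alpha : 'I_n -> 'I_n -> 'cV[R]_n -> R) (B : R).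
Hypothesis B_ge0 : 0 <= B.
Hypothesis b_beta : forall i x, simplex x -> b i x = x i 0 * beta i x.
Hypothesis C_alpha : forall i k x, simplex x ->
  covariation C i k x = x i 0 * x k 0 * alpha i k x.
Hypothesis beta_bound : forall i x, simplex x -> `|beta i x| <= B.
Hypothesis alpha_bound : forall i k x, simplex x -> `|alpha i k x| <= B.
Variable x0 : 'cV[R]_n.
Hypothesis x0_gt0 : forall i, 0 < x0 i 0.
Hypothesis Y0 : {ae P, forall w, Y 0 w = x0}.
Let F := augmented_filtration P W.

Let Yge0 r w k : 0 <= Y r w k 0.
Proof. by have [h _] := rd_simplex Yd r w; have /andP[] := h k. Qed.

Let Yle1 r w k : Y r w k 0 <= 1.
Proof. by have [h _] := rd_simplex Yd r w; have /andP[] := h k. Qed.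

Let Ymeas r k : 0 <= r -> measurable_fun setT (fun w => Y r w k 0).
Proof. by move=> r0; exact: (measurable_wrt_fun bm (rd_adapted Yd k r0)). Qed.

Let pot1 k eps (x : 'cV[R]_n) : 0 < x k 0 + eps ->
  potential (fun i => (i == k)%:R) eps x = (x k 0 + eps)^-1.
Proof.
move=> d0; rewrite /potential (bigD1 k)//= eqxx mul1r big1 ?addr0.
  by rewrite expRN lnK ?posrE.
by move=> i /negPf ->; rewrite mul0r.
Qed.

Let bound k t := expR (3 * B * t) / x0 k 0.

(** A unit weight on coordinate k makes the potential equal to 1/(x_k + eps); its total weight is 1,
    so the generator bound is (2 + 1) B = 3 B, uniformly in eps. *)
Lemma regularised_inverse_moment k eps t : 0 < eps -> eps <= 1 -> 0 <= t ->
  L1 P (fun w => (Y t w k 0 + eps)^-1) /\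
  Ex P (fun w => (Y t w k 0 + eps)^-1) <= bound k t.
Proof.
move=> e0 e1 t0; set v := potential (fun i => (i == k)%:R) eps.
have vE r : (fun w => v (Y r w) * \1_setT w) = (fun w => (Y r w k 0 + eps)^-1).
  by apply/funext => w; rewrite indicE in_setT mulr1 /v pot1// ltr_wpDl.
have FT r : F r setT by exact: measurable_wrt_setT.
have i1 r : 0 <= r -> L1 P (fun w => (Y r w k 0 + eps)^-1).
  by move=> r0; rewrite -vE; exact: (potential_event_L1 bm Yd (fun i => (i == k)%:R) e0 e1 r0 (FT r)).
split; first exact: i1.
have kap1 : total_weight (fun i => (i == k)%:R : R) = 1.
  rewrite /total_weight (bigD1 k)//= eqxx normr1 big1 ?addr0// => i /negPf ->.
  by rewrite normr0.
have ei0 : 0 <= eps^-1 by rewrite invr_ge0 ltW.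
(* The defect is 0 here, so the crude bound 1/eps on the inverse moments is enough and leaves no
   trace in the conclusion. *)
have := @potential_gronwall_pointwise _ _ _ _ _ _ bm _ _ _ _ Yd K_ge0 (fun i => (i == k)%:R) eps e0 e1
  0 t setT (3 * B) 0 eps^-1 (lexx 0) t0 (FT 0) (lexx 0) ei0.
rewrite -/v !vE subr0 !mulr0 !mul0r addr0 => H; apply: (le_trans (H _ _)).
- move=> x sx; rewrite mul0r addr0 mulrC; apply: ler_wpM2r; first exact/ltW/potential_gt0.
  apply: le_trans (log_generator_bound B_ge0 b_beta C_alpha beta_bound alpha_bound _ e0 sx) _.
  by rewrite kap1 expr1n mulr1; have -> : 2 + 1 = 3 :> R by ring.
- move=> r i r0 rt; rewrite -(Ex_cst P eps^-1); apply: Ex_le; [|exact: L1_cst|].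
    exact: (inverse_L1 bm Yd e0 i r0).
  by move=> w; rewrite lef_pV2 ?posrE ?ltr_wpDl// lerDr.
rewrite /bound; apply: ler_wpM2l; first exact: expR_ge0.
have x00 := x0_gt0 k.
rewrite -(Ex_cst P (x0 k 0)^-1); apply: Ex_ae_le; [exact: i1|exact: L1_cst|].
apply: filterS Y0 => w ->; rewrite lef_pV2 ?posrE ?addr_gt0//.
by rewrite lerDl ltW.
Qed.

(** Where the coordinate vanishes its regularised inverse is at least 1/eps; by Markov's inequality
    the probability is at most eps times a constant. The null event may depend on t, which suffices
    for taking limits at fixed times. *)
Lemma coordinate_gt0 k t : 0 <= t -> {ae P, forall w, 0 < Y t w k 0}.
Proof.
move=> t0; pose Z := [set w | Y t w k 0 <= 0].
have mZ : measurable Z.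
  rewrite (_ : Z = (fun w => Y t w k 0) @^-1` `]-oo, 0]); last first.
    by apply/seteqP; split => w /=; rewrite in_itv.
  by rewrite -[X in measurable X]setTI; exact: (Ymeas k t0).
have PZ : fine (P Z) <= 0.
  apply: (@le_of_small _ _ _ (bound k t)) => [|e e0 e1].
    by rewrite divr_ge0 ?expR_ge0// ltW.
  have [i1 i2] := regularised_inverse_moment k e0 e1 t0.
  rewrite add0r -ler_pdivrMl//; apply: le_trans i2; apply: (Ex_markov i1) => // w.
    by rewrite invr_ge0 addr_ge0// ltW.
  by move=> Zw; rewrite lef_pV2 ?posrE ?ltr_wpDl//; rewrite /Z/= in Zw; lra.
exists Z; split => // [|w /=]; last by move/negP; rewrite -leNgt.
apply/eqP; rewrite eq_le measure_ge0 andbT -(fineK (fin_num_measure P _ mZ)).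
by rewrite lee_fin.
Qed.

Lemma inverse_coordinate_L1 k t : 0 <= t ->
  L1 P (fun w => expR (- ln (Y t w k 0))).
Proof.
move=> t0.
have mf : measurable_fun setT (fun w => expR (- ln (Y t w k 0))).
  by apply: measurableT_comp => //; apply: measurableT_comp => //; apply: measurableT_comp => //; exact: Ymeas.
have bd0 : 0 <= bound k t by rewrite divr_ge0 ?expR_ge0// ltW.
suff h (m : nat) : Ex P (fun w => Num.min (expR (- ln (Y t w k 0))) m%:R) <= bound k t.
  by have [] := L1_truncations mf (fun w => expR_ge0 _) h.
apply: (@le_of_small _ _ _ (m%:R ^+ 2)) => [|e e0 e1]; first exact: sqr_ge0.
have [i1 i2] := regularised_inverse_moment k e0 e1 t0.
(* Capping at m makes the passage quantitative: while 1/y <= m, the difference 1/y - 1/(y + e) = e /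
   (y (y + e)) is at most e m^2. *)
apply: (@le_trans _ _ (Ex P (fun w => (Y t w k 0 + e)^-1 + e * m%:R ^+ 2))); last first.
  by rewrite ExD ?Ex_cst ?lerD2r//; exact: L1_cst.
apply: Ex_le; [|by apply: L1D => //; exact: L1_cst|move=> w].
  apply: (@L1_bounded _ _ _ P _ m%:R); first exact: measurable_minr.
  by move=> w; rewrite ger0_norm ?le_min ?expR_ge0 ?ler0n// ge_min lexx orbT.
have m0 : 0 <= m%:R :> R by [].
(* At y = 0 the convention ln 0 = 0 gives the value 1, which is below 1/e as e <= 1. *)
have y1 := Yle1 t w k; have := Yge0 t w k; rewrite le_eqVlt => /predU1P[y0|y0].
  apply: (@le_trans _ _ 1).
    by rewrite -y0 ln0// oppr0 expR0 ge_min lexx.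
  rewrite -y0 add0r; apply: (@le_trans _ _ e^-1); first by rewrite invf_ge1.
  by rewrite lerDl mulr_ge0 ?sqr_ge0// ltW.
rewrite expRN lnK ?posrE//; move: (Y t w k 0) y0 y1 => y y0 _.
have ye : 0 < y + e by rewrite addr_gt0.
have E : (y + e)^-1 = y^-1 - e * (y^-1 * (y + e)^-1) by field; rewrite !gt_eqF.
have [ym|ym] := boolP (y^-1 <= m%:R).
  apply: (@le_trans _ _ y^-1); first by rewrite ge_min lexx.
  rewrite E -addrA lerDl addrC subr_ge0; apply: ler_wpM2l; first exact: ltW.
  rewrite expr2; apply: ler_pM; rewrite ?invr_ge0 ?(ltW y0) ?(ltW ye)//.
  by apply: le_trans ym; rewrite lef_pV2 ?posrE// lerDl ltW.
apply: (@le_trans _ _ m%:R); first by rewrite ge_min lexx orbT.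
have ym' : m%:R * y <= 1.
  rewrite -ltNge in ym; have := ltW ym; rewrite -(ler_pM2r y0) mulVf ?gt_eqF//.
rewrite -(ler_pM2r ye) mulrDl mulVf ?gt_eqF//.
have : 0 <= e * m%:R ^+ 2 * y by rewrite !mulr_ge0 ?sqr_ge0// ltW.
have : e * m%:R <= 1 + e ^+ 2 * m%:R ^+ 2.
  by have := sqr_ge0 (e * m%:R - 1); rewrite sqrrB expr1n exprMn; have := ltW e0; nra.
move: (m%:R : R) m0 ym' => z z0 zy h1 h2; nra.
Qed.
End Positivity.

Lemma cvg_sumr (R : realType) (U : Type) (F : set_system U) (FF : Filter F)
    (I : Type) (s : seq I) (f : I -> U -> R) (l : I -> R) :
  (forall i, f i x @[x --> F] --> l i) ->
  \sum_(i <- s) f i x @[x --> F] --> \sum_(i <- s) l i.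
Proof.
move=> fl; elim: s => [|i s IH].
  by rewrite big_nil; under eq_fun do rewrite big_nil; exact: cvg_cst.
by rewrite big_cons; under eq_fun do rewrite big_cons; apply: cvgD.
Qed.

(** * Removing the regularisation *)

Section PotentialGrowth.
Context (R : realType) (n : nat).
Hypothesis n_ge2 : (2 <= n)%N.
Variables (theta : 'I_n -> R) (eps : R) (x : 'cV[R]_n).
Hypotheses (small : total_weight theta <= 1 / 2) (eps_ge0 : 0 <= eps) (eps_le1 : eps <= 1).
Hypotheses (x_simplex : simplex x) (x_gt0 : forall i, 0 < x i 0 + eps).
Let S := \sum_i (x i 0 + eps)^-1.

Let le_S i : (x i 0 + eps)^-1 <= S.
Proof.
rewrite /S (bigD1 i)//= lerDl; apply: sumr_ge0 => k _.
by rewrite invr_ge0 ltW.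
Qed.

Let le2 i : x i 0 + eps <= 2.
Proof. by have [h _] := x_simplex; have /andP[_ h1] := h i; have := eps_le1; lra. Qed.

Let S_ge1 : 1 <= S.
Proof.
have : n%:R * 2^-1 <= S.
  rewrite mulr_natl -[X in _ *+ X](card_ord n) -sumr_const.
  by apply: ler_sum => i _; rewrite lef_pV2 ?posrE.
have : 2 <= n%:R :> R by rewrite ler_nat.
by lra.
Qed.

(** Every |ln (x_i + eps)| is at most ln (2 S), because x_i + eps lies between 1/S and 2 and S >= 1.
    Total weight 1/2 then turns this into a square root of 2 S. *)
Lemma potential_sqr_le : potential theta eps x ^+ 2 <= 2 * S.
Proof.
have S0 : 0 < S by apply: lt_le_trans S_ge1.
have L0 : 0 <= ln (2 * S) by apply: ln_ge0; have := S_ge1; lra.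
have le1 : `|\sum_i theta i * ln (x i 0 + eps)| <= ln (2 * S) / 2.
  apply: le_trans (ler_norm_sum _ _ _) _.
  apply: (@le_trans _ _ (total_weight theta * ln (2 * S))); last first.
    by have := small; nra.
  rewrite /total_weight mulr_suml; apply: ler_sum => i _; rewrite normrM.
  apply: ler_wpM2l => //; rewrite ler_norml; apply/andP; split.
    rewrite lerNl -lnV ?posrE// ler_ln ?posrE ?invr_gt0 ?mulr_gt0//.
    by have := le_S i; have := S_ge1; lra.
  by rewrite ler_ln ?posrE ?mulr_gt0//; have := le2 i; have := S_ge1; lra.
rewrite -[leRHS](lnK (x := 2 * S)) ?posrE ?mulr_gt0// /potential expr2 -expRD ler_expR.
by move: le1; rewrite ler_norml => /andP[]; lra.
Qed.

Lemma potential_le_inverses : potential theta eps x <= 1 + S.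
Proof.
by have := potential_sqr_le; have := sqr_ge0 (potential theta eps x - 1); nra.
Qed.

(** The factor m = eps/(x_i + eps) satisfies m^2 <= m <= eps S, while the potential squared is at
    most 2 S; the product of the square roots is small with eps and only linear in S, whose mean is
    under control. *)
Lemma potential_defect i :
  potential theta eps x * (eps / (x i 0 + eps)) <= Num.sqrt (2 * eps) * S.
Proof.
have [h _] := x_simplex; have /andP[x0 _] := h i.
have S0 : 0 <= S by apply: le_trans S_ge1.
have v0 := potential_gt0 theta eps x.
pose m := eps / (x i 0 + eps).
have m0 : 0 <= m by rewrite divr_ge0// ltW.
have m1 : m <= 1 by rewrite ler_pdivrMr// mul1r lerDr.
have mS : m <= eps * S by rewrite ler_wpM2l.
have : (potential theta eps x * m) ^+ 2 <= (Num.sqrt (2 * eps) * S) ^+ 2.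
  rewrite [leLHS]exprMn [leRHS]exprMn sqr_sqrtr ?mulr_ge0// (_ : 2 * eps * S ^+ 2 = (2 * S) * (eps * S)); last by ring.
  apply: ler_pM; [by rewrite sqr_ge0|by rewrite sqr_ge0|exact: potential_sqr_le|].
  by apply: (le_trans _ mS); rewrite expr2 ler_piMl.
by rewrite ler_pXn2r// nnegrE mulr_ge0// ?sqrtr_ge0// ltW.
Qed.
End PotentialGrowth.

Section Supermartingale.
Context (R : realType) (d : measure_display) (T : measurableType d)
  (P : probability T R) (n : nat) (W : R -> T -> 'cV[R]_n).
Hypothesis n_ge2 : (2 <= n)%N.
Hypothesis bm : standard_brownian_motion P W.
Variables (b : 'I_n -> 'cV[R]_n -> R) (C : 'I_n -> 'I_n -> 'cV[R]_n -> R)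
  (K : R) (Y : R -> T -> 'cV[R]_n).
Hypothesis Yd : regular_diffusion P W b C K Y.
Hypothesis K_ge0 : 0 <= K.
Variables (beta : 'I_n -> 'cV[R]_n -> R) (alpha : 'I_n -> 'I_n -> 'cV[R]_n -> R) (B : R).
Hypothesis B_ge0 : 0 <= B.
Hypothesis b_beta : forall i x, simplex x -> b i x = x i 0 * beta i x.
Hypothesis C_alpha : forall i k x, simplex x ->
  covariation C i k x = x i 0 * x k 0 * alpha i k x.
Hypothesis beta_bound : forall i x, simplex x -> `|beta i x| <= B.
Hypothesis alpha_bound : forall i k x, simplex x -> `|alpha i k x| <= B.
Variable x0 : 'cV[R]_n.
Hypothesis x0_gt0 : forall i, 0 < x0 i 0.
Hypothesis Y0 : {ae P, forall w, Y 0 w = x0}.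
Variables (theta : 'I_n -> R) (c : R).
Hypothesis small : total_weight theta <= 1 / 2.
Hypothesis negative : forall x, simplex x -> limit_generator beta alpha theta x <= - c.
Let F := augmented_filtration P W.
Let B' := (2 * total_weight theta + total_weight theta ^+ 2) * B.

Let B'_ge0 : 0 <= B'.
Proof. by rewrite mulr_ge0 ?addr_ge0 ?mulr_ge0 ?sqr_ge0 ?total_weight_ge0. Qed.

Let Yge0 r w k : 0 <= Y r w k 0.
Proof. by have [h _] := rd_simplex Yd r w; have /andP[] := h k. Qed.

Let c1 t := \sum_k expR (3 * B * t) / x0 k 0.

Let regularised s t G eps : 0 <= s -> s <= t -> F s G -> 0 < eps -> eps <= 1 ->
  Ex P (fun w => potential theta eps (Y t w) * \1_G w) <=
    expR (- c * (t - s)) * Ex P (fun w => potential theta eps (Y s w) * \1_G w) +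
    (t - s) * n%:R * c1 t * B' * n%:R * expR (`|c| * (t - s)) * Num.sqrt (2 * eps).
Proof.
move=> s0 st FG e0 e1.
have c10 : 0 <= c1 t by apply: sumr_ge0 => k _; rewrite divr_ge0 ?expR_ge0// ltW.
pose del := B' * n%:R * Num.sqrt (2 * eps).
have del0 : 0 <= del by rewrite mulr_ge0 ?sqrtr_ge0// (mulr_ge0 B'_ge0).
have -> : (t - s) * n%:R * c1 t * B' * n%:R * expR (`|c| * (t - s)) * Num.sqrt (2 * eps) =
    (t - s) * (n%:R * c1 t * del) * expR (`|c| * (t - s)) by rewrite /del; ring.
have := @potential_gronwall_pointwise _ _ _ _ _ _ bm _ _ _ _ Yd K_ge0 theta eps e0 e1
  s t G (- c) del (c1 t) s0 st FG del0 c10.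
rewrite normrN; apply.
- move=> x sx; have [h _] := sx.
  have x_gt0 i : 0 < x i 0 + eps by have /andP[x0' _] := h i; rewrite ltr_wpDl.
  have v0 := potential_gt0 theta eps x.
  have g1 := log_generator_limit b_beta C_alpha beta_bound alpha_bound theta e0 sx.
  have g2 := negative sx.
  have g3 : log_generator b C theta eps x <= - c + B' * \sum_i eps / (x i 0 + eps).
    by apply: le_trans g1 _; rewrite lerD2r.
  apply: le_trans (ler_wpM2l (ltW v0) g3) _; rewrite mulrDr [leLHS]addrC [leRHS]addrC.
  rewrite [potential _ _ _ * - c]mulrC lerD2r mulrCA.
  have -> : del * \sum_i (x i 0 + eps)^-1 = B' * (n%:R * (Num.sqrt (2 * eps) * \sum_i (x i 0 + eps)^-1)).
    by rewrite /del; ring.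
  apply: (ler_wpM2l B'_ge0).
  rewrite [leLHS]mulr_sumr [leRHS]mulr_natl -[X in _ *+ X](card_ord n) -sumr_const.
  apply: ler_sum => i _; exact: (potential_defect n_ge2 small (ltW e0) e1 sx x_gt0).
- move=> r i sr rt; have r0 := le_trans s0 sr.
  have [_ h] := regularised_inverse_moment bm Yd K_ge0 B_ge0 b_beta C_alpha beta_bound alpha_bound
    x0_gt0 Y0 i e0 e1 r0.
  apply: le_trans h _; rewrite /c1 (bigD1 i)//= -[leLHS]addr0; apply: lerD.
    apply: ler_wpM2r; first by rewrite invr_ge0 ltW.
    by rewrite ler_expR; apply: ler_wpM2l => //; rewrite mulr_ge0.
  by apply: sumr_ge0 => k _; rewrite divr_ge0 ?expR_ge0// ltW.
Qed.

Let eps_ m : R := harmonic m.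
Let S0 t w := \sum_k expR (- ln (Y t w k 0)).

Let eps_le1 m : eps_ m <= 1.
Proof. by rewrite /eps_ /harmonic/= invf_le1 ?ler1n. Qed.

Let all_gt0 t : 0 <= t -> {ae P, forall w, forall k, 0 < Y t w k 0}.
Proof.
move=> t0; apply: filter_forall => k.
exact: (coordinate_gt0 bm Yd K_ge0 B_ge0 b_beta C_alpha beta_bound alpha_bound x0_gt0 Y0 k t0).
Qed.

Let limit t G : 0 <= t -> F t G -> L1 P (fun w => potential theta 0 (Y t w) * \1_G w) /\
  (fun m => Ex P (fun w => potential theta (eps_ m) (Y t w) * \1_G w)) @ \oo -->
  Ex P (fun w => potential theta 0 (Y t w) * \1_G w).
Proof.
move=> t0 FG; apply: (@Ex_dominated_cvg _ _ _ P _ _ (fun w => 1 + S0 t w)).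
- by move=> m; exact: L1_measurable (potential_event_L1 bm Yd theta (harmonic_gt0 m) (eps_le1 m) t0 FG).
- apply: measurable_funM; last by apply: measurable_indic; exact: filtration_measurable FG.
  exact: (measurable_wrt_fun bm (@potential_adapted _ _ _ _ _ _ _ _ _ _ Yd theta 0 t t0)).
- apply: L1D; first exact: L1_cst.
  apply: L1_sum => k; exact: (inverse_coordinate_L1 bm Yd K_ge0 B_ge0 b_beta C_alpha beta_bound
    alpha_bound x0_gt0 Y0 k t0).
- apply: filterS (all_gt0 t0) => w Yw; apply: cvgMl.
  apply: (@continuous_cvg _ _ _ _ _ _ expR); first exact: continuous_expR.
  apply: cvgN; apply: cvg_sumr => i; apply: cvgMr.
  rewrite addr0; apply: (@continuous_cvg _ _ _ _ _ (fun m => Y t w i 0 + eps_ m) (@ln R)); first exact: continuous_ln.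
  rewrite -[X in _ --> X]addr0; apply: cvgD; first exact: cvg_cst.
  exact: cvg_harmonic.
- apply: filterS (all_gt0 t0) => w Yw m.
  have e0 : 0 < eps_ m := harmonic_gt0 m.
  have v0 := potential_gt0 theta (eps_ m) (Y t w).
  have x_gt0 i : 0 < Y t w i 0 + eps_ m by rewrite addr_gt0.
  have vS := potential_le_inverses n_ge2 small (eps_le1 m) (rd_simplex Yd t w) x_gt0.
  rewrite normrM (gtr0_norm v0) ger0_norm ?indicE ?ler0n//.
  apply: (@le_trans _ _ (potential theta (eps_ m) (Y t w))).
    by rewrite (ler_piMr (ltW v0))//; case: (_ \in _).
  apply: le_trans vS _; rewrite lerD2l /S0; apply: ler_sum => k _.
  by rewrite expRN lnK ?posrE// lef_pV2 ?posrE// lerDl ltW.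
Qed.

Lemma potential_L1 t : 0 <= t -> L1 P (fun w => potential theta 0 (Y t w)).
Proof.
move=> t0; have FT : F t setT by exact: measurable_wrt_setT.
have [+ _] := limit t0 FT.
by under [X in L1 P X]eq_fun do rewrite indicE in_setT mulr1.
Qed.

(** Testing against events of the past replaces conditional expectation. The regularised inequality
    has an error of order sqrt(eps), and both sides converge along eps = 1/(m+1) by domination with
    1 plus the sum of the inverse coordinates. *)
Lemma potential_supermartingale s t G : 0 <= s -> s <= t -> F s G ->
  Ex P (fun w => potential theta 0 (Y t w) * \1_G w) <=
    expR (- c * (t - s)) * Ex P (fun w => potential theta 0 (Y s w) * \1_G w).
Proof.
move=> s0 st FG.
have [_ lt] := limit (le_trans s0 st) (filtration_mono st FG).
have [_ ls] := limit s0 FG.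
pose D := (t - s) * n%:R * c1 t * B' * n%:R * expR (`|c| * (t - s)).
have l2 : (fun m => expR (- c * (t - s)) * Ex P (fun w => potential theta (eps_ m) (Y s w) * \1_G w)
    + D * Num.sqrt (2 * eps_ m)) @ \oo -->
    expR (- c * (t - s)) * Ex P (fun w => potential theta 0 (Y s w) * \1_G w) + D * Num.sqrt (2 * 0).
  apply: cvgD; first exact: cvgMr.
  apply: cvgMr; apply: (@continuous_cvg _ _ _ _ _ _ Num.sqrt); first exact: sqrt_continuous.
  by apply: cvgMr; exact: cvg_harmonic.
rewrite mulr0 sqrtr0 mulr0 addr0 in l2.
apply: ler_cvg_to lt l2 _; apply: nearW => m.
by apply: regularised => //; exact: harmonic_gt0.
Qed.
End Supermartingale.

Lemma maximal_inequality (R : realType) (d : measure_display) (T : measurableType d)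
    (P : probability T R) (U : nat -> T -> R) (l : R) :
  let A k := [set w | forall j, (j <= k)%N -> U j w <= l] in
  (forall k w, 0 <= U k w) -> 0 <= l -> (forall k, L1 P (U k)) ->
  (forall k, Ex P (fun w => U k.+1 w * \1_(A k) w) <= Ex P (fun w => U k w * \1_(A k) w)) ->
  forall k, measurable (A k) /\ l * fine (P (~` A k)) <= Ex P (U 0%N).
Proof.
move=> A U0 l0 U1 super k.
have AS m : A m.+1 = A m `&` [set w | U m.+1 w <= l].
  apply/seteqP; split => [w Aw|w [Aw Uw] j].
    by split => [j jm|]; apply: Aw => //; exact: leqW.
  by rewrite leq_eqVlt => /predU1P[->//|]; rewrite ltnS; exact: Aw.
have mU m : measurable [set w | U m w <= l].
  rewrite (_ : [set w | _] = U m @^-1` `]-oo, l]); last first.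
    by apply/seteqP; split => w /=; rewrite in_itv.
  by rewrite -[X in measurable X]setTI; exact: (L1_measurable (U1 m)).
have A0 : A 0%N = [set w | U 0%N w <= l].
  by apply/seteqP; split => w Aw; [exact: Aw|move=> j; rewrite leqn0 => /eqP ->].
have mA m : measurable (A m).
  by elim: m => [|m IH]; rewrite ?A0// AS; exact: measurableI.
split => //.
(* The process is replaced by the constant l once it has exceeded l; the mean of the result does not
   increase, and it dominates l times the indicator of an exceedance. *)
pose V m w := l * (1 - \1_(A m) w) + U m w * \1_(A m) w.
have i1 m : L1 P (fun w => l * (1 - \1_(A m) w)).
  by apply: L1Z; apply: L1B; [exact: L1_cst|exact: L1_indic].
have i2 m m' : L1 P (fun w => U m w * \1_(A m') w).
  apply: (L1_le _ _ (U1 m)).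
    by apply: measurable_funM; [exact: (L1_measurable (U1 m))|exact: measurable_indic].
  move=> w; rewrite normrM (ger0_norm (U0 _ _)) ger0_norm ?indicE//.
  by apply: ler_piMr => //; case: (_ \in _).
have V1 m : L1 P (V m) by exact: L1D.
have EV : Ex P (V k) <= Ex P (U 0%N).
  elim: k => [|k IH].
    apply: Ex_le => // w; rewrite /V indicE.
    case: (boolP (w \in A 0%N)) => [_|]; first by rewrite subrr mulr0 add0r mulr1.
    rewrite A0 notin_setE/= => /negP; rewrite -ltNge => lU.
    by rewrite subr0 mulr1 mulr0 addr0 ltW.
  apply: le_trans IH; rewrite /V (ExD (i1 k) (i2 k k)).
  apply: le_trans (lerD (lexx _) (super k)); rewrite -ExD//.
  apply: Ex_le => [||w]; [exact: V1|exact: L1D|].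
  rewrite AS indicI/=; set a := \1_(A k) w.
  have /orP[/eqP ->|/eqP ->] : (a == 0) || (a == 1).
    by rewrite /a indicE; case: (_ \in _); rewrite ?eqxx ?orbT.
  - by rewrite mul0r.
  - rewrite !mul1r mulr1 subrr mulr0 add0r indicE.
    case: (boolP (w \in _)) => [_|]; first by rewrite subrr mulr0 add0r mulr1.
    rewrite notin_setE/= => /negP; rewrite -ltNge => lU.
    by rewrite subr0 mulr1 mulr0 addr0 ltW.
apply: le_trans EV; rewrite -lee_fin EFinM fineK ?fin_num_measure//; last exact: measurableC.
rewrite -(Ex_indic P)//; last exact: measurableC.
rewrite -EFinM lee_fin -ExZ; last by apply: L1_indic; exact: measurableC.
apply: Ex_le => [||w]; [by apply: L1Z; apply: L1_indic; exact: measurableC|exact: V1|].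
rewrite /V indicC/= indicE; case: (w \in _) => /=.
  by rewrite mulr0 subrr mulr0 add0r mulr1.
by rewrite subr0 !mulr1 mulr0 addr0.
Qed.

Lemma cvg_prodr (R : realType) (U : Type) (F : set_system U) (FF : Filter F)
    (I : Type) (s : seq I) (f : I -> U -> R) (l : I -> R) :
  (forall i, f i x @[x --> F] --> l i) ->
  \prod_(i <- s) f i x @[x --> F] --> \prod_(i <- s) l i.
Proof.
move=> fl; elim: s => [|i s IH].
  by rewrite big_nil; under eq_fun do rewrite big_nil; exact: cvg_cst.
by rewrite big_cons; under eq_fun do rewrite big_cons; apply: cvgM.
Qed.

(** * Exponential decay of the product of the coordinates *)

Section Decay.
Context (R : realType) (d : measure_display) (T : measurableType d)
  (P : probability T R) (n : nat) (W : R -> T -> 'cV[R]_n).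
Hypothesis n_ge2 : (2 <= n)%N.
Hypothesis bm : standard_brownian_motion P W.
Variables (b : 'I_n -> 'cV[R]_n -> R) (C : 'I_n -> 'I_n -> 'cV[R]_n -> R)
  (K : R) (Y : R -> T -> 'cV[R]_n).
Hypothesis Yd : regular_diffusion P W b C K Y.
Hypothesis K_ge0 : 0 <= K.
Variables (beta : 'I_n -> 'cV[R]_n -> R) (alpha : 'I_n -> 'I_n -> 'cV[R]_n -> R) (B : R).
Hypothesis B_ge0 : 0 <= B.
Hypothesis b_beta : forall i x, simplex x -> b i x = x i 0 * beta i x.
Hypothesis C_alpha : forall i k x, simplex x ->
  covariation C i k x = x i 0 * x k 0 * alpha i k x.
Hypothesis beta_bound : forall i x, simplex x -> `|beta i x| <= B.
Hypothesis alpha_bound : forall i k x, simplex x -> `|alpha i k x| <= B.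
Variable x0 : 'cV[R]_n.
Hypothesis x0_gt0 : forall i, 0 < x0 i 0.
Hypothesis Y0 : {ae P, forall w, Y 0 w = x0}.
Variables (theta : 'I_n -> R) (c : R).
Hypothesis small : total_weight theta <= 1 / 2.
Hypothesis negative : forall x, simplex x -> limit_generator beta alpha theta x <= - c.
Hypothesis Ycont : forall i, continuous_paths (component Y i).
Let F := augmented_filtration P W.

Let U q w := expR (c * q) * potential theta 0 (Y q w).

Let grid m k : R := k%:R / 2 ^+ m.

Let grid_ge0 m k : 0 <= grid m k.
Proof. by rewrite divr_ge0// exprn_ge0. Qed.

Let A m l k := [set w | forall j, (j <= k)%N -> U (grid m j) w <= l].

Let A_event m l k : F (grid m k) (A m l k).
Proof.
have FU q : 0 <= q -> F q [set w | U q w <= l].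
  move=> q0; apply: measurable_wrt_le; last exact: measurable_wrt_cst.
  apply: measurable_wrtM; first exact: measurable_wrt_cst.
  exact: (potential_adapted Yd).
elim: k => [|k IH].
  rewrite (_ : A m l 0 = [set w | U (grid m 0) w <= l]); first exact: FU.
  by apply/seteqP; split => w Aw; [exact: Aw|move=> j; rewrite leqn0 => /eqP ->].
rewrite (_ : A m l k.+1 = A m l k `&` [set w | U (grid m k.+1) w <= l]); last first.
  apply/seteqP; split => [w Aw|w [Aw Uw] j].
    by split => [j jm|]; apply: Aw => //; exact: leqW.
  by rewrite leq_eqVlt => /predU1P[->//|]; rewrite ltnS; exact: Aw.
apply: measurable_wrtTI; last exact: FU.
apply: filtration_mono IH; rewrite ler_wpM2r ?invr_ge0 ?exprn_ge0//.
by rewrite ler_nat.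
Qed.

(** The factor exp(c q) in [U] compensates exactly the decay of the potential, so [U] is a
    supermartingale along each dyadic grid and its initial mean is the potential at x0. *)
Let grid_exceedance m (l : R) k : 0 <= l ->
  measurable (A m l k) /\ l * fine (P (~` A m l k)) <= potential theta 0 x0.
Proof.
move=> l0.
have U1 q : 0 <= q -> L1 P (U q).
  move=> q0; apply: L1Z.
  exact: (potential_L1 n_ge2 bm Yd K_ge0 B_ge0 b_beta C_alpha beta_bound alpha_bound
    x0_gt0 Y0 small q0).
have := @maximal_inequality _ _ _ P (fun j => U (grid m j)) l _ l0 _ _ k.
rewrite -/(A m l k) => -[||j|mA h].
- by move=> j w; rewrite mulr_ge0 ?expR_ge0// ltW ?potential_gt0.
- by move=> j; exact: U1.
- have gS : grid m j <= grid m j.+1.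
    by rewrite ler_wpM2r ?invr_ge0 ?exprn_ge0// ler_nat.
  have := potential_supermartingale n_ge2 bm Yd K_ge0 B_ge0 b_beta C_alpha beta_bound alpha_bound
    x0_gt0 Y0 small negative (grid_ge0 m j) gS (@A_event m l j).
  have iv j' : L1 P (fun w => potential theta 0 (Y (grid m j') w) * \1_(A m l j) w).
    apply: (L1_le (g := potential theta 0 \o Y (grid m j'))).
    - apply: measurable_funM; last by apply: measurable_indic; exact: filtration_measurable (@A_event m l j).
      exact: (measurable_wrt_fun bm (@potential_adapted _ _ _ _ _ _ _ _ _ _ Yd theta 0 _ (grid_ge0 m j'))).
    - move=> w; rewrite normrM (gtr0_norm (potential_gt0 _ _ _)) ger0_norm ?indicE//=.
      by apply: ler_piMr; [exact/ltW/potential_gt0|case: (_ \in _)].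
    - exact: (potential_L1 n_ge2 bm Yd K_ge0 B_ge0 b_beta C_alpha beta_bound alpha_bound
        x0_gt0 Y0 small (grid_ge0 m j')).
  under [X in _ -> Ex P X <= _]eq_fun do rewrite -mulrA.
  under [X in _ -> _ <= Ex P X]eq_fun do rewrite -mulrA.
  rewrite (ExZ _ (iv j.+1)) (ExZ _ (iv j)) => h.
  apply: le_trans (ler_wpM2l (expR_ge0 (c * grid m j.+1)) h) _.
  by rewrite mulrA -expRD; rewrite le_eqVlt; apply/orP; left; apply/eqP; congr (expR _ * _); ring.
- split => //; apply: le_trans h _; rewrite -(Ex_cst P (potential theta 0 x0)).
  apply: Ex_ae_le; [exact: U1|exact: L1_cst|].
  by apply: filterS Y0 => w E; rewrite /U /grid mul0r mulr0 expR0 mul1r E.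
Qed.

(** With mesh 2^-m the index 4^m reaches time 2^m, so both mesh and horizon improve with m. The
    exceedance events increase in m, and continuity from below keeps the bound potential/l for their
    union; then l grows. *)
Let dyadic_bound : {ae P, forall w, exists l : nat, forall m, A m l%:R (4 ^ m) w}.
Proof.
pose G l := \bigcup_m ~` A m l%:R (4 ^ m).
have mA m (l : nat) : measurable (A m l%:R (4 ^ m)).
  by have [] := grid_exceedance m (4 ^ m) (ler0n R l).
have mG l : measurable (G l) by apply: bigcupT_measurable => m; exact: measurableC.
have PG l : (0 < l)%N -> (P (G l) <= (potential theta 0 x0 / l%:R)%:E)%E.
  move=> l0; have l0' : 0 < l%:R :> R by rewrite ltr0n.
  have nd : nondecreasing_seq (fun m => ~` A m l%:R (4 ^ m)).
    apply/nondecreasing_seqP => m; apply/subsetPset; apply: subsetC => w Aw j jm.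
    (* A grid point of level m is the point of twice the index at level m + 1, and twice 4^m is
       still at most 4^(m+1). *)
    have := Aw (j * 2)%N; rewrite expnSr (_ : grid m.+1 (j * 2) = grid m j); last first.
      by rewrite /grid exprSr natrM -mulf_div divff ?mulr1.
    by apply; rewrite leq_mul.
  have := nondecreasing_cvg_mu (mu := P) (fun m => measurableC (mA m l)) (mG l) nd.
  move=> h; rewrite -(cvg_lim _ h)//; apply: lime_le; first by apply/cvg_ex; exists (P (G l)).
  apply: nearW => m; have [_] := grid_exceedance m (4 ^ m) (ltW l0').
  have fA : P (~` A m l%:R (4 ^ m)) \is a fin_num.
    by rewrite fin_num_measure//; exact: measurableC.
  by rewrite -[X in (X <= _)%E](fineK fA) lee_fin ler_pdivlMr// mulrC.
exists (\bigcap_l G l); split.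
- exact: bigcapT_measurable.
- apply/eqP; rewrite eq_le measure_ge0 andbT; apply/lee_addgt0Pr => e e0; rewrite add0e.
  pose l := (Num.truncn (potential theta 0 x0 / e)).+1.
  apply: (@le_trans _ _ (P (G l))).
    apply: le_measure; rewrite ?inE//; first exact: bigcapT_measurable.
    by move=> w; apply.
  apply: le_trans (PG l _) _ => //; rewrite lee_fin ler_pdivrMr ?ltr0n// mulrC -ler_pdivrMr//.
  exact/ltW/truncnS_gt.
- move=> w /= nw l _; apply: contrapT => nG; apply: nw; exists l => m.
  by apply: contrapT => nA; apply: nG; exists m.
Qed.

(** As |theta_i| <= 1 and ln x_i <= 0, each -theta_i ln x_i is at least ln x_i. On the boundary the
    product vanishes while the potential is positive by construction. *)
Let prod_le_potential x : simplex x -> \prod_i x i 0 <= potential theta 0 x.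
Proof.
move=> [h _].
have [[i xi]|pos] := pselect (exists i, x i 0 = 0).
  by rewrite (bigD1 i)//= xi mul0r ltW// potential_gt0.
have x_gt0 i : 0 < x i 0.
  by have /andP[xi _] := h i; rewrite lt_neqAle xi andbT eq_sym; apply/eqP => E; apply: pos; exists i.
have -> : \prod_i x i 0 = expR (\sum_i ln (x i 0)).
  by rewrite expR_sum; apply: eq_bigr => i _; rewrite lnK ?posrE.
rewrite ler_expR lerNr -sumrN; apply: ler_sum => i _; rewrite addr0.
have th : `|theta i| <= 1.
  have := small; rewrite /total_weight (bigD1 i)//=.
  have : 0 <= \sum_(j < n | j != i) `|theta j| by apply: sumr_ge0.
  by lra.
have L : ln (x i 0) <= 0 by have /andP[_ x1] := h i; exact: ln_le0.
by move: th; rewrite ler_norml; move: (ln _) L => z z0; nra.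
Qed.

(** The product of coordinates is continuous along paths even at the boundary, where the potential
    is singular; so the bound at dyadic times extends to all times without knowing that a path stays
    in the interior. *)
Lemma product_decay : {ae P, forall w, exists l : R, forall t, 0 <= t ->
  \prod_i Y t w i 0 <= l * expR (- c * t)}.
Proof.
apply: filterS dyadic_bound => w [l Al]; exists l%:R => t t0.
(* [q m] is the dyadic time just below t; its index is at most 4^m as soon as t <= 2^m. *)
pose N m := Num.truncn (t * 2 ^+ m); pose q m := grid m (N m).
have p0 m : 0 < 2 ^+ m :> R by rewrite exprn_gt0.
have tm0 m : 0 <= t * 2 ^+ m by rewrite mulr_ge0// ltW.
have qt m : q m <= t by rewrite ler_pdivrMr// /N truncn_le tm0.
have tq m : t - 2^-1 ^+ m <= q m.
  rewrite lerBlDr exprVn -[X in _ + X]mul1r -mulrDl ler_pdivlMr// natr1.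
  exact/ltW/truncnS_gt.
have cq : q @ \oo --> t.
  apply: (@squeeze_cvgr _ _ _ _ (fun m => t - 2^-1 ^+ m) (fun=> t)).
  - by apply: nearW => m; rewrite tq qt.
  - rewrite -[X in _ --> X]subr0; apply: cvgB; first exact: cvg_cst.
    by apply: cvg_expr; rewrite ger0_norm; lra.
  - exact: cvg_cst.
have small_grid m : t <= 2 ^+ m -> (N m <= 4 ^ m)%N.
  move=> tm; rewrite /N -(ler_nat R); apply: (@le_trans _ _ (t * 2 ^+ m)).
    by rewrite truncn_le tm0.
  by rewrite natrX (_ : 4%:R = 2 * 2 :> R) ?exprMn ?ler_wpM2r// ?ltW//; ring.
have lhs : (fun m => \prod_i Y (q m) w i 0) @ \oo --> \prod_i Y t w i 0.
  apply: cvg_prodr => i.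
  have ct := @continuous_paths_max0 _ _ _ (component Y i) w (@Ycont i).
  have := @continuous_cvg _ _ _ _ _ q (fun r : R => component Y i (Num.max 0 r) w) t (ct t) cq.
  rewrite /component (max_idPr t0).
  have -> : (fun m => Y (q m) w i 0) = (fun r : R => Y (Num.max 0 r) w i 0) \o q.
    by apply/funext => m /=; rewrite (max_idPr (grid_ge0 _ _)).
  exact.
have rhs : (fun m => l%:R * expR (- c * q m)) @ \oo --> l%:R * expR (- c * t).
  apply: cvgMr; apply: (@continuous_cvg _ _ _ _ _ _ expR); first exact: continuous_expR.
  exact: cvgMr.
apply: ler_cvg_to lhs rhs _.
near=> m.
have := Al m (N m); rewrite -/(q m) => h.
apply: le_trans (prod_le_potential (rd_simplex Yd _ _)) _.
have e0 := expR_gt0 (c * q m).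
have E : expR (c * q m) * (l%:R * expR (- c * q m)) = l%:R.
  by rewrite mulNr expRN mulrCA mulfV ?mulr1 ?gt_eqF.
rewrite -(ler_pM2l e0) E.
apply: h; apply: small_grid; near: m.
exists (Num.truncn t).+1 => // j /= tj; apply/ltW/(lt_le_trans (truncnS_gt t)).
by rewrite -natrX ler_nat; exact: leq_trans tj (ltnW (ltn_expl _ _)).
Unshelve. all: by end_near.
Qed.
End Decay.

(** * Separation on the simplex and distance to its boundary *)

Lemma simplex_convex (R : realType) n (p r : 'cV[R]_n) (s : R) : 0 <= s -> s <= 1 ->
  simplex p -> simplex r -> simplex ((1 - s) *: p + s *: r).
Proof.
move=> s0 s1 [hp sp] [hr sr]; split => [i|].
  have /andP[p0 p1] := hp i; have /andP[r0 r1] := hr i.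
  by rewrite !mxE; apply/andP; split; nra.
under eq_bigr do rewrite !mxE.
by rewrite big_split/= -!mulr_sumr sp sr; ring.
Qed.

Lemma simplex_compact (R : realType) n : compact [set v : 'rV[R]_n | simplex v^T].
Proof.
rewrite (_ : [set v | _] = [set v : 'rV[R]_n | forall i, `[0, 1]%classic (v ord0 i)] `&`
    [set v | \sum_i v ord0 i = 1]); last first.
  apply/seteqP; split => [v [h s]|v [h s]]; split.
  - by move=> i; have := h i; rewrite !mxE /= in_itv.
  - by rewrite /= -s; apply: eq_bigr => i _; rewrite mxE.
  - by move=> i; have := h i; rewrite !mxE /= in_itv.
  - by rewrite -s; apply: eq_bigr => i _; rewrite mxE.
apply: compact_closedI; first exact: (@rV_compact R n (fun=> `[0, 1]%classic) (fun=> @segment_compact R 0 1)).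
apply: (@closed_comp _ _ (fun v : 'rV[R]_n => \sum_i v ord0 i) [set x : R | x = 1]).
  move=> v _; apply: (cvg_sumr (nbhs_filter v)) => i; exact: coord_continuous.
exact: closed_eq.
Qed.

Lemma simplex_delta (R : realType) n (i : 'I_n) : simplex (delta_mx i 0 : 'cV[R]_n).
Proof.
split => [k|]; first by rewrite mxE ler0n lern1 leq_b1.
by rewrite (bigD1 i)//= mxE !eqxx big1 ?addr0// => k /negPf ki; rewrite mxE ki.
Qed.

(* The normal of the separating hyperplane is the centred image [g p] of the
   point [p] of the simplex at which the image comes closest to the diagonal. *)
Lemma separating_direction (R : realType) n (M : 'M[R]_n) : (0 < n)%N ->
  (~ exists p : 'cV[R]_n, simplex p /\ forall i j : 'I_n, (M *m p) i 0 = (M *m p) j 0) ->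
  exists q : 'I_n -> R, exists2 del, 0 < del &
    \sum_i q i = 0 /\ forall p, simplex p -> del <= \sum_i q i * (M *m p) i 0.
Proof.
move=> n0 noeq.
have n0' : n%:R != 0 :> R by rewrite pnatr_eq0 -lt0n.
pose g (p : 'cV[R]_n) i := (M *m p) i 0 - n%:R^-1 * \sum_j (M *m p) j 0.
have g_sum p : \sum_i g p i = 0.
  rewrite sumrB; set S := \sum_j _.
  rewrite sumr_const card_ord -[X in _ - X]mulr_natl mulrA divff// mul1r.
  exact: subrr.
have gL (s : R) p r i : g ((1 - s) *: p + s *: r) i = (1 - s) * g p i + s * g r i.
  have ML k : (M *m ((1 - s) *: p + s *: r)) k 0 = (1 - s) * (M *m p) k 0 + s * (M *m r) k 0.
    by rewrite mulmxDr -!scalemxAr [LHS]mxE [X in X + _]mxE [X in _ + X]mxE.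
  rewrite /g ML; under [X in _ - _ * X]eq_bigr do rewrite ML.
  by rewrite big_split/= -!mulr_sumr; ring.
pose f (p : 'cV[R]_n) := \sum_i g p i ^+ 2.
have fc : continuous (fun v : 'rV[R]_n => f v^T).
  move=> v; apply: (cvg_sumr (nbhs_filter v)) => i.
  have cM k : (fun v : 'rV[R]_n => (M *m v^T) k 0) @ v --> (M *m v^T) k 0.
    rewrite (_ : (fun _ => _) = fun v : 'rV[R]_n => \sum_j M k j * v ord0 j); last first.
      by apply/funext => u; rewrite mxE; apply: eq_bigr => j _; rewrite mxE.
    rewrite [X in _ --> X](_ : _ = \sum_j M k j * v ord0 j); last first.
      by rewrite mxE; apply: eq_bigr => j _; rewrite mxE.
    by apply: (cvg_sumr (nbhs_filter v)) => j; apply: cvgMr; exact: coord_continuous.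
  have cg : (fun v : 'rV[R]_n => g v^T i) @ v --> g v^T i.
    apply: (@cvgB _ _ _ (nbhs v) (nbhs_filter v)); first exact: cM.
    by apply: (@cvgMr _ _ (nbhs v) (nbhs_filter v)); apply: (cvg_sumr (nbhs_filter v)) => k; exact: cM.
  by apply: (@cvgM _ _ (nbhs v) (nbhs_filter v)).
have [v vS vmin] : exists2 v, v \in [set v : 'rV[R]_n | simplex v^T] &
    forall u, u \in [set v : 'rV[R]_n | simplex v^T] -> f v^T <= f u^T.
  apply: (@EVT_min_rV _ _ (fun v => f v^T)).
  - by exists (delta_mx (Ordinal n0) 0)^T; rewrite /= trmxK; exact: simplex_delta.
  - exact: simplex_compact.
  - exact: continuous_subspaceT.
pose p0 := v^T; rewrite inE in vS.
have fmin p : simplex p -> f p0 <= f p.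
  by move=> sp; rewrite -[p]trmxK; apply: vmin; rewrite inE /= trmxK.
exists (g p0), (f p0); last split => //.
  rewrite lt_neqAle sumr_ge0 ?andbT; last by move=> i _; exact: sqr_ge0.
  apply/eqP => /esym/eqP; rewrite psumr_eq0; last by move=> i _; exact: sqr_ge0.
  move=> /allP g0; apply: noeq; exists p0; split => // i j.
  have gz k : g p0 k = 0 by have := g0 k (mem_index_enum k); rewrite sqrf_eq0 => /eqP.
  by have := gz i; have := gz j; rewrite /g; lra.
move=> p sp.
(* The components of [g p0] sum to zero, so pairing with it does not see the centring. *)
have -> : \sum_i g p0 i * (M *m p) i 0 = \sum_i g p0 i * g p i.
  rewrite /(g p); under [RHS]eq_bigr do rewrite mulrBr.
  by rewrite sumrB -mulr_suml g_sum mul0r subr0.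
pose D := \sum_i g p0 i * (g p i - g p0 i); pose E := \sum_i (g p i - g p0 i) ^+ 2.
have E0 : 0 <= E by apply: sumr_ge0 => i _; exact: sqr_ge0.
have -> : \sum_i g p0 i * g p i = D + f p0.
  by rewrite /D /f -big_split/=; apply: eq_bigr => i _; ring.
rewrite lerDr leNgt; apply/negP => D0.
have key s : 0 <= s -> s <= 1 -> 0 <= s * (2 * D + s * E).
  move=> s0 s1; have := fmin _ (simplex_convex s0 s1 vS sp).
  have -> : f ((1 - s) *: p0 + s *: p) = f p0 + s * (2 * D + s * E).
    rewrite /f /D /E !mulr_sumr -big_split/= mulr_sumr -big_split/=.
    by apply: eq_bigr => i _; rewrite gL; ring.
  by rewrite lerDl.
have ED : 0 < E - D by lra.
(* If D were negative, moving from the minimiser towards p by this fraction, which lies in [0, 1],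
   would give 2 D + s E = D (E - 2 D)/(E - D) < 0 and lower the distance. *)
have := key (- D / (E - D)); rewrite ler_pdivlMr// mul0r ler_pdivrMr// mul1r => h.
have {h} : 0 <= (- D / (E - D)) * (2 * D + - D / (E - D) * E) by apply: h; lra.
rewrite pmulr_rge0; last by rewrite divr_gt0//; lra.
have -> : 2 * D + - D / (E - D) * E = D * (E - 2 * D) / (E - D) by field; rewrite gt_eqF.
rewrite ler_pdivlMr// mul0r; nra.
Qed.

Lemma dist_simplex_bd (R : realType) n (x : 'cV[R]_n) i : (2 <= n)%N -> simplex x ->
  0 <= dist_to simplex_bd x <= 2 * x i 0.
Proof.
move=> n2 [hx sx].
have [j ij] : exists j : 'I_n, j != i.
  have n0 : (0 < n)%N by exact: ltnW.
  have [->|] := eqVneq i (Ordinal n0); first by exists (Ordinal n2).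
  by rewrite eq_sym; exists (Ordinal n0).
(* Moving the mass of coordinate i to another coordinate reaches the boundary at Euclidean distance
   sqrt(2) x_i. *)
pose y : 'cV[R]_n := \col_k (if k == i then 0 else if k == j then x j 0 + x i 0 else x k 0).
have yi : y i 0 = 0 by rewrite mxE eqxx.
have yj : y j 0 = x j 0 + x i 0 by rewrite mxE (negPf ij) eqxx.
have yk k : k != i -> k != j -> y k 0 = x k 0 by rewrite mxE => /negPf -> /negPf ->.
have split_sum (f : 'I_n -> R) : \sum_k f k = f i + (f j + \sum_(k < n | (k != i) && (k != j)) f k).
  by rewrite (bigD1 i)//= (bigD1 j)//=.
have y_sum : \sum_k y k 0 = 1.
  rewrite split_sum yi yj (eq_bigr (fun k => x k 0)); last by move=> k /andP[]; exact: yk.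
  by move: sx; rewrite split_sum; lra.
have y_ge0 k : 0 <= y k 0.
  have /andP[xk _] := hx k; have /andP[xi _] := hx i; have /andP[xj _] := hx j.
  by rewrite mxE; case: (k == i) => //; case: (k == j); rewrite ?addr_ge0.
have yS : simplex y.
  split => // k; rewrite y_ge0/= -y_sum (bigD1 k)//= lerDl.
  by apply: sumr_ge0 => l _.
have yB : simplex_bd y by split => // -[_ /(_ i)]; rewrite yi ltxx.
have xi : 0 <= x i 0 by have /andP[] := hx i.
have d0 z : 0 <= euclidean_dist x z by exact: sqrtr_ge0.
have dy : euclidean_dist x y <= 2 * x i 0.
  rewrite /euclidean_dist split_sum yi yj subr0 big1 => [|k /andP[ki kj]]; last first.
    by rewrite yk// subrr expr0n.
  rewrite -[leRHS]ger0_norm ?mulr_ge0// -sqrtr_sqr; apply: ler_wsqrtr.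
  by have := sqr_ge0 (x i 0); rewrite !expr2; nra.
apply/andP; split.
  by apply: lb_le_inf; [exists (euclidean_dist x y), y|move=> _ [z _ <-]].
apply: le_trans dy; apply: ge_inf; last by exists y.
by exists 0 => _ [z _ <-].
Qed.

(** If the distance is at least e, every coordinate is at least e/2, so the product is at least
    (e/2)^n; exponential decay excludes this for large t. *)
Lemma dist_simplex_bd_cvg (R : realType) n (x : R -> 'cV[R]_n) (l c : R) :
  (2 <= n)%N -> 0 < c -> (forall t, 0 <= t -> simplex (x t)) ->
  (forall t, 0 <= t -> \prod_i x t i 0 <= l * expR (- c * t)) ->
  dist_to simplex_bd (x t) @[t --> +oo] --> 0.
Proof.
move=> n2 c0 sx decay; apply/cvgrPdist_lt => e e0.
pose del := (e / 2) ^+ n.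
have del0 : 0 < del by rewrite exprn_gt0// divr_gt0.
near=> t.
have t0 : 0 <= t by near: t; apply: nbhs_pinfty_ge; exact: num_real.
(* Chosen so that exp(c t) >= 1 + c t already exceeds l / del. *)
have tl : l / (del * c) < t by near: t; apply: nbhs_pinfty_gt; exact: num_real.
have dist i := dist_simplex_bd i n2 (sx t t0).
have /andP[d0 _] := dist (Ordinal (ltnW n2)).
rewrite sub0r normrN ger0_norm// ltNge; apply/negP => ed.
have : del <= \prod_i x t i 0.
  rewrite /del -[X in _ ^+ X](card_ord n) -prodr_const.
  apply: ler_prod => i _; have /andP[_ di] := dist i.
  by apply/andP; split; lra.
apply/negP; rewrite -ltNge; apply: le_lt_trans (decay t t0) _.
rewrite mulNr expRN ltr_pdivrMr ?expR_gt0//.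
apply: lt_le_trans (ler_wpM2l (ltW del0) (expR_ge1Dx _)).
rewrite ltr_pdivrMr ?mulr_gt0// in tl.
by move: tl; nra.
Unshelve. all: by end_near.
Qed.

(** * The replicator coefficients *)

Section ReplicatorCoefficients.
Context (R : realType) (n : nat) (A : 'M[R]_n) (sigma : 'I_n -> R).
Hypothesis sigma_gt0 : forall i, 0 < sigma i.
Let G : 'M[R]_n := A - diag_mx (\row_i (sigma i ^+ 2)).

Definition relative_drift i (x : 'cV[R]_n) : R :=
  (G *m x) i 0 - \sum_l x l 0 * (G *m x) l 0.

Definition relative_covariation i k (x : 'cV[R]_n) : R :=
  \sum_j ((i == j)%:R - x j 0) * ((k == j)%:R - x j 0) * sigma j ^+ 2.

Lemma replicator_driftE i x : replicator_drift A sigma x i 0 = x i 0 * relative_drift i x.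
Proof.
rewrite /replicator_drift /relative_drift -/G -mulmxA; move: (G *m x) => u.
rewrite mulmxBl mul_diag_mx -mulmxA !mxE big_ord1 !mxE mulrBr.
by congr (_ - _ * _); apply: eq_bigr => l _; rewrite mxE.
Qed.

Lemma replicator_diffusionE i j x : replicator_diffusion sigma x i j =
  x i 0 * ((i == j)%:R - x j 0) * sigma j.
Proof.
rewrite /replicator_diffusion mul_mx_diag !mxE big_ord1 !mxE.
by rewrite mulrBr; case: eqP => [->|_]; rewrite ?mulr1n ?mulr0n ?mulr1 ?mulr0.
Qed.

Let C i j x := replicator_diffusion sigma x i j.

Lemma replicator_covariation i k x :
  covariation C i k x = x i 0 * x k 0 * relative_covariation i k x.
Proof.
rewrite /covariation /C /relative_covariation mulr_sumr; apply: eq_bigr => j _.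
by rewrite !replicator_diffusionE; ring.
Qed.

Let a : R := \sum_i \sum_j `|G i j|.
Let Ss : R := \sum_i sigma i.
Let S2 : R := \sum_i sigma i ^+ 2.

(** One constant serves both as bound and as Lipschitz constant. For the drift, the product rule
    gives 2 a from the size of the relative drift and 3 a from its variation; the diffusion
    coefficients account for 2 Ss. *)
Definition replicator_bound : R := 5 * a + 2 * Ss.
Definition relative_bound : R := 2 * a + S2.

Let a_ge0 : 0 <= a.
Proof. by apply: sumr_ge0 => i _; apply: sumr_ge0. Qed.

Let Ss_ge0 : 0 <= Ss.
Proof. by apply: sumr_ge0 => i _; exact: ltW. Qed.

Let S2_ge0 : 0 <= S2.
Proof. by apply: sumr_ge0 => i _; exact: sqr_ge0. Qed.

Lemma replicator_bound_ge0 : 0 <= replicator_bound.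
Proof. by rewrite /replicator_bound; have := a_ge0; have := Ss_ge0; lra. Qed.

Lemma relative_bound_ge0 : 0 <= relative_bound.
Proof. by rewrite /relative_bound; have := a_ge0; have := S2_ge0; lra. Qed.

Let linear_bound i (u : 'cV[R]_n) (M : R) : (forall k, `|u k 0| <= M) -> `|(G *m u) i 0| <= a * M.
Proof.
move=> uM; rewrite mxE; apply: le_trans (ler_norm_sum _ _ _) _.
have M0 : 0 <= M by apply: le_trans (uM i).
apply: (@le_trans _ _ ((\sum_j `|G i j|) * M)).
  by rewrite mulr_suml; apply: ler_sum => j _; rewrite normrM ler_wpM2l.
apply: ler_wpM2r => //; rewrite /a [leRHS](bigD1 i)//= lerDl.
by apply: sumr_ge0 => k _; exact: sumr_ge0.
Qed.

Let simplex_norm (x : 'cV[R]_n) k : simplex x -> `|x k 0| <= 1.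
Proof. by move=> [h _]; have /andP[x0 x1] := h k; rewrite ger0_norm. Qed.

Let G_bound i x : simplex x -> `|(G *m x) i 0| <= a.
Proof.
move=> sx; rewrite -[a]mulr1; apply: linear_bound => k; exact: simplex_norm.
Qed.

Let average_bound (x : 'cV[R]_n) (f : 'I_n -> R) (M : R) : simplex x -> (forall i, `|f i| <= M) ->
  `|\sum_l x l 0 * f l| <= M.
Proof.
move=> [h s] fM; apply: le_trans (ler_norm_sum _ _ _) _.
rewrite -[leRHS]mul1r -s mulr_suml; apply: ler_sum => l _.
by have /andP[x0 _] := h l; rewrite normrM ger0_norm// ler_wpM2l.
Qed.

Let relative_drift_bound0 i x : simplex x -> `|relative_drift i x| <= 2 * a.
Proof.
move=> sx; apply: le_trans (ler_normB _ _) _.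
have := G_bound i sx; have := average_bound sx (fun k => G_bound k sx).
by move: (`|_|) (`|_|) => p q; lra.
Qed.

Lemma relative_drift_bound i x : simplex x -> `|relative_drift i x| <= relative_bound.
Proof.
move=> sx; apply: le_trans (relative_drift_bound0 i sx) _.
by rewrite /relative_bound lerDl.
Qed.

Let delta_bound (i j : 'I_n) (x : 'cV[R]_n) : simplex x -> `|(i == j)%:R - x j 0| <= 1.
Proof.
move=> [h _]; have /andP[x0 x1] := h j; rewrite ler_norml.
by case: (i == j) => /=; apply/andP; split; lra.
Qed.

Lemma relative_covariation_bound i k x : simplex x ->
  `|relative_covariation i k x| <= relative_bound.
Proof.
move=> sx; apply: (@le_trans _ _ S2); last first.
  by rewrite /relative_bound lerDr mulr_ge0.
apply: le_trans (ler_norm_sum _ _ _) _; apply: ler_sum => j _.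
rewrite normrM [X in _ * X]ger0_norm ?sqr_ge0// -[leRHS]mul1r.
apply: ler_wpM2r; first exact: sqr_ge0.
by rewrite normrM mulr_ile1// delta_bound.
Qed.

Let sigma_le j : sigma j <= Ss.
Proof. by rewrite /Ss (bigD1 j)//= lerDl; apply: sumr_ge0 => k _; exact: ltW. Qed.

Lemma replicator_drift_bound i x : simplex x ->
  `|replicator_drift A sigma x i 0| <= replicator_bound.
Proof.
move=> sx; rewrite replicator_driftE normrM.
have x1 := simplex_norm i sx; have r1 := relative_drift_bound0 i sx.
apply: (@le_trans _ _ (1 * (2 * a))); first exact: ler_pM.
by rewrite /replicator_bound; have := a_ge0; have := Ss_ge0; lra.
Qed.

Lemma replicator_diffusion_bound i j x : simplex x ->
  `|replicator_diffusion sigma x i j| <= replicator_bound.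
Proof.
move=> sx; rewrite replicator_diffusionE !normrM (gtr0_norm (sigma_gt0 j)).
have x1 := simplex_norm i sx; have r1 := delta_bound i j sx.
apply: (@le_trans _ _ (1 * Ss)).
  by apply: ler_pM; rewrite ?mulr_ge0 ?sigma_le ?mulr_ile1// ltW.
by rewrite /replicator_bound; have := a_ge0; have := Ss_ge0; lra.
Qed.

Section Lipschitz.
Variables (x y : 'cV[R]_n).
Hypotheses (sx : simplex x) (sy : simplex y).
Let Dxy := \sum_k `|x k 0 - y k 0|.

Let coord_le k : `|x k 0 - y k 0| <= Dxy.
Proof. by rewrite /Dxy (bigD1 k)//= lerDl; apply: sumr_ge0. Qed.

Let D_ge0 : 0 <= Dxy.
Proof. by apply: sumr_ge0. Qed.

Lemma replicator_diffusion_lip i j :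
  `|replicator_diffusion sigma x i j - replicator_diffusion sigma y i j| <= replicator_bound * Dxy.
Proof.
rewrite !replicator_diffusionE.
have -> : x i 0 * ((i == j)%:R - x j 0) * sigma j - y i 0 * ((i == j)%:R - y j 0) * sigma j =
  sigma j * ((x i 0 - y i 0) * ((i == j)%:R - x j 0) - y i 0 * (x j 0 - y j 0)) by ring.
rewrite normrM (gtr0_norm (sigma_gt0 j)).
have h : `|(x i 0 - y i 0) * ((i == j)%:R - x j 0) - y i 0 * (x j 0 - y j 0)| <= 2 * Dxy.
  have h1 : `|(x i 0 - y i 0) * ((i == j)%:R - x j 0)| <= Dxy.
    by rewrite normrM -[leRHS]mulr1; apply: ler_pM => //; exact: delta_bound.
  have h2 : `|y i 0 * (x j 0 - y j 0)| <= Dxy.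
    by rewrite normrM -[leRHS]mul1r; apply: ler_pM => //; exact: simplex_norm.
  by apply: le_trans (ler_normB _ _) _; move: h1 h2; lra.
apply: (@le_trans _ _ (Ss * (2 * Dxy))).
  by apply: ler_pM => //; exact: ltW.
rewrite /replicator_bound mulrA [leRHS]mulrDl [Ss * 2]mulrC lerDr.
by rewrite mulr_ge0 ?mulr_ge0.
Qed.

Lemma replicator_drift_lip i :
  `|replicator_drift A sigma x i 0 - replicator_drift A sigma y i 0| <= replicator_bound * Dxy.
Proof.
rewrite !replicator_driftE.
have GL k : `|(G *m x) k 0 - (G *m y) k 0| <= a * Dxy.
  have -> : (G *m x) k 0 - (G *m y) k 0 = (G *m (x - y)) k 0 by rewrite mulmxBr [RHS]mxE [X in _ = _ + X]mxE.
  by apply: linear_bound => l; rewrite !mxE.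
have avg : `|\sum_l x l 0 * (G *m x) l 0 - \sum_l y l 0 * (G *m y) l 0| <= 2 * a * Dxy.
  have -> : \sum_l x l 0 * (G *m x) l 0 - \sum_l y l 0 * (G *m y) l 0 =
      \sum_l (x l 0 - y l 0) * (G *m x) l 0 + \sum_l y l 0 * ((G *m x) l 0 - (G *m y) l 0).
    by rewrite -sumrB -big_split/=; apply: eq_bigr => l _; ring.
  have h1 : `|\sum_l (x l 0 - y l 0) * (G *m x) l 0| <= a * Dxy.
    apply: le_trans (ler_norm_sum _ _ _) _; rewrite mulrC /Dxy mulr_suml.
    by apply: ler_sum => l _; rewrite normrM ler_wpM2l// G_bound.
  have h2 := average_bound sy GL.
  by apply: le_trans (ler_normD _ _) _; move: h1 h2; lra.
have rel : `|relative_drift i x - relative_drift i y| <= 3 * a * Dxy.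
  rewrite /relative_drift.
  have -> : forall p q r s : R, p - q - (r - s) = (p - r) - (q - s) by move=> *; ring.
  by apply: le_trans (ler_normB _ _) _; move: (GL i) avg; lra.
have -> : x i 0 * relative_drift i x - y i 0 * relative_drift i y =
  (x i 0 - y i 0) * relative_drift i x + y i 0 * (relative_drift i x - relative_drift i y) by ring.
have h1 : `|(x i 0 - y i 0) * relative_drift i x| <= Dxy * (2 * a).
  by rewrite normrM; apply: ler_pM => //; exact: relative_drift_bound0.
have h2 : `|y i 0 * (relative_drift i x - relative_drift i y)| <= 1 * (3 * a * Dxy).
  by rewrite normrM; apply: ler_pM => //; exact: simplex_norm.
apply: le_trans (ler_normD _ _) _.
have := mulr_ge0 Ss_ge0 D_ge0; rewrite /replicator_bound.
by move: h1 h2; lra.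
Qed.
End Lipschitz.

(** Since the theta_i sum to zero, all averages over x drop out. The term sigma_i^2 x_i of the drift
    cancels the one from the diagonal covariations, leaving sigma_i^2 / 2; multiplied by sum x_j = 1
    it becomes the correction in [modified_payoff]. *)
Lemma replicator_limit_generator (theta : 'I_n -> R) x : \sum_i theta i = 0 -> simplex x ->
  limit_generator relative_drift relative_covariation theta x =
  - (\sum_i theta i * (modified_payoff A sigma *m x) i 0) + (\sum_j theta j ^+ 2 * sigma j ^+ 2) / 2.
Proof.
move=> th0 [_ sx]; rewrite /limit_generator.
have e1 : \sum_i theta i * relative_drift i x =
    \sum_i theta i * (A *m x) i 0 - \sum_i theta i * (sigma i ^+ 2 * x i 0).
  rewrite /relative_drift; under eq_bigr do rewrite mulrBr.
  rewrite sumrB -mulr_suml th0 mul0r subr0 -sumrB; apply: eq_bigr => i _.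
  by rewrite /G mulmxBl mul_diag_mx !mxE; ring.
have dsum i (f : 'I_n -> R) : \sum_j (i == j)%:R * f j = f i.
  rewrite (bigD1 i)//= eqxx mul1r big1 ?addr0// => j ji.
  by rewrite eq_sym (negPf ji) mul0r.
have e2 : \sum_i theta i * relative_covariation i i x =
    \sum_i theta i * sigma i ^+ 2 - 2 * \sum_i theta i * (sigma i ^+ 2 * x i 0).
  have -> : \sum_i theta i * relative_covariation i i x =
      \sum_i (theta i * (sigma i ^+ 2 - 2 * (sigma i ^+ 2 * x i 0)) +
              theta i * \sum_j x j 0 ^+ 2 * sigma j ^+ 2).
    apply: eq_bigr => i _; rewrite -mulrDr; congr (_ * _).
    rewrite /relative_covariation.
    rewrite -(dsum i (fun j => sigma j ^+ 2 - 2 * (sigma j ^+ 2 * x j 0))) -big_split/=.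
    apply: eq_bigr => j _; case: (i == j) => /=; ring.
  rewrite big_split/= -mulr_suml th0 mul0r addr0 mulr_sumr -sumrB.
  by apply: eq_bigr => i _; ring.
have e3 : \sum_i \sum_k theta i * theta k * relative_covariation i k x =
    \sum_j theta j ^+ 2 * sigma j ^+ 2.
  have -> : \sum_j theta j ^+ 2 * sigma j ^+ 2 =
      \sum_j (\sum_i theta i * ((i == j)%:R - x j 0)) ^+ 2 * sigma j ^+ 2.
    apply: eq_bigr => j _; congr (_ ^+ 2 * _).
    under [RHS]eq_bigr do rewrite mulrBr eq_sym mulrC.
    by rewrite sumrB dsum -mulr_suml th0 mul0r subr0.
  under [RHS]eq_bigr do rewrite expr2 mulr_suml mulr_suml.
  rewrite [RHS]exchange_big/=; apply: eq_bigr => i _.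
  under [RHS]eq_bigr do rewrite mulr_sumr mulr_suml.
  rewrite [RHS]exchange_big/=; apply: eq_bigr => k _.
  by rewrite /relative_covariation mulr_sumr; apply: eq_bigr => j _; ring.
have e4 : \sum_i theta i * (modified_payoff A sigma *m x) i 0 =
    \sum_i theta i * (A *m x) i 0 - (\sum_i theta i * sigma i ^+ 2) / 2.
  rewrite mulr_suml -sumrB; apply: eq_bigr => i _.
  have -> : (modified_payoff A sigma *m x) i 0 = (A *m x) i 0 - sigma i ^+ 2 / 2 * \sum_j x j 0.
    rewrite !mxE mulr_sumr -sumrB; apply: eq_bigr => j _; rewrite !mxE; ring.
  by rewrite sx; ring.
by rewrite e1 e2 e3 e4; field.
Qed.
End ReplicatorCoefficients.

Section CoefficientMeasurability.
Context (R : realType) (d : measure_display) (U : measurableType d) (n : nat).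
Variables (A : 'M[R]_n) (sigma : 'I_n -> R) (f : U -> 'cV[R]_n).
Hypothesis mf : forall i, measurable_fun setT (fun u => f u i 0).

Lemma replicator_drift_measurable i :
  measurable_fun setT (fun u => replicator_drift A sigma (f u) i 0).
Proof.
have mG k : measurable_fun setT
    (fun u => ((A - diag_mx (\row_i (sigma i ^+ 2))) *m f u) k 0).
  rewrite (_ : (fun _ => _) = (fun u => \sum_j (A - diag_mx (\row_i (sigma i ^+ 2))) k j * f u j 0)).
    by apply: measurable_sum => j; apply: measurable_funM.
  by apply/funext => u; rewrite mxE.
under eq_fun do rewrite replicator_driftE.
apply: measurable_funM => //; apply: measurable_funB; first exact: mG.
by apply: measurable_sum => l; apply: measurable_funM.
Qed.

Lemma replicator_diffusion_measurable i j :
  measurable_fun setT (fun u => replicator_diffusion sigma (f u) i j).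
Proof.
under eq_fun do rewrite replicator_diffusionE.
apply: measurable_funM => //; apply: measurable_funM => //.
exact: measurable_funB.
Qed.
End CoefficientMeasurability.

(** * A version of the process with all paths in the simplex *)

Section Realisation.
Context (R : realType) (d : measure_display) (T : measurableType d)
  (P : probability T R) (n : nat) (W : R -> T -> 'cV[R]_n)
  (A : 'M[R]_n) (sigma : 'I_n -> R) (x0 : 'cV[R]_n) (X : R -> T -> 'cV[R]_n).
Hypothesis sigma_gt0 : forall i, 0 < sigma i.
Hypothesis bm : standard_brownian_motion P W.
Hypothesis x0_simplex : simplex x0.
Hypothesis X_replicator : stochastic_replicator P W A sigma x0 X.
Let F := augmented_filtration P W.
Let b i (x : 'cV[R]_n) := replicator_drift A sigma x i 0.
Let C i j (x : 'cV[R]_n) := replicator_diffusion sigma x i j.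
Let K := replicator_bound A sigma.

(* Redefining [X] on a null event and at negative times makes every path live
   in the simplex without affecting adaptedness, as the filtration is complete. *)
Lemma replicator_realisation : exists Y : R -> T -> 'cV[R]_n,
  [/\ regular_diffusion P W b C K Y, {ae P, forall w, Y 0 w = x0},
      forall i, continuous_paths (component Y i) &
      {ae P, forall w, forall t, 0 <= t -> Y t w = X t w}].
Proof.
have [sX solX] := X_replicator.
have [N [mN PN NX]] : exists N, [/\ measurable N, P N = 0%E &
    forall w, ~ N w -> X 0 w = x0 /\ forall t, 0 <= t -> simplex (X t w)].
  have [N [mN PN sub]] : {ae P, forall w, X 0 w = x0 /\ forall t, 0 <= t -> simplex (X t w)}.
    by near=> w; split; near: w; [exact: (sol_start solX)|exact: sX].
  exists N; split => // w nN; apply: contrapT => h; exact/nN/sub.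
pose X' i (r : R) w := if w \in N then x0 i 0 else X r w i 0.
pose Y (r : R) w := if w \in N then x0 else X (Num.max 0 r) w.
have YE i : component Y i = fun r w => X' i (Num.max 0 r) w.
  by apply/funext => r; apply/funext => w; rewrite /component /Y /X'; case: (w \in N).
have YX w (r : R) : ~ N w -> 0 <= r -> Y r w = X r w.
  by move=> nN r0; rewrite /Y memNset// (max_idPr r0).
have aeN : {ae P, forall w, ~ N w}.
  by exists N; split => // w /= /contrapT.
have YS (r : R) w : simplex (Y r w).
  rewrite /Y; case: (boolP (w \in N)) => // /negP; rewrite inE => nN.
  by have [_] := NX w nN; apply; rewrite le_max lexx.
have cX' i : continuous_paths (X' i).
  move=> w; rewrite /X'; case: (w \in N); last exact: (sol_continuous solX).
  by apply: continuous_subspaceT => t; exact: cvg_cst.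
have cX : forall i, continuous_paths (component X i) by exact: (sol_continuous solX).
have mX i (r : R) : 0 <= r -> measurable_fun setT (component X i r).
  by move=> r0; exact: (measurable_wrt_fun bm (sol_adapted solX i r0)).
have aX' i (r : R) : 0 <= r -> measurable_wrt (F r) (X' i r).
  (* The exceptional event is null, hence belongs to the augmented filtration at every time. *)
  move=> r0; rewrite (_ : X' i r = fun w => \1_N w * x0 i 0 + (1 - \1_N w) * component X i r w).
    have FN : F r N by exact: filtration_null.
    have mI := measurable_wrt_indic FN.
    apply: measurable_wrtD; apply: measurable_wrtM => //; try exact: measurable_wrt_cst.
    - apply: measurable_wrtB => //; exact: measurable_wrt_cst.
    - exact: (sol_adapted solX).
  apply/funext => w; rewrite /X' indicE; case: (w \in N) => /=.
    by rewrite mul1r subrr mul0r addr0.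
  by rewrite mul0r subr0 mul1r add0r.
have aY i (r : R) : 0 <= r -> measurable_wrt (F r) (component Y i r).
  by move=> r0; rewrite YE (max_idPr r0); exact: aX'.
have jY i : jointly_measurable (component Y i).
  rewrite YE; apply: jointly_measurable_continuous => // r r0.
  exact: (measurable_wrt_fun bm (aX' i r r0)).
have jX i : jointly_measurable (fun r w => X (Num.max 0 r) w i 0).
  by have := @jointly_measurable_continuous _ _ _ (component X i) (cX i) (mX i).
have jb i : jointly_measurable (fun r w => b i (Y r w)).
  exact: (@replicator_drift_measurable R _ (measurableTypeR R * T)%type n A sigma
    (fun z => Y z.1 z.2) jY i).
have jC i j : jointly_measurable (fun r w => C i j (Y r w)).
  exact: (@replicator_diffusion_measurable R _ (measurableTypeR R * T)%type n sigma
    (fun z => Y z.1 z.2) jY i j).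
have jCX i j : jointly_measurable (fun r w => C i j (X (Num.max 0 r) w)).
  exact: (@replicator_diffusion_measurable R _ (measurableTypeR R * T)%type n sigma
    (fun z => X (Num.max 0 z.1) z.2) jX i j).
exists Y; split.
- split.
  + exact: YS.
  + by move=> i s; exact: aY.
  + exact: jb.
  + move=> i s s0; apply/measurable_wrtP.
    apply: replicator_drift_measurable => k; apply/measurable_wrtP; exact: aY.
  + exact: jC.
  + move=> i j s s0; apply/measurable_wrtP.
    apply: replicator_diffusion_measurable => k; apply/measurable_wrtP; exact: aY.
  + by move=> i x; exact: replicator_drift_bound.
  + by move=> i j x; exact: replicator_diffusion_bound.
  + by move=> i x y sx_ sy_; exact: replicator_drift_lip.
  + by move=> i j x y sx_ sy_; exact: replicator_diffusion_lip.
  + move=> s t i s0 st; have t0 := le_trans s0 st.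
    have [Js [JsI Jse]] := sol_equation solX s0 i.
    have [Jt [JtI Jte]] := sol_equation solX t0 i.
    exists (fun j w => Jt j w - Js j w); split.
      move=> j zeta gam mz [M zM] Hg.
      (* The given integrals have integrands built from [X]; the version built from [Y] supplies
         joint measurability and the bound [K + M] on every path. *)
      apply: (@ito_increment _ _ _ P _ W bm j s t (fun r w => C i j (X r w))
        (fun r w => C i j (Y r w)) (Js j) (Jt j) zeta (K + M) gam) => //.
      * by apply: filterS aeN => w nN r r0; rewrite YX.
      * by exists M.
      * move=> r w _ _; apply: le_trans (ler_normB _ _) _; apply: lerD => //.
        exact/replicator_diffusion_bound/YS.
    near=> w.
    have nN : ~ N w by near: w.
    have Es : X s w i 0 = x0 i 0 + (\int[lebesgue_measure]_(r in `[0, s]) b i (X r w)) + \sum_j Js j w.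
      by near: w.
    have Et : X t w i 0 = x0 i 0 + (\int[lebesgue_measure]_(r in `[0, t]) b i (X r w)) + \sum_j Jt j w.
      by near: w.
    rewrite !YX// Es Et sumrB.
    have IE q : 0 <= q -> \int[lebesgue_measure]_(r in `[0, q]) b i (X r w) =
        \int[lebesgue_measure]_(r in `[0, q]) b i (Y r w).
      move=> q0; apply: eq_Rintegral => r; rewrite inE/= in_itv/= => /andP[r0 _].
      by rewrite YX.
    have ib : lebesgue_measure.-integrable `[0, t] (EFin \o (fun r => b i (Y r w))).
      have fin : (lebesgue_measure (`[0%R, t]%classic : set R) < +oo)%E.
        by rewrite lebesgue_measure_itv/= lte_fin; case: ifP => _; rewrite -?EFinB ltry.
      apply: measurable_bounded_integrable => //.
      - apply: measurable_funTS; exact: (jointly_measurable_path w (jb i)).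
      - exists K; split; first exact: num_real.
        by move=> x Kx r _ /=; apply: le_trans (ltW Kx); exact/replicator_drift_bound/YS.
    rewrite !IE//.
    have := @Rintegral_itvB R (fun r => b i (Y r w)) (BLeft 0) (BRight t) s ib.
    rewrite !bnd_simp => /(_ s0 st); rewrite Rintegral_itv_obnd_cbnd; last first.
      apply: integrableS ib => // r /=; rewrite !in_itv/= => /andP[sr ->].
      by rewrite andbT (le_trans s0)// ltW.
    by move=> <-; move: (\int[_]_(_ in _) _) (\int[_]_(_ in _) _) => p q; ring.
- by apply: filterS aeN => w nN; rewrite YX//; have [] := NX w nN.
- move=> i w; rewrite YE; apply: continuous_subspaceT.
  exact: (@continuous_paths_max0 _ _ _ (X' i) w (cX' i)).
- by apply: filterS aeN => w nN t t0; exact: YX.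
Unshelve. all: by end_near.
Qed.
End Realisation.

(** * Choice of the exponents and conclusion *)

(** For theta = e q the separation gains e del and the noise costs e^2 S / 2; once e S <= del, half
    of the gain is left. *)
Lemma negative_generator (R : realType) (n : nat) (A : 'M[R]_n) (sigma : 'I_n -> R) :
  (0 < n)%N ->
  (~ exists p : 'cV[R]_n, simplex p /\
     forall i j : 'I_n,
       (modified_payoff A sigma *m p) i 0 = (modified_payoff A sigma *m p) j 0) ->
  exists theta : 'I_n -> R, exists2 c, 0 < c &
    total_weight theta <= 1 / 2 /\ forall x, simplex x ->
      limit_generator (relative_drift A sigma) (relative_covariation sigma) theta x <= - c.
Proof.
move=> n0 /(separating_direction n0) [q [del del0 [q0 sep]]].
pose S := \sum_j q j ^+ 2 * sigma j ^+ 2; pose k := total_weight q.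
have S0 : 0 <= S by apply: sumr_ge0 => j _; rewrite mulr_ge0 ?sqr_ge0.
have k0 : 0 <= k := total_weight_ge0 q.
(* The summands secure, in turn, total weight at most 1/2, the inequality e S <= del, and a nonzero
   denominator. *)
pose D := 2 * k + S / del + 1.
have Sd0 : 0 <= S / del by rewrite divr_ge0// ltW.
have D1 : 1 <= D by rewrite /D; lra.
have D0 : 0 < D by lra.
pose e := D^-1.
have e0 : 0 < e by rewrite invr_gt0.
have ek : e * k <= 1 / 2.
  by rewrite /e mulrC ler_pdivrMr// /D; lra.
have eS : e * S <= del.
  by rewrite /e mulrC ler_pdivrMr// mulrC -ler_pdivrMr// /D; lra.
exists (fun i => e * q i), (e * del / 2); first by rewrite divr_gt0// mulr_gt0.
split.
  rewrite /total_weight; under eq_bigr do rewrite normrM (gtr0_norm e0).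
  by rewrite -mulr_sumr.
move=> x sx; rewrite replicator_limit_generator//; last by rewrite -mulr_sumr q0 mulr0.
have -> : \sum_i e * q i * (modified_payoff A sigma *m x) i 0 =
    e * \sum_i q i * (modified_payoff A sigma *m x) i 0.
  by rewrite mulr_sumr; apply: eq_bigr => i _; rewrite mulrA.
have -> : \sum_j (e * q j) ^+ 2 * sigma j ^+ 2 = e * (e * S).
  by rewrite /S !mulr_sumr; apply: eq_bigr => j _; ring.
have := ler_wpM2l (ltW e0) (sep x sx); have := ler_wpM2l (ltW e0) eS.
by lra.
Qed.

Theorem theorem4p1 (R : realType) (d : measure_display) (T : measurableType d)
    (P : probability T R) (n : nat) (A : 'M[R]_n) (sigma : 'I_n -> R)
    (W : R -> T -> 'cV[R]_n) (x0 : 'cV[R]_n) (X : R -> T -> 'cV[R]_n)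
    (n_ge2 : (2 <= n)%N)
    (sigma_gt0 : forall i, 0 < sigma i)
    (W_bm : standard_brownian_motion P W)
    (x0_int : simplex_int x0)
    (X_replicator : stochastic_replicator P W A sigma x0 X)
    (no_equalizer : ~ exists p : 'cV[R]_n, simplex p /\
       forall i j : 'I_n,
         (modified_payoff A sigma *m p) i 0 = (modified_payoff A sigma *m p) j 0) :
  transient P X.
Proof.
have [x0S x0_gt0] := x0_int.
have [Y [Yd Y0 Yc YX]] := replicator_realisation sigma_gt0 W_bm x0S X_replicator.
have [theta [c c0 [small neg]]] := negative_generator (ltnW n_ge2) no_equalizer.
have := product_decay n_ge2 W_bm Yd (replicator_bound_ge0 A sigma_gt0) (relative_bound_ge0 A sigma)
  (fun i x _ => replicator_driftE A sigma i x) (fun i k x _ => replicator_covariation sigma i k x)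
  (@relative_drift_bound _ _ _ _) (@relative_covariation_bound _ _ _ _) x0_gt0 Y0 small neg Yc.
apply: filterS2 YX => w YXw [l decay].
apply: (dist_simplex_bd_cvg (l := l) n_ge2 c0) => t t0.
- by rewrite -YXw//; exact: (rd_simplex Yd).
- by rewrite -YXw//; exact: decay.
Qed.
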